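(* Let $\Phi$ be an irreducible and reduced root system of type $t \neq F_4$ in a finite-dimensional real inner product space $(V,\langle\,,\,\rangle)$, with Weyl group $W$ and Coxeter number $h$. Let $P \subseteq V$ be a symmetric alcoved polytope of type $t$. Then $P$ has a generating set consisting of $h$ vertices of $P$.
   Context: An (generalized) alcoved polytope of type $t$ is a bounded set of the form $\bigcap_{a \in \Psi}\{x \in V : \langle a, x\rangle \le c_a\}$, where $\Psi$ is a subset of a root system $\Phi$ of type $t$ in $V$ and $c_a \in \mathbb{R}$. The Weyl group $W$ is the group of orthogonal maps of $V$ generated by the reflections in the hyperplanes $\{x : \langle a,x\rangle = 0\}$, $a \in \Phi$. An alcoved polytope is symmetric if it is invariant under the action of $W$. A subset $\Sigma \subseteq V$ is a generating set of an alcoved polytope $P$ if $P$ is the smallest alcoved polytope (for the root system $\Phi$) in $V$ containing $\Sigma$. The Coxeter number $h$ is the order in $W$ of a Coxeter element $s_{b_1}\circ\cdots\circ s_{b_n}$, where $b_1,\dots,b_n$ is a basis of simple roots of $\Phi$ and $s_b$ is the reflection associated to $b$.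
   Formalization: P is assumed nonempty (the empty set has no vertices), and the h vertices are claimed to be pairwise distinct only when P is not the single point {0}, which has one vertex although h ≥ 2; for P = {0} they may repeat. *)

(* Defs.v *)
From HB Require Import structures.
From mathcomp Require Import all_boot all_order all_algebra.
From mathcomp Require Import finmap boolp classical_sets reals.

Set Implicit Arguments.
Unset Strict Implicit.
Unset Printing Implicit Defensive.

Import Order.TTheory GRing.Theory Num.Theory.
Local Open Scope ring_scope.

Section RootSystems.
Variables (R : realType) (V : vectType R) (ip : {dot V for idfun}).
Implicit Types (Phi : {fset V}) (P : set V) (a b : V).

Definition cartan_number a b : R := 2 * ip a b / ip b b.

Definition reflection a (x : V) : V := x - cartan_number x a *: a.

Definition root_system Phi : Prop :=
  [/\ 0 \notin Phi,
      (<< enum_fset Phi >> = fullv)%VS,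
      (forall a b, a \in Phi -> b \in Phi -> reflection a b \in Phi)
    & (forall a b, a \in Phi -> b \in Phi ->
         exists z : int, cartan_number a b = z%:~R)].

Definition reduced Phi : Prop :=
  forall a (t : R), a \in Phi -> t *: a \in Phi -> t = 1 \/ t = -1.

Definition irreducible Phi : Prop :=
  Phi <> fset0 /\
  forall A : {fset V}, {subset A <= Phi} ->
    (forall a b, a \in A -> b \in Phi -> b \notin A -> ip a b = 0) ->
    A = fset0 \/ A = Phi.

(* Inverses are required as in any generated group, although they are
   redundant here because reflections are involutions. *)
Inductive weyl_group Phi : (V -> V) -> Prop :=
| weyl_reflection a : a \in Phi -> weyl_group Phi (reflection a)
| weyl_id : weyl_group Phi id
| weyl_comp f g :
    weyl_group Phi f -> weyl_group Phi g -> weyl_group Phi (f \o g)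
| weyl_inv f g :
    weyl_group Phi f -> cancel f g -> cancel g f -> weyl_group Phi g.

Definition simple_roots Phi (b : seq V) : Prop :=
  [/\ {subset b <= Phi},
      basis_of fullv b
    & (forall a, a \in Phi -> exists k : 'I_(size b) -> nat,
         a = \sum_(i < size b) b`_i *+ k i \/
         a = - \sum_(i < size b) b`_i *+ k i)].

Definition coxeter_element (b : seq V) : V -> V :=
  foldr (fun a f => reflection a \o f) id b.

Definition has_order (f : V -> V) (h : nat) : Prop :=
  [/\ (0 < h)%N,
      iter h f =1 id
    & (forall k, (0 < k < h)%N -> ~ (iter k f =1 id))].

(* The order does not depend on the choice of the simple roots b, nor on
   their ordering. *)
Definition coxeter_number Phi (h : nat) : Prop :=
  exists b : seq V, simple_roots Phi b /\ has_order (coxeter_element b) h.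

Definition F4_cartan : seq (seq int) :=
  [:: [::  2; -1;  0;  0];
      [:: -1;  2; -2;  0];
      [::  0; -1;  2; -1];
      [::  0;  0; -1;  2]].

Definition type_F4 Phi : Prop :=
  exists b : seq V,
    [/\ simple_roots Phi b, size b = 4%N
      & (forall i j, (i < 4)%N -> (j < 4)%N ->
           cartan_number b`_i b`_j = (nth 0 (nth [::] F4_cartan i) j)%:~R)].

Definition bounded P : Prop :=
  exists M : R, forall x, P x -> Num.sqrt (ip x x) <= M.

Definition alcoved_polytope Phi P : Prop :=
  bounded P /\
  exists (Psi : {fset V}) (c : V -> R),
    {subset Psi <= Phi} /\
    P = [set x | forall a, a \in Psi -> ip a x <= c a]%classic.

Definition weyl_symmetric Phi P : Prop :=
  forall w, weyl_group Phi w -> (w @` P = P)%classic.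

Definition generating_set Phi P (S : set V) : Prop :=
  [/\ alcoved_polytope Phi P,
      (S `<=` P)%classic
    & (forall Q : set V,
         alcoved_polytope Phi Q -> (S `<=` Q)%classic -> (P `<=` Q)%classic)].

(* A vertex is a zero-dimensional face: the linear form <u, .> attains its
   maximum over P exactly at v. *)
Definition vertex P (v : V) : Prop :=
  P v /\ exists u : V, forall x, P x -> x <> v -> ip u x < ip u v.

End RootSystems.

(* Main.v *)
Require Import Defs.
From HB Require Import structures.
From mathcomp Require Import all_boot all_order all_algebra.
From mathcomp Require Import finmap boolp classical_sets reals.
From mathcomp Require Import zify ring lra.

(** Every symmetric alcoved polytope has the form {x : <a, x> <= c_a} with c constant
    on Weyl orbits of roots, so a set of vertices generates it as soon as each of its
    root-supporting faces contains one of them. The roots fall into the Dynkin types,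
    and each type has h vertices meeting all these faces:
    - A_n: the vectors e_k (projected), k = 0..n;
    - B_n, C_n: after normalising P to |x_i| <= al and |x_i| + |x_j| <= be with
      al <= be <= 2 al, the vectors +-v_i, where v_i has coordinate al at i,
      be - al before i and al - be after i;
    - D_n: the vectors +-(1, .., -1, .., 1) / 2 with the -1 at one of n - 1 places;
    - G_2, E_6, E_7, E_8: the orbit of one vertex under the Coxeter element; for E_n a
      computation checks that every orbit of roots contains one maximal at it.
    The order h of a Coxeter element is computed in one ordering of the simple roots:
    the diagram is a tree, so all orderings give conjugate elements. *)

Set Implicit Arguments.
Unset Strict Implicit.
Unset Printing Implicit Defensive.

Import Order.TTheory GRing.Theory Num.Theory.
Local Open Scope ring_scope.

(** * Inner products and reflections *)

(** Say that a vertex settles a root if the root attains its maximum over [P] there. A Weyl element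
    carries a settled root to one settled by the image vertex, so the images of one vertex under the
    powers of a Coxeter element suffice as soon as that vertex settles a root in every Coxeter orbit
    of roots. With two root lengths the bounds on long and on short roots are independent data and
    one of them may be slack; lowering both to values attained on [P] gives inequalities such as al
    <= be <= 2 al, which put the proposed points inside [P]. Only a root system is given, so its
    Dynkin type has to be derived from the simple roots. The main tool is Bessel's inequality: the
    projections of a node on orthogonal neighbours, arms or contracted chains have total square
    below its own, strictly so because a dual basis vector witnesses independence. F_4 comes out as
    one of the cases and is excluded by hypothesis. When [P] is the origin alone it has a single
    vertex, so distinctness of the h vertices is asked for only when [P] differs from it. *)

Section InnerProduct.
Variables (R : realType) (V : vectType R) (ip : {dot V for idfun}).
Implicit Types (x y z a : V) (b : seq V).

Lemma ipC x y : ip x y = ip y x.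
Proof. by rewrite hermC expr0 mul1r. Qed.
Lemma ipDl x y z : ip (x + y) z = ip x z + ip y z.
Proof. exact: linearDl. Qed.
Lemma ipDr x y z : ip z (x + y) = ip z x + ip z y.
Proof. exact: linearDr. Qed.
Lemma ipZl (k : R) x y : ip (k *: x) y = k * ip x y.
Proof. exact: linearZl_LR. Qed.
Lemma ipZr (k : R) x y : ip x (k *: y) = k * ip x y.
Proof. by rewrite ipC ipZl ipC. Qed.
Lemma ipNl x y : ip (- x) y = - ip x y.
Proof. exact: linearNl. Qed.
Lemma ipNr x y : ip x (- y) = - ip x y.
Proof. exact: linearNr. Qed.
Lemma ipBl x y z : ip (x - y) z = ip x z - ip y z.
Proof. exact: linearBl. Qed.
Lemma ipBr x y z : ip z (x - y) = ip z x - ip z y.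
Proof. exact: linearBr. Qed.
Lemma ip0l x : ip 0 x = 0.
Proof. exact: linear0l. Qed.
Lemma ip0r x : ip x 0 = 0.
Proof. exact: linear0r. Qed.
Lemma ip_suml (I : Type) (r : seq I) (Q : pred I) (F : I -> V) y :
  ip (\sum_(i <- r | Q i) F i) y = \sum_(i <- r | Q i) ip (F i) y.
Proof. exact: linear_sumlz. Qed.
Lemma ip_sumr (I : Type) (r : seq I) (Q : pred I) (F : I -> V) y :
  ip y (\sum_(i <- r | Q i) F i) = \sum_(i <- r | Q i) ip y (F i).
Proof. exact: linear_sumr. Qed.
Lemma ip_gt0 x : (0 < ip x x) = (x != 0).
Proof.
have [->|x0] := eqVneq; first by rewrite ip0l ltxx.
exact: (@neq0_dnorm_gt0 _ _ _ ip).
Qed.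
Lemma ip_ge0 x : 0 <= ip x x.
Proof. by have [->|x0] := eqVneq x 0; rewrite ?ip0l// ltW// ip_gt0. Qed.

Definition ipE := (ipDl, ipDr, ipBl, ipBr, ipNl, ipNr, ipZl, ipZr).

Lemma ip_eq0_span b x : (<<b>> = fullv)%VS -> {in b, forall y, ip y x = 0} ->
  x = 0.
Proof.
move=> bV bx; apply/eqP; rewrite -[_ == 0]negbK -ip_gt0 -leNgt.
have xb : x \in <<in_tuple b>>%VS by rewrite bV memvf.
rewrite {1}(coord_span xb).
rewrite ip_suml big1 // => i _; rewrite ipZl bx ?mulr0//.
by rewrite mem_nth.
Qed.

(** The map sending a vector to its products with [b] has trivial kernel, so it is onto by
    dimension. Prescribing values on the simple roots in this way later produces dual vectors,
    frames and vertices. *)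
Lemma riesz b (f : V -> R) : basis_of fullv b ->
  exists v, {in b, forall x, ip x v = f x}.
Proof.
move=> bV; have bsp : (<<b>> = fullv)%VS by case/andP: bV => /eqP.
pose phi (v : V) : 'rV[R]_(size b) := \row_i ip b`_i v.
have philin : linear phi.
  by move=> k x y; apply/rowP => i; rewrite !mxE ipDr ipZr.
pose phiL := GRing.isLinear.Build _ _ _ _ phi philin.
pose phi' : {linear V -> 'rV[R]_(size b)} := HB.pack phi phiL.
pose g := linfun phi'.
have kg : lker g = 0%VS.
  apply/eqP; rewrite -subv0; apply/subvP => x; rewrite memv_ker lfunE /= => /eqP.
  move=> /rowP gx; rewrite memv0; apply/eqP/(ip_eq0_span bsp) => y yb.
  have := gx (Ordinal (etrans (index_mem y b) yb)).
  by rewrite !mxE /= nth_index.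
have dimb : size b = \dim {: V} by have := size_basis (X := in_tuple b) bV.
have lg : limg g = fullv.
  apply/eqP; rewrite eqEdim subvf /= limg_dim_eq ?kg ?capv0 //.
  by rewrite dimvf -dimb /dim /= mul1n.
have : \row_i f b`_i \in limg g by rewrite lg memvf.
case/memv_imgP => v _ vE; exists v => x xb.
have /rowP/(_ (Ordinal (etrans (index_mem x b) xb))) := vE.
by rewrite lfunE !mxE /= nth_index.
Qed.

Lemma dual_vector b x : basis_of fullv b -> x \in b ->
  exists d, ip x d = 1 /\ {in b, forall y, y != x -> ip y d = 0}.
Proof.
move=> bV xb; have [d dP] := riesz (fun y => (y == x)%:R) bV.
by exists d; split=> [|y yb /negPf yx]; rewrite dP ?eqxx // yx.
Qed.

Section Reflection.
Variable a : V.
Hypothesis a0 : a != 0.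
Local Notation s := (reflection ip a).

Lemma reflectionE x : s x = x - (2 * ip x a / ip a a) *: a.
Proof. by []. Qed.

Lemma reflection_is_linear k x y : s (k *: x + y) = k *: s x + s y.
Proof.
rewrite /reflection /cartan_number ipDl ipZl scalerBr scalerA addrACA.
rewrite -opprD -scalerDl; congr (_ - _ *: _).
by rewrite mulrDr mulrDl; congr (_ + _); rewrite !mulrA [2 * k]mulrC.
Qed.

Lemma reflection_id : s a = - a.
Proof.
rewrite /reflection /cartan_number mulfK ?gt_eqF ?ip_gt0 //.
by rewrite scaler_nat mulr2n opprD addNKr.
Qed.

Lemma reflection_ip x y : ip (s x) (s y) = ip x y.
Proof.
have aa : ip a a != 0 by rewrite gt_eqF ?ip_gt0.
rewrite /reflection /cartan_number !ipE (ipC a y); by field.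
Qed.

Lemma reflection_invol : involutive s.
Proof.
move=> x; rewrite /reflection /cartan_number ipBl ipZl -addrA -opprD -scalerDl.
have aa : ip a a != 0 by rewrite gt_eqF ?ip_gt0.
by rewrite [X in X *: a](_ : _ = 0) ?scale0r ?subr0 //; field.
Qed.

End Reflection.

Lemma reflection_orth a x : ip x a = 0 -> reflection ip a x = x.
Proof. by move=> xa; rewrite reflectionE xa mulr0 mul0r scale0r subr0. Qed.

End InnerProduct.
Arguments ipC {R V ip} x y.

(** * Simple roots *)

Section SimpleSystem.
Variables (R : realType) (V : vectType R) (ip : {dot V for idfun}).
Variable Phi : {fset V}.

(** Coefficients are indexed by vectors rather than by positions, which makes the notion visibly
    invariant under reordering of [b]. *)
Definition simple_system (b : seq V) : Prop :=
  [/\ {subset b <= Phi}, basis_of fullv b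
    & forall a, a \in Phi -> exists k : V -> nat,
        a = \sum_(x <- b) (k x)%:R *: x \/ a = - \sum_(x <- b) (k x)%:R *: x].

Lemma simple_system_perm b b' : perm_eq b b' ->
  simple_system b -> simple_system b'.
Proof.
move=> bb' [sub bas pos]; split.
- by move=> x; rewrite -(perm_mem bb'); apply: sub.
- by rewrite -(perm_basis _ bb').
- by move=> a /pos [k]; rewrite (perm_big _ bb'); exists k.
Qed.

Lemma simple_roots_system b : simple_roots Phi b -> simple_system b.
Proof.
move=> [sub bas pos]; split=> // a /pos [k aE].
have ub : uniq b by apply: free_uniq; apply: basis_free bas.
pose k' x := oapp k 0%N (insub (index x b)).
exists k'; rewrite (_ : \sum_(x <- b) _ = \sum_(i < size b) b`_i *+ k i) //.
rewrite (big_nth 0) big_mkord; apply: eq_bigr => i _.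
by rewrite scaler_nat /k' index_uniq // valK.
Qed.

Lemma simple_system_roots b : simple_system b -> simple_roots Phi b.
Proof.
move=> [sub bas pos]; split=> // a /pos [k aE].
exists (fun i => k b`_i).
rewrite (_ : \sum_(i < size b) _ = \sum_(x <- b) (k x)%:R *: x) //.
by rewrite (big_nth 0) big_mkord; apply: eq_bigr => i _; rewrite scaler_nat.
Qed.

End SimpleSystem.

(** Meant for the two Cartan integers of a pair of bonded simple roots: Cauchy-Schwarz puts their
    product below 4, which leaves single, double and triple bonds. *)
Lemma negative_pair_lt4 (z w : int) : z <= 0 -> w <= 0 -> z != 0 -> w != 0 ->
  z * w < 4 ->
  exists2 m : nat, (0 < m < 4)%N & (z = -1 /\ w = - m%:Z) \/ (w = -1 /\ z = - m%:Z).
Proof.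
move=> z0 w0 zn wn zw; exists (`|z| * `|w|)%N; first by lia.
case: z w z0 w0 zn wn zw => [n|n] [p|p] z0 w0 zn wn zw; try lia.
have np : (n.+1 * p.+1 < 4)%N by rewrite !NegzE mulrNN in zw.
have n3 : (n < 3)%N by nia.
have p3 : (p < 3)%N by nia.
by move: n p n3 p3 np {z0 w0 zn wn zw} => [|[|[|n]]] [|[|[|p]]] // *; by [left|right].
Qed.

Section RootTheory.
Variables (R : realType) (V : vectType R) (ip : {dot V for idfun}).
Variables (Phi : {fset V}) (b : seq V).
Hypotheses (Phi_root : root_system ip Phi) (Phi_reduced : reduced Phi).
Hypothesis bP : simple_system Phi b.
Local Notation s := (reflection ip).

Lemma root_neq0 a : a \in Phi -> a != 0.
Proof. by case: Phi_root => P0 _ _ _ aP; apply: contraNneq P0 => <-. Qed.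

Lemma root_reflection a x : a \in Phi -> x \in Phi -> s a x \in Phi.
Proof. by case: Phi_root => _ _ refl _; apply: refl. Qed.

Lemma root_opp a : a \in Phi -> - a \in Phi.
Proof.
by move=> aP; rewrite -(reflection_id ip (root_neq0 aP)) root_reflection.
Qed.

Lemma simple_root x : x \in b -> x \in Phi.
Proof. by case: bP => sub _ _; apply: sub. Qed.

Lemma simple_neq0 x : x \in b -> x != 0.
Proof. by move=> /simple_root/root_neq0. Qed.

Lemma simple_uniq : uniq b.
Proof. by case: bP => _ /basis_free/free_uniq. Qed.

Lemma simple_span : (<<b>> = fullv)%VS.
Proof. by case: bP => _ /andP[/eqP]. Qed.

Lemma simple_dual x : x \in b ->
  exists d, ip x d = 1 /\ {in b, forall y, y != x -> ip y d = 0}.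
Proof. by case: bP => _ bas _; apply: dual_vector. Qed.

Lemma simple_coef x d (f : V -> R) : x \in b -> ip x d = 1 ->
  {in b, forall y, y != x -> ip y d = 0} ->
  ip (\sum_(y <- b) f y *: y) d = f x.
Proof.
move=> xb xd yd; rewrite (bigD1_seq x) ?simple_uniq //= ipDl ipZl xd mulr1.
rewrite ip_suml big_seq_cond big1 ?addr0 // => y /andP[yb yx].
by rewrite ipZl yd ?mulr0.
Qed.

(* A positive root meets some simple root at an acute angle; reflecting in it
   lowers the height and, the system being reduced, keeps the root positive. *)
Lemma root_ind (S : V -> Prop) : {in b, forall x, S x} ->
  (forall a, S a -> S (- a)) ->
  (forall a x, x \in b -> S a -> S (s x a)) ->
  forall a, a \in Phi -> S a.
Proof.
move=> Sb SN Sr.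
suff pos n : forall (k : V -> nat), (\sum_(x <- b) k x <= n)%N ->
    \sum_(x <- b) (k x)%:R *: x \in Phi -> S (\sum_(x <- b) (k x)%:R *: x).
  move=> a aP; case: bP => _ _ /(_ _ aP)[k [aE|aE]].
    by rewrite aE; apply: (pos _ k (leqnn _)); rewrite -aE.
  rewrite aE; apply/SN/(pos _ k (leqnn _)).
  by rewrite -[X in X \in _]opprK -aE root_opp.
elim: n => [|n IHn] k kn; set a := \sum_(x <- b) _ => aP.
  have : a = 0.
    rewrite /a big_seq big1 // => x xb.
    by move: kn; rewrite (bigD1_seq x) ?simple_uniq //=; case: (k x) => //; rewrite scale0r.
  by move/eqP; rewrite (negPf (root_neq0 aP)).
(* Otherwise every term of [ip a a], expanded in its second argument, would be at most 0. *)
have [x xb] : exists2 x, x \in b & (0 < ip a x) && (0 < k x)%N.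
  apply/hasP; rewrite -[has _ _]negbK -all_predC; apply/negP => /allP nx.
  have : 0 < ip a a by rewrite ip_gt0 root_neq0.
  rewrite {2}/a ip_sumr ltNge => /negP[]; rewrite big_seq sumr_le0 // => x xb.
  rewrite ipZr; have /= := nx x xb; rewrite negb_and -leNgt -eqn0Ngt.
  case/orP => [ax|/eqP->]; last by rewrite mul0r.
  by rewrite mulr_ge0_le0.
case/andP=> ax kx.
have [ab|ab] := boolP (a \in b); first exact: Sb.
(* A root supported on [x] alone would be [x] itself, the system being reduced. The coefficient at a
   second simple root [y] is untouched by the reflection in [x], and being positive it rules out the
   negative expansion of the image. *)
have [y /andP[yb yx] ky] : exists2 y, (y \in b) && (y != x) & (0 < k y)%N.
  have : has (fun y => (y != x) && (0 < k y)%N) b.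
    rewrite -[has _ _]negbK -all_predC; apply/negP => /allP nx.
    have aE : a = (k x)%:R *: x.
      rewrite /a (bigD1_seq x) ?simple_uniq //= big_seq_cond big1 ?addr0 //.
      move=> z /andP[zb zx]; have /= := nx z zb.
      by rewrite zx /= lt0n negbK => /eqP->; rewrite scale0r.
    have := Phi_reduced (simple_root xb); rewrite aE in aP => /(_ _ aP).
    case=> [k1|/eqP]; last by rewrite -subr_eq0 opprK -(natrD _ _ 1) pnatr_eq0 addn1.
    by move: ab; rewrite aE k1 scale1r xb.
  by case/hasP => y yb /andP[yx ky]; exists y; rewrite ?yb.
have a'P : s x a \in Phi by rewrite root_reflection // simple_root.
have x0 := simple_neq0 xb.
have [m mE] : exists m : nat, cartan_number ip a x = m.+1%:R.
  case: Phi_root => _ _ _ /(_ a x aP (simple_root xb))[z zE].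
  have : 0 < cartan_number ip a x.
    by rewrite /cartan_number divr_gt0 ?ip_gt0 // mulr_gt0.
  rewrite zE; case: z {zE} => [[|m]|m]; rewrite ?ltxx //.
    by exists m.
  by rewrite ltr0z.
have a'E : s x a = a - m.+1%:R *: x by rewrite /reflection mE.
case: bP => _ _ /(_ _ a'P)[k' k'E].
have [d [xd yd]] := simple_dual xb.
have [d' [yd' zd']] := simple_dual yb.
case: k'E => k'E; last first.
  have : ip (s x a) d' = - (k' y)%:R by rewrite k'E ipNl (simple_coef _ yb yd' zd').
  rewrite a'E ipBl ipZl [ip x d']zd' // 1?eq_sym // mulr0 subr0 (simple_coef _ yb yd' zd').
  move/eqP; rewrite -subr_eq0 opprK -natrD pnatr_eq0 addn_eq0.
  by move: ky; rewrite lt0n => /negPf->.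
suff kk : (\sum_(x <- b) k' x <= n)%N.
  have := Sr _ _ xb (IHn k' kk _); rewrite -k'E => /(_ a'P).
  by rewrite reflection_invol.
have k'y z : z \in b -> z != x -> k' z = k z.
  move=> zb zx; have [dz [zdz udz]] := simple_dual zb.
  have : ip (s x a) dz = (k' z)%:R by rewrite k'E (simple_coef _ zb zdz udz).
  rewrite a'E ipBl ipZl [ip x dz]udz 1?eq_sym // mulr0 subr0 (simple_coef _ zb zdz udz) => /eqP.
  by rewrite eqr_nat => /eqP.
have k'x : k x = (k' x + m.+1)%N.
  have : ip (s x a) d = (k' x)%:R by rewrite k'E (simple_coef _ xb xd yd).
  rewrite a'E ipBl ipZl xd mulr1 (simple_coef _ xb xd yd) => /eqP.
  by rewrite subr_eq -natrD eqr_nat => /eqP.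
move: kn; rewrite !(bigD1_seq x xb simple_uniq) /=.
rewrite (_ : \sum_(i <- b | i != x) k' i = \sum_(i <- b | i != x) k i)%N.
  rewrite k'x; lia.
rewrite big_seq_cond [RHS]big_seq_cond.
by apply: eq_bigr => z /andP[zb zx]; rewrite k'y.
Qed.

(** If the product were positive, reflecting [x] in [y] would give a root [x - c y] with [c > 0],
    whose coefficients have both signs. *)
Lemma simple_obtuse x y : x \in b -> y \in b -> x != y -> ip x y <= 0.
Proof.
move=> xb yb xy; rewrite leNgt; apply/negP => xy0.
have [[xP yP] y0] := (simple_root xb, simple_root yb, simple_neq0 yb).
have c0 : 0 < cartan_number ip x y.
  by rewrite /cartan_number divr_gt0 ?ip_gt0 // mulr_gt0.
have := root_reflection yP xP; rewrite /reflection; set c := cartan_number _ _ _ in c0 *.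
have [d [xd zd]] := simple_dual xb; have [d' [yd' zd']] := simple_dual yb.
case: bP => _ _ pos /pos [k [kE|kE]].
  have := congr1 (ip^~ d') kE; rewrite (simple_coef _ yb yd' zd') ipBl ipZl yd' [ip x d']zd' // mulr1 sub0r.
  by move=> cE; have := ler0n R (k y); rewrite -cE oppr_ge0 leNgt c0.
have := congr1 (ip^~ d) kE; rewrite ipNl (simple_coef _ xb xd zd) ipBl ipZl xd [ip y d]zd 1?eq_sym //.
rewrite mulr0 subr0 => cE; have := ler0n R (k x).
by rewrite -[_%:R]opprK -cE oppr_ge0 ler10.
Qed.

(** A Dynkin bond of multiplicity [m]: the squared lengths have ratio [m] and the product is minus
    half of the larger one. Which end is longer is left open. *)
Definition mbond (m : nat) x y :=
  [\/ ip x x = m%:R * ip y y /\ ip x y = - ip x x / 2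
    | ip y y = m%:R * ip x x /\ ip x y = - ip y y / 2].

Lemma mbondC m x y : mbond m x y -> mbond m y x.
Proof. by case=> -[h1 h2]; [right|left]; rewrite ipC. Qed.

Lemma simple_bond x y : x \in b -> y \in b -> x != y ->
  ip x y = 0 \/ exists2 m : nat, (0 < m < 4)%N & mbond m x y.
Proof.
move=> xb yb xy; have [xP yP] := (simple_root xb, simple_root yb).
have [x0 y0] := (simple_neq0 xb, simple_neq0 yb).
have xy_le0 := simple_obtuse xb yb xy.
have xx : 0 < ip x x by rewrite ip_gt0.
have yy : 0 < ip y y by rewrite ip_gt0.
case: Phi_root => _ _ _ int.
have [z zE] := int x y xP yP; have [z' z'E] := int y x yP xP.
have h1 : 2 * ip x y = z%:~R * ip y y.
  by rewrite -zE /cartan_number divfK // gt_eqF.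
have h2 : 2 * ip x y = z'%:~R * ip x x.
  by rewrite -z'E /cartan_number divfK ?gt_eqF // ipC.
(* Strict Cauchy-Schwarz: the part of [x] orthogonal to [y] is nonzero, since the vector dual to [x]
   pairs to 1 with it. *)
have cs : ip x y * ip x y < ip x x * ip y y.
  have [d [xd yd]] := simple_dual xb.
  have : 0 < ip (x - (ip x y / ip y y) *: y) (x - (ip x y / ip y y) *: y).
    rewrite ip_gt0; apply/eqP => /(congr1 (ip^~ d)).
    rewrite ip0l ipBl ipZl xd [ip y d]yd 1?eq_sym // mulr0 subr0 => /eqP.
    by rewrite oner_eq0.
  rewrite !ipE (ipC y x).
  rewrite [X in 0 < X](_ : _ = (ip x x * ip y y - ip x y * ip x y) / ip y y).
    by rewrite pmulr_lgt0 ?invr_gt0 // subr_gt0.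
  by field; rewrite gt_eqF.
have zz : ((z * z')%:~R : R) < 4%:~R.
  have e : (z * z')%:~R * (ip x x * ip y y) = 4 * (ip x y * ip x y).
    by rewrite intrM; transitivity ((2 * ip x y) * (2 * ip x y)); [rewrite {1}h1 h2; ring|ring].
  rewrite -(ltr_pM2r (x := ip x x * ip y y)) ?mulr_gt0 // e.
  by rewrite -[4%:~R]/(4%:R) ltr_pM2l.
rewrite ltr_int in zz.
have zle : (z <= 0)%R.
  by rewrite -(lerz0 R) -(ler_pM2r yy) -h1 mul0r mulr_ge0_le0.
have z'le : (z' <= 0)%R.
  by rewrite -(lerz0 R) -(ler_pM2r xx) -h2 mul0r mulr_ge0_le0.
have [xy0|xyn] := eqVneq (ip x y) 0; [by left|right].
have zn : z != 0.
  by apply: contra_neq xyn => z0; move: h1; rewrite z0 mul0r => /eqP; rewrite mulf_eq0 pnatr_eq0 => /eqP.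
have z'n : z' != 0.
  by apply: contra_neq xyn => z0; move: h2; rewrite z0 mul0r => /eqP; rewrite mulf_eq0 pnatr_eq0 => /eqP.
have [m m4 [[z1 z2]|[z1 z2]]] := negative_pair_lt4 zle z'le zn z'n zz.
- exists m => //; right; move: h1 h2; rewrite z1 z2 !rmorphN /= => h1 h2.
  by split; lra.
- exists m => //; left; move: h1 h2; rewrite z1 z2 !rmorphN /= => h1 h2.
  by split; lra.
Qed.

Hypothesis Phi_irr : irreducible ip Phi.

(** Were the simple roots in [A] orthogonal to the others, induction on roots would place every root
    in the span of one group or of the other, and the root system would split. *)
Lemma simple_connected (A : pred V) : has A b -> ~~ all A b ->
  exists x y, [/\ x \in b, y \in b, A x, ~~ A y & ip x y != 0].
Proof.
move=> /hasP[x0 x0b Ax0] /allPn[y0 y0b Ay0]; apply: contrapT => noedge.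
have orth x y : x \in b -> y \in b -> A x -> ~~ A y -> ip x y = 0.
  move=> xb yb Ax Ay; apply/eqP; apply: contra_notT noedge => xy.
  by exists x, y.
pose U1 := <<filter A b>>%VS; pose U2 := <<filter (predC A) b>>%VS.
have U12 u v : u \in U1 -> v \in U2 -> ip u v = 0.
  move=> u1 v2.
  have uE : u \in <<in_tuple (filter A b)>>%VS by [].
  have vE : v \in <<in_tuple (filter (predC A) b)>>%VS by [].
  rewrite (coord_span uE) ip_suml big1 // => i _; rewrite ipZl.
  rewrite (coord_span vE) ip_sumr big1 ?mulr0 // => j _; rewrite ipZr.
  have := mem_nth 0 (ltn_ord i); have := mem_nth 0 (ltn_ord j).
  rewrite !mem_filter /= => /andP[Aj jb] /andP[Ai ib].
  by rewrite orth ?mulr0.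
have inU a : a \in Phi -> (a \in U1) || (a \in U2).
  have inb x : x \in b -> (x \in U1) || (x \in U2).
    move=> xb; have [Ax|Ax] := boolP (A x).
      by rewrite memv_span // mem_filter Ax.
    by apply/orP; right; rewrite memv_span // mem_filter /= Ax.
  apply: (root_ind (S := fun a => (a \in U1) || (a \in U2))) => [x /inb //|a'|a' x xb /orP aU].
    by rewrite !memvN.
  have xx : ip x x != 0 by rewrite gt_eqF // ip_gt0 simple_neq0.
  case/orP: (inb x xb) => xU; case: aU => aU.
  - by rewrite rpredB // rpredZ.
  - by rewrite reflection_orth ?aU ?orbT // ipC U12.
  - by rewrite reflection_orth ?aU // U12.
  - by apply/orP; right; rewrite rpredB // rpredZ.
case: Phi_irr => _ /(_ [fset a in Phi | a \in U1]%fset).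
case.
- by move=> a; rewrite !inE => /andP[].
- move=> a a'; rewrite !inE => /andP[aP aU] a'P; rewrite a'P /= => a'U.
  by apply: U12 => //; have := inU _ a'P; rewrite (negPf a'U).
- move/fsetP/(_ x0); rewrite !inE simple_root //= memv_span //.
  by rewrite mem_filter Ax0.
- move/fsetP/(_ y0); rewrite !inE simple_root //= => y0U.
  have : ip y0 y0 = 0.
    apply: U12 => //; apply: memv_span; rewrite mem_filter /= y0b andbT.
    by [].
  by move/eqP; rewrite gt_eqF // ip_gt0 simple_neq0.
Qed.

End RootTheory.

(** * Dynkin diagrams *)

Section Diagrams.
Variables (R : realType) (V : vectType R) (ip : {dot V for idfun}).
Implicit Types (x y z u v w d : V) (L t : seq V).

(** The squared length of the projection of [z] on the line of [u]. *)
Definition weight z u := ip z u ^+ 2 / ip u u.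

(** Bessel's inequality, proved by splitting off one projection at a time. It is strict because [d]
    is orthogonal to all of [us] but not to [z]; in the applications [d] belongs to the dual
    basis. *)
Lemma bessel us z d : ip z d != 0 -> {in us, forall u, ip u d = 0} ->
  {in us, forall u, u != 0} -> pairwise (fun u v => ip u v == 0) us ->
  \sum_(u <- us) weight z u < ip z z.
Proof.
elim: us z => [|u us IH] z zd usd us0.
  by move=> _; rewrite big_nil ip_gt0; apply: contra_neq zd => ->; rewrite ip0l.
rewrite pairwise_cons => /andP[/allP uus pus].
have u0 : ip u u != 0 by rewrite gt_eqF // ip_gt0 us0 ?mem_head.
pose z' := z - (ip z u / ip u u) *: u.
have zz : ip z z = weight z u + ip z' z'.
  by rewrite /z' /weight !ipE (ipC u z); field.
rewrite big_cons zz ltrD2l.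
rewrite (_ : \sum_(v <- us) _ = \sum_(v <- us) weight z' v); last first.
  rewrite !big_seq; apply: eq_bigr => v vus.
  by rewrite /weight /z' ipBl ipZl (eqP (uus v vus)) mulr0 subr0.
apply: IH => //.
- by rewrite /z' ipBl ipZl (usd u) ?mem_head // mulr0 subr0.
- by move=> v vus; rewrite usd // in_cons vus orbT.
- by move=> v vus; rewrite us0 // in_cons vus orbT.
Qed.

(** Whichever end is longer, the bond uses up the share m/4 of the squared length of [z]; so
    orthogonal neighbours of [z] have total multiplicity at most 3. *)
Lemma weight_mbond m z u : (0 < m)%N -> u != 0 -> mbond ip m z u ->
  weight z u = m%:R / 4 * ip z z.
Proof.
move=> m0 u0; have uu : ip u u != 0 by rewrite gt_eqF // ip_gt0.
have mn : (m%:R : R) != 0 by rewrite pnatr_eq0 -lt0n.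
rewrite /weight; case=> -[e1 e2]; rewrite e2.
  by rewrite e1; field.
have zz : ip z z != 0 by apply: contra_neq uu => zz0; rewrite e1 zz0 mulr0.
by rewrite e1; field; rewrite zz.
Qed.

Definition bond x y := ip x x = ip y y /\ ip x y = - ip x x / 2.

Lemma bondC x y : bond x y -> bond y x.
Proof. by case=> e1 e2; split; rewrite // ipC -e1. Qed.

Lemma mbond1 x y : mbond ip 1 x y -> bond x y.
Proof. by case=> -[]; rewrite mul1r => e1 e2; split; rewrite ?e2 ?e1. Qed.

Lemma bond_mbond x y : bond x y -> mbond ip 1 x y.
Proof. by case=> e1 e2; left; rewrite mul1r. Qed.

Definition orths L L' := {in L & L', forall u v, ip u v = 0}.

Lemma orthsC L L' : orths L L' -> orths L' L.
Proof. by move=> o u v uL vL'; rewrite ipC o. Qed.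

Lemma orths_sub L1 L2 L1' L2' : orths L1 L2 -> {subset L1' <= L1} ->
  {subset L2' <= L2} -> orths L1' L2'.
Proof. by move=> o s1 s2 u v /s1 u1 /s2 v2; apply: o. Qed.

Lemma orths_consl x L1 L2 : orths [:: x] L2 -> orths L1 L2 -> orths (x :: L1) L2.
Proof.
move=> o1 o2 u v; rewrite in_cons => /orP[/eqP->|uL] vL; last exact: o2.
by apply: o1; rewrite ?mem_head.
Qed.

(** A chain of single bonds leaving [y], with no other bonds among its nodes. The starting node [y]
    is not listed in [L]. *)
Fixpoint arm y L : Prop :=
  if L is x :: L' then [/\ bond y x, orths [:: y] L' & arm x L'] else True.

Lemma arm_norm y L : arm y L -> {in L, forall u, ip u u = ip y y}.
Proof.
elim: L y => //= x L IH y [[e _] _ ar] u.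
by rewrite in_cons e => /orP[/eqP->//|]; apply: IH.
Qed.

Lemma arm_rcons y L x : arm y L -> bond (last y L) x ->
  orths (belast y L) [:: x] -> arm y (rcons L x).
Proof.
elim: L y => [|x' L IH] y /=; first by move=> _ b _; split.
move=> [b o ar] bx ox; split=> //; last first.
  by apply: IH => //; apply: orths_sub ox _ _ => // u uL; rewrite in_cons uL orbT.
move=> u v; rewrite inE => /eqP-> {u}; rewrite mem_rcons in_cons => /orP[/eqP->|vL].
  by apply: ox; rewrite ?mem_head.
by apply: o; rewrite ?mem_head.
Qed.

Lemma arm_cat y L L' : arm y (L ++ L') -> arm y L.
Proof.
elim: L y => //= x L IH y [b o ar]; split=> //; last exact: IH ar.
by apply: orths_sub o _ _ => // u; rewrite mem_cat => ->.
Qed.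

Lemma arm_next y L n L' : arm y (L ++ n :: L') ->
  bond (last y L) n /\ orths (belast y L) [:: n].
Proof.
elim: L y => [|x L IH] y /=; first by case.
case=> b o /IH [bn on]; split=> //; apply: orths_consl => // u v.
rewrite !inE => /eqP-> /eqP->; apply: o; rewrite ?mem_head //.
by rewrite mem_cat mem_head orbT.
Qed.

(** Each single bond contributes minus one squared length to the norm of the sum and so cancels one
    node: a contracted chain is as long as a single node. *)
Lemma arm_sum y L (w := y + \sum_(u <- L) u) : arm y L -> ip w w = ip y y.
Proof.
rewrite {}/w; elim: L y => [|x L IH] y; first by rewrite big_nil addr0.
move=> [[e1 e2] o ar]; rewrite big_cons; set w := x + _.
have ww : ip w w = ip y y by rewrite IH.
have yw : ip y w = - ip y y / 2.
  rewrite /w ipDr e2 ip_sumr big_seq big1 ?addr0 // => u uL.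
  by apply: o; rewrite ?mem_head.
by clearbody w; rewrite !ipE (ipC w y) ww yw; field.
Qed.

(* A chain of single bonds contracts to one node (the sum of its nodes), whose
   bonds are all those leaving the chain, so their total multiplicity is below 4. *)
Lemma leaf_on_arm z pre y post x m (hs : seq V) d L :
  z :: L = pre ++ y :: post -> arm z L ->
  {in hs, forall u, u != 0} -> pairwise (fun u v => ip u v == 0) hs ->
  orths L hs -> orths [:: x] hs ->
  ip z z / 2 <= \sum_(u <- hs) weight z u ->
  (0 < m)%N -> mbond ip m y x -> x != 0 -> {in L, forall u, u != 0} ->
  {in z :: L, forall u, u != y -> ip x u = 0} -> y \notin pre -> y \notin post ->
  z \notin L ->
  ip z d = 1 -> {in L ++ x :: hs, forall u, ip u d = 0} ->
  post = [::] /\ m = 1%N.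
Proof.
move=> zE arz hs0 phs oLh oxh wh m0 byx x0 L0 ox ypre ypost zL zd od.
have zz : 0 < ip z z.
  rewrite ip_gt0; apply: contra_eq_neq zd => ->.
  by rewrite ip0l eq_sym oner_neq0.
(* The chain from [z] to [y] contracted to one node: it pairs with [x] as [y] does and with [hs] as
   [z] does. *)
pose w := \sum_(u <- rcons pre y) u.
have [pr prE] : exists pr, rcons pre y = z :: pr.
  by case: pre zE {ypre w} => [[-> _]|p pre [-> _]]; [exists [::]|exists (rcons pre y)].
have LE : L = pr ++ post.
  by move: zE; rewrite -cat_rcons prE /= => -[].
have wE : w = z + \sum_(u <- pr) u by rewrite /w prE big_cons.
have arpr : arm z pr by move: arz; rewrite LE => /arm_cat.
have ww : ip w w = ip z z by rewrite wE arm_sum.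
have lasty : last z pr = y by rewrite -(last_cons z) -prE last_rcons.
have yy : ip y y = ip z z.
  rewrite -lasty; have := mem_last z pr; rewrite inE => /orP[/eqP->//|].
  exact: arm_norm.
have wx : ip w x = ip y x.
  rewrite /w -cats1 big_cat big_seq1 /= ipDl ip_suml big_seq big1 ?add0r // => u up.
  rewrite ipC ox ?zE ?mem_cat ?up //.
  by apply: contraNneq ypre => <-.
have wtx : weight w x = m%:R / 4 * ip z z.
  by rewrite -yy -(weight_mbond m0 x0 byx) /weight wx.
have wth : \sum_(u <- hs) weight w u = \sum_(u <- hs) weight z u.
  rewrite !big_seq; apply: eq_bigr => u uh; rewrite /weight wE ipDl ip_suml.
  rewrite [\sum_(i <- pr) _]big_seq big1 ?addr0 // => v vp.
  by apply: oLh; rewrite // LE mem_cat vp.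
have wd : ip w d = 1.
  rewrite wE ipDl zd ip_suml big_seq big1 ?addr0 // => u up; apply: od.
  by rewrite LE !mem_cat up.
have wd0 : ip w d != 0 by rewrite wd oner_neq0.
have xhs0 : {in x :: hs, forall u, u != 0}.
  by move=> u; rewrite in_cons => /orP[/eqP->|/hs0].
have xhsd : {in x :: hs, forall u, ip u d = 0}.
  by move=> u ux; apply: od; rewrite mem_cat ux orbT.
have pxhs : pairwise (fun u v => ip u v == 0) (x :: hs).
  rewrite pairwise_cons phs andbT; apply/allP => u uh.
  by rewrite oxh ?mem_head.
(* The share m/4 taken by [x] and the half taken by [hs] must stay below 1. *)
have m1 : m = 1%N.
  have := bessel wd0 xhsd xhs0 pxhs; rewrite big_cons wtx wth ww => lt.
  have : m%:R / 4 * ip z z + ip z z / 2 < ip z z by apply: le_lt_trans lt; rewrite lerD2l.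
  rewrite -ltrBrDr => lt'.
  have : (m%:R : R) < 2%:R.
    rewrite -(ltr_pM2r zz); lra.
  by rewrite ltr_nat; case: (m) m0 => [|[|]].
split=> //; case: post => // n post in zE LE ypost *.
have nL : n \in L by rewrite LE mem_cat mem_head orbT.
have [bn on] : bond y n /\ orths (belast z pr) [:: n].
  by rewrite -lasty; apply: (@arm_next _ _ _ post); rewrite -LE.
have wn : ip w n = ip y n.
  rewrite /w prE lastI lasty -cats1 big_cat big_seq1 /= ipDl ip_suml big_seq big1 ?add0r //.
  by move=> u up; apply: on; rewrite ?mem_head.
have wtn : weight w n = 1 / 4 * ip z z.
  by rewrite -yy -(weight_mbond (ltn0Sn 0) (L0 n nL) (bond_mbond bn)) /weight wn.
(* A node [n] after [y] would take a further quarter and bring the total to at least 1. *)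
have : \sum_(u <- n :: x :: hs) weight w u < ip w w.
  apply: (bessel wd0).
  - by move=> u; rewrite in_cons => /orP[/eqP->|/xhsd//]; apply: od; rewrite mem_cat nL.
  - by move=> u; rewrite in_cons => /orP[/eqP->|/xhs0//]; apply: L0.
  - rewrite pairwise_cons pxhs andbT; apply/allP => u; rewrite in_cons => /orP[/eqP->|uh].
      rewrite ipC ox ?in_cons ?nL ?orbT //.
      by apply: contraNneq ypost => <-; rewrite mem_head.
    by rewrite oLh.
rewrite !big_cons wtn wtx m1 wth ww => lt; exfalso; move: wh lt.
by move: (ip z z) (\sum_(u <- hs) _); clear => a c; lra.
Qed.

(** The coefficients decrease from [size L] to 1. On a chain of single bonds this is a multiple of
    the fundamental weight of its first node, that is, the direction in which a node bonded only to
    that first node projects onto the span of the chain. *)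
Fixpoint armv L : V := if L is x :: L' then (size L)%:R *: x + armv L' else 0.

Lemma armv_orth L v : orths [:: v] L -> ip v (armv L) = 0.
Proof.
elim: L => [|x L IH] o /=; first by rewrite ip0r.
rewrite ipDr ipZr o ?mem_head // mulr0 add0r IH //.
by apply: orths_sub o _ _ => // u uL; rewrite in_cons uL orbT.
Qed.

Lemma armv_orths L L' : orths L L' -> ip (armv L) (armv L') = 0.
Proof.
move=> o; rewrite armv_orth // => u v; rewrite inE => /eqP-> vL'.
by rewrite ipC armv_orth // => u' v'; rewrite inE => /eqP-> uL; apply: orthsC o _ _ vL' uL.
Qed.

Lemma armv_ip y L : arm y L ->
  ip y (armv L) = - (size L)%:R * ip y y / 2 /\
  ip (armv L) (armv L) = (size L)%:R * (size L).+1%:R * ip y y / 2.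
Proof.
elim: L y => [|x L IH] y /=; first by rewrite !ip0r !(mul0r, oppr0).
move=> [[e1 e2] o /IH[h1 h2]]; rewrite -e1 in h1 h2.
have yL : ip y (armv L) = 0 by apply: armv_orth.
rewrite !ipE e2 -e1 (ipC (armv L) x) h1 h2 yL -!natr1; by split; field.
Qed.

(** An arm of p - 1 nodes uses up the share m/2 * (1 - 1/p) of the squared length of [z]. For three
    single-bonded arms, a total below 1 is the classical 1/p + 1/q + 1/r > 1. *)
Lemma weight_armv m z x L : (0 < m)%N -> x != 0 -> mbond ip m z x -> arm x L ->
  orths [:: z] L ->
  weight z (armv (x :: L)) =
    m%:R * ((size L).+1%:R / (size L).+2%:R) * ip z z / 2.
Proof.
move=> m0 x0 bzx ar o; have xx : ip x x != 0 by rewrite gt_eqF // ip_gt0.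
have [h1 h2] := armv_ip ar; have zL := armv_orth o.
have e1 : ip z (armv (x :: L)) = (size L).+1%:R * ip z x.
  by rewrite /= ipDr ipZr zL addr0.
have e2 : ip (armv (x :: L)) (armv (x :: L)) = (size L).+1%:R * (size L).+2%:R * ip x x / 2.
  by rewrite /= !ipE (ipC (armv L) x) h1 h2 -!natr1; field.
have w := weight_mbond m0 x0 bzx; rewrite /weight in w.
rewrite /weight e1 e2.
have zx2 : ip z x ^+ 2 = m%:R / 4 * ip z z * ip x x by rewrite -w divfK.
rewrite exprMn zx2.
move: (size L).+1%:R (size L).+2%:R (pnatr_eq0 R (size L).+1)
  (pnatr_eq0 R (size L).+2) => p q /negbT p0 /negbT q0.
by field; rewrite xx p0 q0.
Qed.

Lemma armv_neq0 y L : y != 0 -> arm y L -> L != [::] -> armv L != 0.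
Proof.
move=> y0 ar L0; rewrite -(ip_gt0 ip) (armv_ip ar).2.
have sL : (0 < size L)%N by rewrite lt0n size_eq0.
by rewrite divr_gt0 // mulr_gt0 ?ip_gt0 // mulr_gt0 ?ltr0n.
Qed.

Lemma armv_cons_neq0 x L : x != 0 -> arm x L -> armv (x :: L) != 0.
Proof.
move=> x0 ar; rewrite -(ip_gt0 ip) /= !ipE (ipC (armv L) x).
have [-> ->] := armv_ip ar; rewrite -!natr1.
set n : R := (size L)%:R; have n0 : 0 <= n by rewrite ler0n.
have xx : 0 < ip x x by rewrite ip_gt0.
rewrite [X in 0 < X](_ : _ = (n + 1) * (n + 2) * ip x x / 2); last by field.
by rewrite divr_gt0 // mulr_gt0 // mulr_gt0 //; lra.
Qed.

End Diagrams.

Ltac perm_by_count H :=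
  let p := fresh in
  move/permP: H; clear; let H' := fresh in move=> H'; apply/permP => p;
  move: (H' p); clear; rewrite -?cats1 /= ?(count_cat, count_rev) /=
    ?(count_cat, count_rev) /=; lia.

Lemma half_le_quarters (R : realFieldType) (a k : R) :
  0 <= a -> 2 <= k -> a / 2 <= k / 4 * a.
Proof. nra. Qed.

(** * Growing a diagram by one leaf *)

Section DiagramGrowth.
Variables (R : realType) (V : vectType R) (ip : {dot V for idfun}).
Implicit Types (x y z u v w d : V) (L t : seq V).
Local Notation arm := (arm ip).
Local Notation orths := (orths ip).
Local Notation bond := (bond ip).
Local Notation mbond := (mbond ip).

Definition fork z L1 L2 L3 :=
  [/\ [/\ arm z L1, arm z L2 & arm z L3],
      [/\ orths L1 L2, orths L1 L3 & orths L2 L3]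
    & [/\ L1 <> [::], L2 <> [::] & L3 <> [::]]].

Definition multi m z L x L' :=
  [/\ (1 < m < 4)%N, mbond m z x, arm z L /\ arm x L',
      orths (z :: L) L' & orths L (x :: L')].

(** At most one branch point or one multiple bond, and not both. A path is stored as two arms around
    a base point, so that it can be recentred at the node where a new leaf is attached. *)
Inductive diagram t : Prop :=
| DiagramPath z L1 L2 of arm z L1 & arm z L2 & orths L1 L2
    & perm_eq t (z :: L1 ++ L2)
| DiagramFork z L1 L2 L3 of fork z L1 L2 L3 & perm_eq t (z :: L1 ++ L2 ++ L3)
| DiagramMulti m z L x L' of multi m z L x L' & perm_eq t (z :: L ++ x :: L').

Lemma fork_swap12 z L1 L2 L3 : fork z L1 L2 L3 -> fork z L2 L1 L3.
Proof. by case=> -[? ? ?] [? ? ?] [? ? ?]; split; split=> //; apply: orthsC. Qed.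

Lemma fork_swap23 z L1 L2 L3 : fork z L1 L2 L3 -> fork z L1 L3 L2.
Proof. by case=> -[? ? ?] [? ? ?] [? ? ?]; split; split=> //; apply: orthsC. Qed.

Lemma multiC m z L x L' : multi m z L x L' -> multi m x L' z L.
Proof.
by case=> ? ? [? ?] ? ?; split=> //; [apply: mbondC|apply: orthsC|apply: orthsC].
Qed.

Lemma diagram_perm t t' : perm_eq t t' -> diagram t -> diagram t'.
Proof.
rewrite perm_sym => tt' [z L1 L2 a1 a2 o tE|z L1 L2 L3 f tE|m z L x L' mu tE].
- exact: DiagramPath a1 a2 o (perm_trans tt' tE).
- exact: DiagramFork f (perm_trans tt' tE).
- exact: DiagramMulti mu (perm_trans tt' tE).
Qed.

Lemma path_recenter z L1 L2 y : arm z L1 -> arm z L2 -> orths L1 L2 ->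
  y \in z :: L1 ++ L2 ->
  exists L1' L2', [/\ arm y L1', arm y L2', orths L1' L2'
    & perm_eq (z :: L1 ++ L2) (y :: L1' ++ L2')].
Proof.
have step : forall L2 z L1, arm z L1 -> arm z L2 -> orths L1 L2 ->
    y \in z :: L2 ->
    exists L1' L2', [/\ arm y L1', arm y L2', orths L1' L2'
      & perm_eq (z :: L1 ++ L2) (y :: L1' ++ L2')].
  elim=> [|x L2' IH] {z L1 L2} z L1 a1 a2 o; rewrite in_cons => /orP[/eqP yz|].
  - by subst y; exists L1, [::].
  - by [].
  - by subst y; exists L1, (x :: L2').
  move=> yL; case: a2 => b zo ax.
  have [] := IH x (z :: L1).
  - split=> //; first exact: bondC.
    apply: orthsC; apply: orths_sub o _ _ => // u; rewrite inE => /eqP->.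
    by rewrite mem_head.
  - by [].
  - apply: orths_consl => //; apply: orths_sub o _ _ => // u uL.
    by rewrite in_cons uL orbT.
  - by [].
  move=> L1' [L3 [? ? ? pm]]; exists L1', L3; split=> //.
  by perm_by_count pm.
move=> a1 a2 o; rewrite in_cons mem_cat => /or3P[yz|y1|y2].
- by apply: step => //; rewrite in_cons yz.
- have [|L1' [L2' [? ? ? pm]]] := step L1 z L2 a2 a1 (orthsC o).
    by rewrite in_cons y1 orbT.
  by exists L1', L2'; split=> //; perm_by_count pm.
- by apply: step => //; rewrite in_cons y2 orbT.
Qed.

Variable b : seq V.
Hypothesis b_neq0 : {in b, forall x, x != 0}.
Hypothesis b_dual : forall x, x \in b ->
  exists d, ip x d = 1 /\ {in b, forall y, y != x -> ip y d = 0}.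
Hypothesis b_bond : forall x y, x \in b -> y \in b -> x != y ->
  ip x y = 0 \/ exists2 m : nat, (0 < m < 4)%N & mbond m x y.

(** Here [hs] stands for neighbours of [z] off the arm that already use half of its squared length:
    the first nodes of two other arms, or the far end of one multiple bond. *)
Lemma leaf_on_arm_simple z L y x m (hs : seq V) :
  uniq (z :: L ++ x :: hs) -> {subset z :: L ++ x :: hs <= b} ->
  arm z L -> pairwise (fun u v => ip u v == 0) hs ->
  orths L hs -> ip z z / 2 <= \sum_(u <- hs) weight ip z u ->
  y \in z :: L -> (0 < m)%N -> mbond m y x ->
  {in z :: L ++ hs, forall u, u != y -> ip x u = 0} ->
  m = 1%N /\ arm z (rcons L x).
Proof.
move=> un sub ar phs oLh wh yL m0 byx ox.
have zb : z \in b by rewrite sub ?mem_head.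
have Lb u : u \in L ++ x :: hs -> u \in b.
  by move=> uL; rewrite sub // in_cons uL orbT.
have [d [zd dz]] := b_dual zb.
have [zn [unL xL hsn]] : z \notin L ++ x :: hs /\
    [/\ uniq L, x \notin L & {in hs, forall u, u \notin z :: L}].
  move: un; rewrite cons_uniq cat_uniq => /and4P[zn uL /hasPn hn _]; split=> //; split=> //.
    by apply: hn; rewrite mem_head.
  move=> u uh; rewrite in_cons negb_or hn ?in_cons ?uh ?orbT // andbT.
  by apply: contraNneq zn => <-; rewrite mem_cat in_cons uh !orbT.
have zL : z \notin L by move: zn; rewrite mem_cat negb_or => /andP[].
have [pre [post zE]] : exists pre post, z :: L = pre ++ y :: post.
  by case/splitPr: yL => pre post; exists pre, post.
have [ypre ypost] : y \notin pre /\ y \notin post.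
  have : uniq (pre ++ y :: post) by rewrite -zE /= zL.
  by rewrite cat_uniq /= negb_or => /and4P[_ /andP[-> _] -> _].
have [] := @leaf_on_arm _ _ ip z pre y post x m hs d L zE ar.
- by move=> u uh; rewrite b_neq0 // Lb // mem_cat in_cons uh !orbT.
- by [].
- by [].
- move=> u v; rewrite inE => /eqP-> vh; apply: ox.
    by rewrite in_cons mem_cat vh !orbT.
  by apply: contraTneq yL => <-; apply: hsn.
- by [].
- by [].
- by [].
- by rewrite b_neq0 // Lb // mem_cat mem_head orbT.
- by move=> u uL; rewrite b_neq0 // Lb // mem_cat uL.
- move=> u uL; apply: ox; move: uL; rewrite !in_cons mem_cat.
  by case/orP => ->; rewrite ?orbT.
- by [].
- by [].
- by [].
- by [].
- move=> u uL; apply: dz; first exact: Lb.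
  by apply: contraNneq zn => <-.
move=> post0 m1; split=> //; apply: arm_rcons => //.
  move: zE; rewrite post0 lastI cats1 => /rcons_inj[_ ->].
  by apply: mbond1; rewrite -m1.
move: (zE); rewrite post0 lastI cats1 => /rcons_inj[-> ly] u v up.
rewrite inE => /eqP->; rewrite ipC ox //.
  have : u \in z :: L by rewrite zE mem_cat up.
  by rewrite !in_cons mem_cat => /orP[->|->]; rewrite ?orbT.
by apply: contraNneq ypre => <-.
Qed.

Lemma weight_bond_head z L : arm z L -> L <> [::] -> {subset L <= b} ->
  exists h L', L = h :: L' /\ weight ip z h = ip z z / 4.
Proof.
case: L => // h L' [bo _ _] _ Lb; exists h, L'; split=> //.
have h0 : h != 0 by rewrite b_neq0 // Lb ?mem_head.
rewrite (weight_mbond (ltn0Sn 0) h0 (bond_mbond bo)); by field.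
Qed.

Lemma fork_add z L1 L2 L3 x y m : fork z L1 L2 L3 ->
  uniq (x :: z :: L1 ++ L2 ++ L3) -> {subset x :: z :: L1 ++ L2 ++ L3 <= b} ->
  y \in z :: L1 -> (0 < m)%N -> mbond m y x ->
  {in z :: L1 ++ L2 ++ L3, forall u, u != y -> ip x u = 0} ->
  diagram (x :: z :: L1 ++ L2 ++ L3).
Proof.
move=> [[a1 a2 a3] [o12 o13 o23] [n1 n2 n3]] un sub yL m0 byx ox.
have L2b : {subset L2 <= b}.
  by move=> u uL; rewrite sub // !in_cons !mem_cat uL !orbT.
have L3b : {subset L3 <= b}.
  by move=> u uL; rewrite sub // !in_cons !mem_cat uL !orbT.
have [h2 [L2' [L2E w2]]] := weight_bond_head a2 n2 L2b.
have [h3 [L3' [L3E w3]]] := weight_bond_head a3 n3 L3b.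
have subhs : {subset [:: h2; h3] <= L2 ++ L3}.
  move=> u; rewrite L2E L3E !inE mem_cat !in_cons => /orP[]->; by rewrite ?orbT.
have [] := @leaf_on_arm_simple z L1 y x m [:: h2; h3].
- apply: (@subseq_uniq _ _ (z :: L1 ++ x :: L2 ++ L3)).
    rewrite -!cat_cons; apply: cat_subseq => //; rewrite L2E L3E /= !eqxx.
    by rewrite sub1seq mem_cat mem_head orbT.
  rewrite (perm_uniq (_ : perm_eq _ (x :: z :: L1 ++ L2 ++ L3))) //.
  by have pm := perm_refl (x :: z :: L1 ++ L2 ++ L3); perm_by_count pm.
- move=> u; rewrite in_cons mem_cat in_cons => /or4P[uz|uL|ux|uh].
  + by rewrite sub // !in_cons uz orbT.
  + by rewrite sub // !in_cons mem_cat uL !orbT.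
  + by rewrite sub // in_cons ux.
  + by move/subhs: uh => uh; rewrite sub // !in_cons mem_cat uh !orbT.
- by [].
- by rewrite /= o23 ?eqxx // ?L2E ?L3E mem_head.
- move=> u v uL; rewrite !inE => /orP[]/eqP->.
    by apply: o12; rewrite // L2E mem_head.
  by apply: o13; rewrite // L3E mem_head.
- by rewrite !big_cons big_nil w2 w3; lra.
- by [].
- by [].
- by [].
- move=> u; rewrite in_cons mem_cat => /or3P[uz|uL|/subhs uh].
  + by apply: ox; rewrite in_cons uz.
  + by apply: ox; rewrite in_cons mem_cat uL orbT.
  + by apply: ox; rewrite in_cons mem_cat uh !orbT.
move=> _ ar; apply: (@DiagramFork _ z (rcons L1 x) L2 L3).
  have oxL L : {subset L <= L2 ++ L3} -> orths L1 L -> orths (rcons L1 x) L.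
    move=> sL o u v; rewrite mem_rcons in_cons => /orP[/eqP->|uL] vL; last exact: o.
    apply: ox; first by rewrite in_cons mem_cat sL ?orbT.
    apply: contraTneq yL => <-; move/sL: vL => vL.
    move: un; rewrite -cat_cons -[x :: _]cat1s catA cat_uniq.
    case/and3P => _ /hasPn/(_ _ vL); rewrite mem_cat negb_or => /andP[_ ?] _.
    by [].
  split; split=> //; first by apply: oxL => // u uL; rewrite mem_cat uL.
    by apply: oxL => // u uL; rewrite mem_cat uL orbT.
  by case: (L1).
by have pm := perm_refl (x :: z :: L1 ++ L2 ++ L3); perm_by_count pm.
Qed.

Lemma multi_add m0 z L x0 L' x y m : multi m0 z L x0 L' ->
  uniq (x :: z :: L ++ x0 :: L') -> {subset x :: z :: L ++ x0 :: L' <= b} ->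
  y \in z :: L -> (0 < m)%N -> mbond m y x ->
  {in z :: L ++ x0 :: L', forall u, u != y -> ip x u = 0} ->
  diagram (x :: z :: L ++ x0 :: L').
Proof.
move=> [m12 bzx [aL aL'] o1 o2] un sub yL m_gt0 byx ox.
have x0b : x0 \in b by rewrite sub // !(in_cons, mem_cat) eqxx !orbT.
have [] := @leaf_on_arm_simple z L y x m [:: x0].
- apply: (@subseq_uniq _ _ (z :: L ++ x :: x0 :: L')).
    rewrite -!cat_cons; apply: cat_subseq => //; rewrite /= !eqxx.
    by case: (L').
  rewrite (perm_uniq (_ : perm_eq _ (x :: z :: L ++ x0 :: L'))) //.
  by have pm := perm_refl (x :: z :: L ++ x0 :: L'); perm_by_count pm.
- move=> u; rewrite !(in_cons, mem_cat) in_nil orbF => /or4P[uz|uL|ux|/eqP->//].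
  + by rewrite sub // !in_cons uz orbT.
  + by rewrite sub // !in_cons mem_cat uL !orbT.
  + by rewrite sub // in_cons ux.
- by [].
- by [].
- move=> u v uL; rewrite inE => /eqP->.
  by apply: o2; rewrite // mem_head.
- rewrite big_seq1 (weight_mbond (m := m0)) ?b_neq0 //; last by case: (m0) m12.
  by apply: half_le_quarters; rewrite ?ip_ge0 // ler_nat; case/andP: m12.
- by [].
- by [].
- by [].
- move=> u; rewrite in_cons mem_cat => /or3P[uz|uL|].
  + by apply: ox; rewrite in_cons uz.
  + by apply: ox; rewrite in_cons mem_cat uL orbT.
  + by rewrite inE => /eqP->; apply: ox; rewrite in_cons mem_cat mem_head !orbT.
move=> _ ar; apply: (@DiagramMulti _ m0 z (rcons L x) x0 L').
  have xo : orths [:: x] (x0 :: L').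
    move=> u v; rewrite inE => /eqP-> vL; apply: ox.
      by rewrite in_cons mem_cat vL !orbT.
    apply: contraTneq yL => <-.
    move: un; rewrite -cat_cons -[x :: _]cat1s catA cat_uniq.
    by case/and3P => _ /hasPn/(_ _ vL); rewrite mem_cat negb_or => /andP[_ ?] _.
  split=> //.
    move=> u v; rewrite in_cons mem_rcons in_cons => /or3P[/eqP->|/eqP->|uL] vL.
    - by apply: o1; rewrite ?mem_head.
    - by apply: xo; rewrite ?mem_head // in_cons vL orbT.
    - by apply: o1; rewrite // in_cons uL orbT.
  move=> u v; rewrite mem_rcons in_cons => /orP[/eqP->|uL] vL.
    by apply: xo; rewrite ?mem_head.
  exact: o2.
by have pm := perm_refl (x :: z :: L ++ x0 :: L'); perm_by_count pm.
Qed.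

Lemma diagram_add t x y : diagram t -> uniq (x :: t) -> {subset x :: t <= b} ->
  y \in t -> ip x y != 0 -> {in t, forall u, u != y -> ip x u = 0} ->
  diagram (x :: t).
Proof.
move=> sh un sub yt xy ox.
have xb : x \in b by rewrite sub ?mem_head.
have yb : y \in b by rewrite sub // in_cons yt orbT.
have yx : y != x by apply: contraTneq yt => ->; case/andP: un.
have [m /andP[m0 m4] byx] : exists2 m, (0 < m < 4)%N & mbond m y x.
  by case: (b_bond yb xb yx) => // yx0; rewrite ipC yx0 eqxx in xy.
have reduce t' : perm_eq t t' -> [/\ uniq (x :: t'), {subset x :: t' <= b},
    {in t', forall u, u != y -> ip x u = 0} & (diagram (x :: t') -> diagram (x :: t))].
  move=> tt'; have xtt' : perm_eq (x :: t) (x :: t') by rewrite perm_cons.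
  split; first by rewrite -(perm_uniq xtt').
  - by move=> u; rewrite -(perm_mem xtt'); apply: sub.
  - by move=> u; rewrite -(perm_mem tt'); apply: ox.
  - by apply: diagram_perm; rewrite perm_sym.
case: sh => [z L1 L2 a1 a2 o tE|z L1 L2 L3 f tE|m1 z L x0 L' mu tE].
- have := yt; rewrite (perm_mem tE) => /(path_recenter a1 a2 o).
  move=> [K1 [K2 [{}a1 {}a2 {}o tE']]]; have {}tE := perm_trans tE tE'.
  have [{}un {}sub {}ox red] := reduce _ tE; apply: red.
  have yK : y \notin K1 ++ K2 by case/and3P: un.
  have oK K : {subset K <= K1 ++ K2} -> orths [:: x] K.
    move=> sK u v; rewrite inE => /eqP-> /sK vK; apply: ox; first by rewrite in_cons vK orbT.
    by apply: contraNneq yK => <-.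
  have oK1 : orths [:: x] K1 by apply: oK => u uK; rewrite mem_cat uK.
  have oK2 : orths [:: x] K2 by apply: oK => u uK; rewrite mem_cat uK orbT.
  have pm := perm_refl (x :: y :: K1 ++ K2).
  have [m1|m1] := eqVneq m 1%N.
    have byx1 : bond y x by apply: mbond1; rewrite -m1.
    case: K1 => [|h1 K1] in a1 o tE tE' un sub ox yK oK oK1 pm *.
      by apply: (@DiagramPath _ y [:: x] K2) => //; perm_by_count pm.
    case: K2 => [|h2 K2] in a2 o tE tE' un sub ox yK oK oK2 pm *.
      apply: (@DiagramPath _ y [:: x] (h1 :: K1)) => //.
      by rewrite cats0 in pm *; perm_by_count pm.
    by apply: (@DiagramFork _ y [:: x] (h1 :: K1) (h2 :: K2)) => //; perm_by_count pm.
  have m2 : (1 < m < 4)%N by rewrite m4 andbT; case: (m) m0 m1 => [|[|]].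
  case: K1 => [|h1 K1] in a1 o tE tE' un sub ox yK oK oK1 pm *.
    apply: (@DiagramMulti _ m y K2 x [::]); last by perm_by_count pm.
    by split=> //; apply: orthsC.
  case: K2 => [|h2 K2] in a2 o tE tE' un sub ox yK oK oK2 pm *.
    apply: (@DiagramMulti _ m y (h1 :: K1) x [::]); last by perm_by_count pm.
    by split=> //; apply: orthsC.
  have mu : multi m y (h2 :: K2) x [::] by split=> //; apply: orthsC.
  (* A multiple bond at an interior node of a path is impossible: [x] takes at least half of the
     squared length of [y], so the leaf [h1] could only prolong the arm through [h2] at its far end,
     yet it is bonded to [y]. *)
  have [] := @leaf_on_arm_simple y (h2 :: K2) y h1 1 [:: x].
  + apply: (@subseq_uniq _ _ (y :: (h2 :: K2) ++ (h1 :: K1) ++ [:: x])).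
      rewrite -!cat_cons; apply: cat_subseq => //; rewrite cat_cons /= eqxx.
      by rewrite sub1seq mem_cat mem_head orbT.
    rewrite (perm_uniq (_ : perm_eq _ (x :: y :: (h1 :: K1) ++ h2 :: K2))) //.
    by perm_by_count pm.
  + move=> u; rewrite !(in_cons, mem_cat) in_nil => uin; apply: sub.
    rewrite !(in_cons, mem_cat); move: uin.
    by do ![case/orP|move=> ->|rewrite ?orbT //].
  + by [].
  + by [].
  + exact: orthsC.
  + rewrite big_seq1 (weight_mbond (m := m)) ?b_neq0 //.
    by apply: half_le_quarters; rewrite ?ip_ge0 // ler_nat; case/andP: m2.
  + by rewrite mem_head.
  + by [].
  + by apply: bond_mbond; case: a1.
  + move=> u; rewrite in_cons mem_cat => /or3P[uy|uK|ux] uy'.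
    - by rewrite uy in uy'.
    - by apply: o; rewrite ?mem_head.
    by move: ux; rewrite inE => /eqP->; rewrite ipC; apply: oK1; rewrite ?mem_head.
  move=> _ /=; case=> _ ho _.
  have := ho y h1; rewrite ?mem_head mem_rcons mem_head => /(_ isT isT) yh1.
  have : ip y h1 != 0.
    case: a1 => -[_ ->] _ _; rewrite mulf_neq0 ?invr_eq0 ?pnatr_eq0 //.
    by rewrite oppr_eq0 gt_eqF // ip_gt0 b_neq0.
  by rewrite yh1 eqxx.
- move: yt; rewrite (perm_mem tE) in_cons !mem_cat => yt.
  have [y1|[y2|y3]] : y \in z :: L1 \/ y \in z :: L2 \/ y \in z :: L3.
    by rewrite !in_cons; case/or4P: yt => ->; rewrite ?orbT; auto.
  + have [? ? ? red] := reduce _ tE.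
    by apply: red; apply: (fork_add (y := y) (m := m)).
  + have {}tE : perm_eq t (z :: L2 ++ L1 ++ L3) by perm_by_count tE.
    have [? ? ? red] := reduce _ tE.
    by apply: red; apply: (fork_add (y := y) (m := m)) => //; apply: fork_swap12.
  + have {}tE : perm_eq t (z :: L3 ++ L1 ++ L2) by perm_by_count tE.
    have [? ? ? red] := reduce _ tE.
    apply: red; apply: (fork_add (y := y) (m := m)) => //.
    by apply: fork_swap12; apply: fork_swap23.
- move: yt; rewrite (perm_mem tE) in_cons mem_cat => yt.
  have [y1|y2] : y \in z :: L \/ y \in x0 :: L'.
    by move: yt; rewrite !in_cons; case/or4P => ->; rewrite ?orbT; auto.
  + have [? ? ? red] := reduce _ tE.
    by apply: red; apply: (multi_add (m0 := m1) (y := y) (m := m)).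
  + have {}tE : perm_eq t (x0 :: L' ++ z :: L) by perm_by_count tE.
    have [? ? ? red] := reduce _ tE.
    by apply: red; apply: (multi_add (m0 := m1) (y := y) (m := m)) => //; apply: multiC.
Qed.

End DiagramGrowth.

(** The inequality is 1/p + 1/q + 1/r > 1 with denominators cleared. Since p, q, r exceed the arm
    lengths by one, the solutions (2, 2, r) and (2, 3, r) with r < 6 are the forks of types D and
    E. *)
Lemma unit_fractions (p q r : nat) : (1 < p)%N -> (p <= q)%N -> (q <= r)%N ->
  (p * q * r < q * r + p * r + p * q)%N ->
  p = 2%N /\ (q = 2%N \/ q = 3%N /\ (r < 6)%N).
Proof.
move=> p1 pq qr lt.
have p2 : p = 2%N.
  have : (p < 3)%N; last by lia.
  rewrite ltnNge; apply/negP => p3.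
  have : (3 * (q * r) <= p * q * r)%N by rewrite -mulnA leq_mul2r p3 orbT.
  have : (p * r <= q * r)%N by rewrite leq_mul2r pq orbT.
  have : (p * q <= q * r)%N by rewrite mulnC leq_mul2l (leq_trans pq qr) orbT.
  lia.
subst p; split=> //.
have : (q < 4)%N by nia.
by case: q {p1} pq qr lt => [|[|[|[|]]]] // _ qr lt _; [left|right; split=> //; nia].
Qed.

Lemma fork_sizes (R : realFieldType) (p q r : nat) (a : R) : 0 < a ->
  1%:R * (p.+1%:R / p.+2%:R) * a / 2 + (1%:R * (q.+1%:R / q.+2%:R) * a / 2 +
   (1%:R * (r.+1%:R / r.+2%:R) * a / 2 + 0)) < a ->
  (p.+2 * q.+2 * r.+2 < q.+2 * r.+2 + p.+2 * r.+2 + p.+2 * q.+2)%N.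
Proof.
move=> a0 lt; rewrite -(ltr_nat R) !natrD !natrM.
have e n : (n.+1%:R : R) = n.+2%:R - 1 by rewrite -[n.+2%:R]natr1 addrK.
rewrite (e p) (e q) (e r) in lt; move: (ltr0Sn R p.+1) (ltr0Sn R q.+1) (ltr0Sn R r.+1) lt.
move: (p.+2%:R) (q.+2%:R) (r.+2%:R) => x y z x0 y0 z0 lt.
have xyz : 0 < x * y * z / a by rewrite divr_gt0 // !mulr_gt0.
rewrite -(ltr_pM2r xyz) in lt.
have e1 : a * (x * y * z / a) = x * y * z by field; rewrite gt_eqF.
rewrite e1 in lt.
suff : (1 * ((x - 1) / x) * a / 2 + (1 * ((y - 1) / y) * a / 2 +
     (1 * ((z - 1) / z) * a / 2 + 0))) * (x * y * z / a) =
   (3 * (x * y * z) - (y * z + x * z + x * y)) / 2 by lra.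
by field; rewrite !gt_eqF.
Qed.

Lemma multi_sizes (R : realFieldType) (m p q : nat) (a : R) : 0 < a ->
  m%:R * (p.+1%:R / p.+2%:R) * a / 2 + 1%:R * (q%:R / q.+1%:R) * a / 2 < a ->
  (m * (p.+1 * q.+1) + q * p.+2 < 2 * (p.+2 * q.+1))%N.
Proof.
move=> a0 lt; rewrite -(ltr_nat R) !(natrD, natrM).
have e n : (n%:R : R) = n.+1%:R - 1 by rewrite -[n.+1%:R]natr1 addrK.
rewrite (e p.+1) (e q) in lt *.
move: (ltr0Sn R p.+1) (ltr0Sn R q) lt.
move: (p.+2%:R) (q.+1%:R) (m%:R) => x y k x0 y0 lt.
have xya : 0 < x * y / a by rewrite divr_gt0 // mulr_gt0.
rewrite -(ltr_pM2r xya) in lt.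
have e1 : a * (x * y / a) = x * y by field; rewrite gt_eqF.
rewrite e1 in lt.
suff : (k * ((x - 1) / x) * a / 2 + 1 * ((y - 1) / y) * a / 2) * (x * y / a) =
   (k * ((x - 1) * y) + (y - 1) * x) / 2 by lra.
by field; rewrite !gt_eqF.
Qed.

(** Here p and q count the further nodes on the two sides of the multiple bond. A triple bond admits
    none (G_2); for a double bond, p q < 2 leaves a bare side (B, C) or one node on each side
    (F_4). *)
Lemma multi_sizes_cases (m p q : nat) : (1 < m)%N -> (m < 4)%N ->
  (m * (p.+1 * q.+1) + q * p.+2 < 2 * (p.+2 * q.+1))%N ->
  [/\ m = 3%N, q = 0%N & p = 0%N] \/ m = 2%N /\ (p * q < 2)%N.
Proof.
move: m => [|[|[|[|m]]]] // _ _ h; [right; split=> //; nia|left].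
by have [p0 q0] : p = 0%N /\ q = 0%N by nia.
Qed.

(** * The classification of connected Dynkin diagrams *)

Section Classification.
Variables (R : realType) (V : vectType R) (ip : {dot V for idfun}).
Implicit Types (x y z u v w d : V) (L t : seq V).
Local Notation arm := (arm ip).
Local Notation orths := (orths ip).
Local Notation mbond := (mbond ip).
Local Notation fork := (fork ip).
Local Notation multi := (multi ip).

(** Read from the end of the list, each node is a leaf attached to those already placed, which is
    the order in which the diagram is grown. *)
Fixpoint tree t : Prop :=
  if t is x :: t' then
    (t' = [::] \/ exists2 y, y \in t' & {in t', forall u, u != y -> ip x u = 0})
    /\ tree t'
  else True.

(** B and C share a constructor because [mbond] does not say which end is longer. The arm [L] may be
    empty in the first two cases, giving A_1 and B_2; the bounds on [size L] give E_6, E_7 and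
    E_8. *)
Inductive dynkin t : Prop :=
| DynkinA z L of arm z L & perm_eq t (z :: L)
| DynkinBC z L x of multi 2 z L x [::] & perm_eq t (x :: z :: L)
| DynkinD z L x y of fork z [:: x] [:: y] L & perm_eq t (x :: y :: z :: L)
| DynkinE z L x y y' of fork z [:: x] [:: y; y'] L & (2 <= size L <= 4)%N
    & perm_eq t (z :: x :: y :: y' :: L)
| DynkinF z x y x' of multi 2 z [:: y] x [:: x'] & perm_eq t [:: y; z; x; x']
| DynkinG z x of multi 3 z [::] x [::] & perm_eq t [:: z; x].

Lemma path_arm z L1 L2 : arm z L1 -> arm z L2 -> orths L1 L2 ->
  exists y L, arm y L /\ perm_eq (z :: L1 ++ L2) (y :: L).
Proof.
elim: L1 z L2 => [|x L1 IH] z L2 a1 a2 o; first by exists z, L2.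
case: a1 => b zo ax.
have [] := IH x (z :: L2) ax.
- split=> //; first exact: bondC.
  by apply: orths_sub o _ _ => // u; rewrite inE => /eqP->; rewrite mem_head.
- apply: orthsC; apply: orths_consl => //; apply: orthsC.
  by apply: orths_sub o _ _ => // u uL; rewrite in_cons uL orbT.
by move=> y [L [ay pm]]; exists y, L; split=> //; perm_by_count pm.
Qed.

Lemma fork_sort z L1 L2 L3 : fork z L1 L2 L3 ->
  exists K1 K2 K3, [/\ fork z K1 K2 K3, (size K1 <= size K2 <= size K3)%N
    & perm_eq (L1 ++ L2 ++ L3) (K1 ++ K2 ++ K3)].
Proof.
have sort2 : forall L1 L2 L3, fork z L1 L2 L3 -> exists K1 K2 K3,
    [/\ fork z K1 K2 K3, (size K1 <= size K3)%N, (size K2 <= size K3)%N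
      & perm_eq (L1 ++ L2 ++ L3) (K1 ++ K2 ++ K3)].
  move=> {}L1 {}L2 {}L3 f; have pm := perm_refl (L1 ++ L2 ++ L3).
  have [h12|/ltnW h12] := leqP (size L1) (size L2).
    have [h23|/ltnW h23] := leqP (size L2) (size L3).
      by exists L1, L2, L3; split=> //; apply: leq_trans h23.
    exists L1, L3, L2; split=> //; first exact: fork_swap23.
    by perm_by_count pm.
  have [h13|/ltnW h13] := leqP (size L1) (size L3).
    by exists L1, L2, L3; split=> //; apply: leq_trans h13.
  exists L2, L3, L1; split=> //; first by apply/fork_swap23/fork_swap12.
  by perm_by_count pm.
move=> /sort2[K1 [K2 [K3 [f h1 h2 pm]]]].
have [h12|/ltnW h12] := leqP (size K1) (size K2).
  by exists K1, K2, K3; split=> //; rewrite h12.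
exists K2, K1, K3; split; [exact: fork_swap12|by rewrite h12|by perm_by_count pm].
Qed.

Variable b : seq V.
Hypothesis b_uniq : uniq b.
Hypothesis b_neq0 : {in b, forall x, x != 0}.
Hypothesis b_dual : forall x, x \in b ->
  exists d, ip x d = 1 /\ {in b, forall y, y != x -> ip y d = 0}.
Hypothesis b_bond : forall x y, x \in b -> y \in b -> x != y ->
  ip x y = 0 \/ exists2 m : nat, (0 < m < 4)%N & mbond m x y.
Hypothesis b_conn : forall A : pred V, has A b -> ~~ all A b ->
  exists x y, [/\ x \in b, y \in b, A x, ~~ A y & ip x y != 0].

Definition normalize x : V := (Num.sqrt (ip x x))^-1 *: x.

Lemma normalize_ip x : x \in b -> ip (normalize x) (normalize x) = 1.
Proof.
move=> xb; have xx : 0 < ip x x by rewrite ip_gt0 b_neq0.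
have s0 : Num.sqrt (ip x x) != 0 by rewrite gt_eqF // sqrtr_gt0.
rewrite /normalize !ipE -{3}(sqr_sqrtr (ltW xx)); by field.
Qed.

(** The cosine at a bond of multiplicity m is - sqrt m / 2, hence at most -1/2. *)
Lemma normalize_le x y : x \in b -> y \in b -> x != y ->
  ip (normalize x) (normalize y) <= - (ip x y != 0)%:R / 2.
Proof.
move=> xb yb xy; rewrite /normalize !ipE.
have [->|[m /andP[m0 _] bxy]] := b_bond xb yb xy.
  by rewrite !mulr0 eqxx oppr0 mul0r.
have xx : 0 < ip x x by rewrite ip_gt0 b_neq0.
have yy : 0 < ip y y by rewrite ip_gt0 b_neq0.
have : 0 < Num.sqrt (ip x x) by rewrite sqrtr_gt0.
have : 0 < Num.sqrt (ip y y) by rewrite sqrtr_gt0.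
have := sqr_sqrtr (ltW xx); have := sqr_sqrtr (ltW yy).
have m1 : (1 : R) <= m%:R by rewrite ler1n.
move: (Num.sqrt (ip x x)) (Num.sqrt (ip y y)) => s q q2 s2 q0 s0.
have sq0 : 0 < s * q by rewrite mulr_gt0.
have key : ip x y <= - (s * q) / 2.
  case: bxy => -[e1 ->].
    have : q <= s.
      by rewrite -ler_sqr ?nnegrE ?(ltW s0) ?(ltW q0) // s2 q2 e1 ler_peMl // ltW.
    by rewrite -s2; nra.
  have : s <= q.
    by rewrite -ler_sqr ?nnegrE ?(ltW s0) ?(ltW q0) // s2 q2 e1 ler_peMl // ltW.
  by rewrite -q2; nra.
apply: (@le_trans _ _ (-1 / 2)).
  rewrite mulrA -invfM mulrC ler_pdivrMr //; move: key; lra.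
by rewrite ler_pM2r ?invr_gt0 // lerN2 lern1; case: (_ != _).
Qed.

(** The sum of the unit vectors at the nodes has squared length at most nodes minus edges, since
    each edge contributes at most -1; the bound 1 is the value for a tree. A new node with two or
    more neighbours would bring it down to 0 or below, against linear independence, so every node
    enters as a leaf. *)
Lemma growth n : (n < size b)%N ->
  exists t, [/\ size t = n.+1, uniq t, {subset t <= b}, diagram ip t & tree t] /\
    ip (\sum_(x <- t) normalize x) (\sum_(x <- t) normalize x) <= 1.
Proof.
elim: n => [|n IH] nb.
  case: b nb b_neq0 normalize_ip => // x b' _ x0 nx; exists [:: x]; split.
    split=> //.
    - by move=> y; rewrite inE => /eqP->; rewrite mem_head.
    - exact: (@DiagramPath _ _ _ _ x [::] [::]).
    - by split=> //; left.
  by rewrite big_seq1 nx ?mem_head.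
have [t [[st ut sub sh tr] Q]] := IH (ltnW nb).
have [y0 [x [y0b xb y0t xt y0x]]] : exists x y, [/\ x \in b, y \in b, x \in t, y \notin t & ip x y != 0].
  apply: b_conn.
    case: t st sub {ut sh tr Q} => // x t _ sub; apply/hasP; exists x; last exact: mem_head.
    by rewrite sub ?mem_head.
  apply: contraL nb => /allP bt; rewrite -leqNgt -st.
  exact: uniq_leq_size.
set w := \sum_(x <- t) _ in Q.
pose nb' := count (fun u => ip x u != 0) t.
have xw : ip (normalize x) w <= - nb'%:R / 2.
  rewrite /w ip_sumr /nb' -sum1_count natr_sum -sumrN mulr_suml.
  rewrite [X in _ <= X]big_mkcond /= !big_seq; apply: ler_sum => u ut'.
  apply: le_trans (normalize_le xb (sub u ut') _) _.
    by apply: contraNneq xt => ->.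
  by case: (_ != _); rewrite ?oppr0 ?mul0r.
have Q' : ip (normalize x + w) (normalize x + w) <= ip w w + 1 - nb'%:R.
  move: (normalize x) (normalize_ip xb) xw; clearbody w => e nx ew.
  by rewrite !ipE nx (ipC w); lra.
have xw0 : 0 < ip (normalize x + w) (normalize x + w).
  have [d [xd dx]] := b_dual xb.
  rewrite ip_gt0; apply/eqP => /(congr1 (ip^~ d)).
  rewrite ip0l ipDl ipZl xd mulr1 /w ip_suml big_seq big1 ?addr0 => [/eqP|u ut'].
    by rewrite invr_eq0 gt_eqF // sqrtr_gt0 ip_gt0 b_neq0.
  rewrite ipZl dx ?mulr0 ?sub //; by apply: contraNneq xt => <-.
have nb1 : (nb' < 2)%N.
  rewrite -(ltr_nat R); move: xw0 Q' Q; lra.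
have y0f : y0 \in filter (fun u => ip x u != 0) t by rewrite mem_filter ipC y0x.
have nb0 : (0 < nb')%N by rewrite -has_count; apply/hasP; exists y0; rewrite // ipC.
exists (x :: t).
have ox : {in t, forall u, u != y0 -> ip x u = 0}.
  move=> u ut' uy; apply/eqP; apply: contraLR nb1 => xu; rewrite -leqNgt.
  rewrite /nb' -size_filter; apply: (@uniq_leq_size _ [:: y0; u]).
    by rewrite /= inE eq_sym uy.
  by move=> v; rewrite !inE => /orP[]/eqP-> //; rewrite mem_filter xu.
have uxt : uniq (x :: t) by rewrite /= xt.
have subx : {subset x :: t <= b} by move=> u; rewrite in_cons => /orP[/eqP->|/sub].
split; last first.
  rewrite big_cons; apply: le_trans Q' _.
  have : (1 : R) <= nb'%:R by rewrite ler1n.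
  by move: Q; lra.
split=> //; first by rewrite /= st.
- apply: (diagram_add b_neq0 b_dual b_bond sh uxt subx y0t) => //.
  by rewrite ipC.
- by split=> //; right; exists y0.
Qed.

Lemma diagram_dynkin t : uniq t -> {subset t <= b} -> diagram ip t -> dynkin t.
Proof.
move=> ut sub [z L1 L2 a1 a2 o tE|z L1 L2 L3 f tE|m z L x L' mu tE].
- have [y [L [ay pm]]] := path_arm a1 a2 o.
  exact: DynkinA ay (perm_trans tE pm).
- have [K1 [K2 [K3 [[[a1 a2 a3] [o12 o13 o23] [n1 n2 n3]] /andP[h12 h23] pm]]]] := fork_sort f.
  have {pm}tE : perm_eq t (z :: K1 ++ K2 ++ K3).
    by apply: perm_trans tE _; rewrite perm_cons.
  have fk : fork z K1 K2 K3 by split; split.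
  have Kb u : u \in z :: K1 ++ K2 ++ K3 -> u \in b by rewrite -(perm_mem tE) => /sub.
  have z_b : z \in b by rewrite Kb ?mem_head.
  have zn : z \notin K1 ++ K2 ++ K3 by move: ut; rewrite (perm_uniq tE) => /andP[].
  have [d [zd dz]] := b_dual z_b; have z0 := b_neq0 z_b.
  have Kd u : u \in K1 ++ K2 ++ K3 -> ip u d = 0.
    move=> uK; apply: dz; first by rewrite Kb // in_cons uK orbT.
    by apply: contraNneq zn => <-.
  have armd K : {subset K <= K1 ++ K2 ++ K3} -> ip (armv K) d = 0.
    move=> sK; rewrite ipC armv_orth // => u v; rewrite inE => /eqP-> vK.
    by rewrite ipC Kd // sK.
  have wK K : arm z K -> K <> [::] -> {subset K <= K1 ++ K2 ++ K3} ->
      weight ip z (armv K) = 1%:R * ((size K)%:R / (size K).+1%:R) * ip z z / 2.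
    case: K => // h K [bh oh ah] _ sK; rewrite (weight_armv (m := 1)) //.
      by rewrite b_neq0 // Kb // in_cons sK ?orbT // mem_head.
    exact: bond_mbond.
  have s1 : {subset K1 <= K1 ++ K2 ++ K3} by move=> u uK; rewrite !mem_cat uK.
  have s2 : {subset K2 <= K1 ++ K2 ++ K3} by move=> u uK; rewrite !mem_cat uK !orbT.
  have s3 : {subset K3 <= K1 ++ K2 ++ K3} by move=> u uK; rewrite !mem_cat uK !orbT.
  (* The three arms are mutually orthogonal, so the projections of [z] on their spans obey Bessel's
     inequality. *)
  have : \sum_(u <- [:: armv K1; armv K2; armv K3]) weight ip z u < ip z z.
    apply: (@bessel _ _ ip _ z d); first by rewrite zd oner_neq0.
  + by move=> u; rewrite !inE => /or3P[]/eqP->; apply: armd.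
  + move=> u; rewrite !inE => /or3P[]/eqP->;
      by apply: (armv_neq0 (ip := ip) (y := z)) => //; apply/eqP.
  + by rewrite /= !armv_orths // eqxx.
  rewrite !big_cons big_nil !wK // => lt.
  case: K1 => [|x K1] // in a1 o12 o13 n1 h12 tE fk lt {Kb zn Kd armd wK s1 s2 s3} *.
  case: K2 => [|y K2] // in a2 o12 o23 n2 h12 h23 tE fk lt *.
  case: K3 => [|v K3] // in a3 o13 o23 n3 h23 tE fk lt *.
  have zz : 0 < ip z z by rewrite ip_gt0.
  have := fork_sizes zz lt => /(unit_fractions _ _ _)[]//.
  case=> /size0nil K10 [[/size0nil K20]|[K21 h3]].
    subst K1 K2; apply: (@DynkinD _ z (v :: K3) x y) => //; by perm_by_count tE.
  subst K1; case: K2 K21 => [|y' [|//]] // _ in a2 o12 o23 h23 h12 tE fk lt n2 *.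
  apply: (@DynkinE _ z (v :: K3) x y y') => //.
  by apply/andP; split.
- case: (mu) => /andP[m1 m4] bzx [aL aL'] o1 o2.
  have Kb u : u \in z :: L ++ x :: L' -> u \in b by rewrite -(perm_mem tE) => /sub.
  have z_b : z \in b by rewrite Kb ?mem_head.
  have zn : z \notin L ++ x :: L' by move: ut; rewrite (perm_uniq tE) => /andP[].
  have [d [zd dz]] := b_dual z_b; have z0 := b_neq0 z_b.
  have Kd u : u \in L ++ x :: L' -> ip u d = 0.
    move=> uK; apply: dz; first by rewrite Kb // in_cons uK orbT.
    by apply: contraNneq zn => <-.
  have armd K : {subset K <= L ++ x :: L'} -> ip (armv K) d = 0.
    move=> sK; rewrite ipC armv_orth // => u v; rewrite inE => /eqP-> vK.
    by rewrite ipC Kd // sK.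
  have s1 : {subset L <= L ++ x :: L'} by move=> u uK; rewrite !mem_cat uK.
  have s2 : {subset x :: L' <= L ++ x :: L'} by move=> u uK; rewrite !mem_cat uK !orbT.
  have x0 : x != 0 by rewrite b_neq0 // Kb // !in_cons mem_cat mem_head !orbT.
  have zz : 0 < ip z z by rewrite ip_gt0.
  have m0 : (0 < m)%N by apply: ltn_trans m1.
  have ozL' : orths [:: z] L'.
    by apply: orths_sub o1 _ _ => // u; rewrite inE => /eqP->; rewrite mem_head.
  have wx := weight_armv m0 x0 bzx aL' ozL'.
  have lt : m%:R * ((size L').+1%:R / (size L').+2%:R) * ip z z / 2 +
      1%:R * ((size L)%:R / (size L).+1%:R) * ip z z / 2 < ip z z.
    (* An empty [L] contributes the share 0, but its [armv] is the zero vector and must stay out of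
       the Bessel family. *)
    have [L0|/eqP L0] := eqVneq L [::].
      rewrite L0 /= mul0r mulr0 !mul0r addr0 -wx.
      suff : \sum_(u <- [:: armv (x :: L')]) weight ip z u < ip z z.
        by rewrite big_seq1.
      apply: (@bessel _ _ ip _ z d) => //; first by rewrite zd oner_neq0.
        by move=> u; rewrite !inE => /eqP->; apply: armd.
      by move=> u; rewrite !inE => /eqP->; apply: armv_cons_neq0 aL'.
    have -> : 1%:R * ((size L)%:R / (size L).+1%:R) * ip z z / 2 = weight ip z (armv L).
      have L_neq0 u : u \in L -> u != 0.
        by move=> uL; rewrite b_neq0 // Kb // in_cons mem_cat uL orbT.
      case: L {o1 o2 mu tE Kb zn Kd armd s1 s2} L0 aL L_neq0 => // h K _ [bh oh ah] h0.
      rewrite (weight_armv (m := 1)) ?h0 ?mem_head //; exact: bond_mbond.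
    rewrite -wx.
    suff : \sum_(u <- [:: armv (x :: L'); armv L]) weight ip z u < ip z z.
      by rewrite big_cons big_seq1.
    apply: (@bessel _ _ ip _ z d); first by rewrite zd oner_neq0.
    - by move=> u; rewrite !inE => /orP[]/eqP->; apply: armd.
    - move=> u; rewrite !inE => /orP[]/eqP->; first exact: armv_cons_neq0 aL'.
      by apply: (armv_neq0 z0 aL); apply/eqP.
    - by have /= o3 := armv_orths (orthsC o2); rewrite /= o3 eqxx.
  have [[m3 L0 L0']|[m2 L0L']] := multi_sizes_cases m1 m4 (multi_sizes zz lt).
    move: mu tE; rewrite m3 (size0nil L0) (size0nil L0') => mu tE.
    exact: DynkinG mu tE.
  subst m; case: L' => [|x' L'] in mu tE L0L' o1 o2 aL' lt wx ozL' Kb Kd zn armd s1 s2 *.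
    by apply: DynkinBC mu _; perm_by_count tE.
  case: L => [|y L] in mu tE L0L' o1 o2 aL lt Kb Kd zn armd s1 s2 *.
    by apply: (DynkinBC (multiC mu)); perm_by_count tE.
  have [L'0 L0] : size L' = 0%N /\ size L = 0%N.
    by move: L0L' => /=; case: (size L') => [|?]; case: (size L) => [|?].
  rewrite (size0nil L0) (size0nil L'0) in mu tE.
  by apply: DynkinF mu _; perm_by_count tE.
Qed.

Theorem dynkin_classification : b != [::] ->
  exists t, [/\ perm_eq t b, tree t & dynkin t].
Proof.
move=> b0; have sb : ((size b).-1 < size b)%N by case: (b) b0.
have [t [[st ut sub sh tr] _]] := growth sb.
exists t; split=> //; last exact: diagram_dynkin.
have [|_ eqm] := uniq_min_size ut sub; last exact: uniq_perm.
by rewrite st (ltn_predK sb).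
Qed.

End Classification.

(** * Coxeter elements *)

Section Coxeter.
Variables (R : realType) (V : vectType R) (ip : {dot V for idfun}).
Implicit Types (x y z u v : V) (s t : seq V).
Local Notation cox := (coxeter_element ip).

Lemma cox_cat s t x : cox (s ++ t) x = cox s (cox t x).
Proof. by elim: s => //= y s ->. Qed.

Lemma cox_linear s : linear (cox s).
Proof. by elim: s => //= a s IH c x y; rewrite /= IH reflection_is_linear. Qed.

Lemma iter_linear (f : V -> V) m : linear f -> linear (iter m f).
Proof. by move=> lf; elim: m => //= m IH c x y; rewrite /= IH lf. Qed.

Lemma linear_span_id (f : V -> V) s : linear f -> (<<s>> = fullv)%VS ->
  {in s, forall x, f x = x} -> f =1 id.
Proof.
move=> lf sV fs x; have xs : x \in <<in_tuple s>>%VS by rewrite sV memvf.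
have f0 : f 0 = 0.
  have := lf (-1) 0 0; rewrite scaler0 add0r scaleN1r addNr.
  by [].
rewrite (coord_span xs); elim/big_rec: _ => [|i y _ IH]; first exact: f0.
by rewrite lf IH fs // mem_nth.
Qed.

(** Rotating a word conjugates the product of its reflections; swapping two adjacent orthogonal
    letters leaves the product unchanged. *)
Inductive word_equiv : seq V -> seq V -> Prop :=
| WordRefl s : word_equiv s s
| WordTrans s t r : word_equiv s t -> word_equiv t r -> word_equiv s r
| WordSym s t : word_equiv s t -> word_equiv t s
| WordRot x s : word_equiv (x :: s) (rcons s x)
| WordSwap s x y t : ip x y = 0 ->
    word_equiv (s ++ x :: y :: t) (s ++ y :: x :: t).

Lemma word_equiv_perm s t : word_equiv s t -> perm_eq s t.
Proof.
elim=> {s t} [s|s t u _ h1 _ h2|s t _|x s|s x y t _] //.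
- exact: perm_trans h1 h2.
- by rewrite perm_sym.
- by rewrite perm_sym perm_rcons.
- by rewrite perm_cat2l; apply/permP => p; rewrite /= addnCA.
Qed.

Lemma word_rot s t : word_equiv (s ++ t) (t ++ s).
Proof.
elim: s t => [|x s IH] t; first by rewrite cats0; apply: WordRefl.
apply: WordTrans (WordRot _ _) _; rewrite rcons_cat.
by apply: WordTrans (IH _) _; rewrite -cats1 -catA; apply: WordRefl.
Qed.

Lemma word_push x s t : {in s, forall u, ip x u = 0} ->
  word_equiv (x :: s ++ t) (s ++ x :: t).
Proof.
have gen : forall s r, {in s, forall u, ip x u = 0} ->
    word_equiv (r ++ x :: s ++ t) (r ++ s ++ x :: t).
  elim=> [|u {}s IH] r xs; first exact: WordRefl.
  apply: WordTrans (WordSwap _ _ (xs u (mem_head _ _))) _.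
  rewrite -cat_rcons; apply: WordTrans (IH _ _) _; last by rewrite cat_rcons; apply: WordRefl.
  by move=> v vs; rewrite xs // in_cons vs orbT.
exact: (gen s [::]).
Qed.

Section Leaf.
Variables (x y : V) (t0 : seq V).
Hypothesis xo : {in t0, forall u, u != y -> ip x u = 0}.

(** Substituting the block [x y] for the letter [y] lifts a word without the leaf [x] to a word
    containing it. *)
Definition graft1 u := if u == y then [:: x; y] else [:: u].
Definition graft s := flatten [seq graft1 u | u <- s].

Lemma graft_cat s t : graft (s ++ t) = graft s ++ graft t.
Proof. by rewrite /graft map_cat flatten_cat. Qed.

Lemma graft_id s : y \notin s -> graft s = s.
Proof.
elim: s => //= u s IH; rewrite in_cons negb_or => /andP[yu /IH e].
by rewrite /graft /= -/(graft s) e /graft1 eq_sym (negPf yu).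
Qed.

(** A letter other than [y] that commutes with [y] also commutes with the leaf [x], so it passes the
    block [x y] in two swaps; a rotation lifts to a rotation by a whole block. *)
Lemma graft_equiv s t : word_equiv s t -> {subset s <= t0} ->
  word_equiv (graft s) (graft t).
Proof.
elim=> {s t} [s|s t u st h1 tu h2|s t st h|u s|s u v t uv] sub.
- exact: WordRefl.
- apply: WordTrans (h1 sub) (h2 _) => w.
  by rewrite -(perm_mem (word_equiv_perm st)); apply: sub.
- apply/WordSym/h => w; rewrite (perm_mem (word_equiv_perm st)); exact: sub.
- by rewrite -cats1 graft_cat -cat1s graft_cat; apply: word_rot.
have [ut vt] : u \in t0 /\ v \in t0.
  by split; apply: sub; rewrite mem_cat !in_cons eqxx ?orbT.
have uvs : [:: u, v & t] = [:: u] ++ [:: v] ++ t by [].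
have vus : [:: v, u & t] = [:: v] ++ [:: u] ++ t by [].
rewrite uvs vus !graft_cat /graft /= !cats0 /graft1.
case: (eqVneq u y) => uy; case: (eqVneq v y) => vy.
- exact: WordRefl.
- have xv := xo vt vy; rewrite /= uy in uv *.
  apply: WordTrans (_ : word_equiv _ (_ ++ [:: x, v, y & _])) _.
    by rewrite -!(cat_rcons x); apply: WordSwap.
  exact: WordSwap.
- have xu := xo ut uy; rewrite /= vy in uv *.
  apply: WordTrans (_ : word_equiv _ (_ ++ [:: x, u, y & _])) _.
    by apply: WordSwap; rewrite ipC.
  by rewrite -!(cat_rcons x); apply: WordSwap.
- exact: WordSwap.
Qed.

Lemma cons_graft s : y \in s -> uniq s -> perm_eq s t0 -> word_equiv (x :: s) (graft s).
Proof.
move=> /splitPr[s1 s2]; rewrite cat_uniq /= negb_or => /and4P[_ /andP[y1 _] y2 _] st.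
have -> : graft (s1 ++ y :: s2) = s1 ++ [:: x, y & s2].
  rewrite graft_cat -[y :: s2]cat1s graft_cat (graft_id y1) (graft_id y2).
  by rewrite /graft /= /graft1 eqxx.
apply: word_push => u us.
apply: xo; first by rewrite -(perm_mem st) mem_cat us.
by apply: contraNneq y1 => <-.
Qed.

End Leaf.

(* Induction on the tree: a leaf x commutes with everything but its neighbour y,
   so it can be moved next to y and the pair xy treated as a single letter. *)
Lemma tree_words t t' : tree ip t -> uniq t -> perm_eq t t' -> word_equiv t t'.
Proof.
elim: t t' => [|x t IH] t'.
  by rewrite perm_sym => _ _ /perm_nilP->; apply: WordRefl.
move=> [leaf tr] /= /andP[xt ut] tt'.
have xt' : x \in t' by rewrite -(perm_mem tt') mem_head.
case/splitPr: xt' tt' => p q tt'.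
have tw : perm_eq t (q ++ p).
  by rewrite -(perm_cons x); apply: perm_trans tt' _; rewrite perm_catC.
apply: WordTrans (_ : word_equiv _ (x :: q ++ p)) _; last exact: (word_rot (x :: q) p).
case: leaf => [t0|[y yt xo]].
  by move: tw; rewrite t0 perm_sym => /perm_nilP->; apply: WordRefl.
apply: WordTrans (cons_graft xo yt ut (perm_refl _)) _.
apply: WordTrans (graft_equiv xo (IH _ tr ut tw) _) _ => //.
apply/WordSym/(cons_graft xo); rewrite -?(perm_mem tw) -?(perm_uniq tw) //.
by rewrite perm_sym.
Qed.

Definition conjugate (f g : V -> V) := exists u u' : V -> V,
  [/\ cancel u u', cancel u' u & forall x, g x = u' (f (u x))].

Lemma word_equiv_conjugate s t : {in s, forall x, x != 0} -> word_equiv s t ->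
  conjugate (cox s) (cox t).
Proof.
move=> s0 st; elim: st s0 => {s t} [s|s t u st h1 tu h2|s t st h|x s|s x y t xy] s0.
- by exists id, id.
- have [p [p' [pK p'K pE]]] := h1 s0.
  have [|q [q' [qK q'K qE]]] := h2.
    by move=> z; rewrite -(perm_mem (word_equiv_perm st)); apply: s0.
  exists (p \o q), (q' \o p'); split; [exact: can_comp|exact: can_comp|].
  by move=> z; rewrite qE pE.
- have [|p [p' [pK p'K pE]]] := h.
    by move=> z; rewrite (perm_mem (word_equiv_perm st)); apply: s0.
  by exists p', p; split=> // z; rewrite pE p'K p'K.
- have x0 := s0 x (mem_head _ _).
  exists (reflection ip x), (reflection ip x); split; try exact: reflection_invol.
  by move=> z; rewrite -cats1 cox_cat /= reflection_invol.
- exists id, id; split=> // z; rewrite !cox_cat /=; congr (cox s _).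
  have [x0 y0] : x != 0 /\ y != 0.
    by split; apply: s0; rewrite mem_cat !in_cons eqxx ?orbT.
  move: (cox t z) => w; rewrite !reflectionE !ipE xy (ipC y x) xy !mulr0 !subr0.
  by rewrite addrAC.
Qed.

Lemma iter_conj (f g u u' : V -> V) n : cancel u u' -> cancel u' u ->
  (forall x, g x = u' (f (u x))) -> forall x, iter n g x = u' (iter n f (u x)).
Proof.
by move=> uK u'K gE; elim: n => [|n IH] x /=; rewrite ?uK // IH gE u'K.
Qed.

Lemma has_order_conj (f g : V -> V) h : conjugate f g -> has_order f h -> has_order g h.
Proof.
move=> [u [u' [uK u'K gE]]] [h0 hf hk]; split=> //.
  by move=> x; rewrite (iter_conj _ uK u'K gE) hf uK.
move=> k kh gk; apply: (hk k kh) => x.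
by have := gk (u' x); rewrite (iter_conj _ uK u'K gE) u'K => /(can_inj u'K).
Qed.

Lemma has_order_uniq (f : V -> V) h h' : has_order f h -> has_order f h' -> h = h'.
Proof.
move=> [h0 hf hk] [h0' hf' hk']; have [hlt|hlt|//] := ltngtP h h'.
- by case: (hk' h); rewrite ?h0.
- by case: (hk h'); rewrite ?h0'.
Qed.

End Coxeter.

(** * Symmetric alcoved polytopes *)

Lemma seq_min (R : realType) (T : eqType) (s : seq T) (c : T -> R) : s != [::] ->
  exists2 a, a \in s & {in s, forall x, c a <= c x}.
Proof.
elim: s => // x [_ _|y s IH _].
  by exists x; [rewrite mem_head|move=> z; rewrite inE => /eqP->].
have [//|a as' amin] := IH.
have [xa|ax] := leP (c x) (c a).
  exists x; first exact: mem_head.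
  by move=> z; rewrite in_cons => /orP[/eqP->//|/amin]; apply: le_trans.
exists a; first by rewrite in_cons as' orbT.
by move=> z; rewrite in_cons => /orP[/eqP->|/amin//]; apply: ltW.
Qed.

(** * Weyl orbits of roots *)

Section WeylGroup.
Variables (R : realType) (V : vectType R) (ip : {dot V for idfun}).
Variable Phi : {fset V}.
Hypothesis Phi_root : root_system ip Phi.
Local Notation W := (weyl_group ip Phi).

Lemma weyl_isometry w : W w -> forall x y, ip (w x) (w y) = ip x y.
Proof.
elim=> {w} [a aP x y|//|f g _ hf _ hg x y|f g _ hf fg gf x y].
- by rewrite reflection_ip // (root_neq0 Phi_root).
- by rewrite /= hf hg.
- by rewrite -hf !gf.
Qed.

Lemma weyl_cancel w : W w -> exists w', [/\ W w', cancel w w' & cancel w' w].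
Proof.
elim=> {w} [a aP||f g _ [f' [Wf' fK f'K]] _ [g' [Wg' gK g'K]]|f g Wf _ fg gf].
- have a0 := root_neq0 Phi_root aP.
  by exists (reflection ip a); split; [apply: weyl_reflection|apply: reflection_invol..].
- by exists id; split=> //; apply: weyl_id.
- by exists (g' \o f'); split; [apply: weyl_comp|apply: can_comp..].
- by exists f.
Qed.

Definition weyl_conj a a' := exists2 w, W w & w a = a'.

Lemma weyl_conj_refl a : weyl_conj a a.
Proof. by exists id => //; apply: weyl_id. Qed.

Lemma weyl_conj_trans a a' a'' :
  weyl_conj a a' -> weyl_conj a' a'' -> weyl_conj a a''.
Proof.
by move=> [w Ww <-] [w' Ww' <-]; exists (w' \o w) => //; apply: weyl_comp.
Qed.

Lemma weyl_conj_sym a a' : weyl_conj a a' -> weyl_conj a' a.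
Proof.
by move=> [w Ww <-]; have [w' [Ww' wK _]] := weyl_cancel Ww; exists w'; rewrite ?wK.
Qed.

Lemma weyl_conj_reflection a x : x \in Phi -> weyl_conj a (reflection ip x a).
Proof. by move=> xP; exists (reflection ip x) => //; apply: weyl_reflection. Qed.

Lemma weyl_conj_bond x y : x \in Phi -> y \in Phi -> bond ip x y -> weyl_conj x y.
Proof.
move=> xP yP [xx xy].
have x0 : ip x x != 0 by rewrite gt_eqF // ip_gt0 (root_neq0 Phi_root).
have <- : reflection ip x (reflection ip y x) = y.
  rewrite !reflectionE !ipE (ipC y x) xy -xx.
  rewrite (_ : 2 * (- ip x x / 2) / ip x x = -1); last by field.
  rewrite (_ : 2 * _ / _ = 1); last by field.
  by rewrite scaleN1r opprK scale1r addrC addKr.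
exact: weyl_conj_trans (weyl_conj_reflection _ yP) (weyl_conj_reflection _ xP).
Qed.

Lemma weyl_conj_arm z L : {subset z :: L <= Phi} -> arm ip z L ->
  {in z :: L, forall x, weyl_conj z x}.
Proof.
elim: L z => [|y L IH] z sub ar x; rewrite in_cons.
  by rewrite in_nil orbF => /eqP->; apply: weyl_conj_refl.
case/orP => [/eqP->|xL]; first exact: weyl_conj_refl.
case: ar => bzy _ ay; apply: weyl_conj_trans (IH y _ ay x xL).
  by apply: weyl_conj_bond bzy; apply: sub; rewrite !in_cons eqxx ?orbT.
by move=> u uL; apply: sub; rewrite in_cons uL orbT.
Qed.

Lemma weyl_conj_simple b : reduced Phi -> simple_system Phi b ->
  forall a, a \in Phi -> exists2 x, x \in b & weyl_conj x a.
Proof.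
move=> red bP.
suff h : forall a, a \in Phi -> a \in Phi /\ exists2 x, x \in b & weyl_conj x a.
  by move=> a /h[].
apply: (root_ind Phi_root red bP).
- by move=> x xb; split; [case: bP => sub _ _; apply: sub|exists x; last exact: weyl_conj_refl].
- move=> a [aP [x xb xa]]; split; first exact: (root_opp Phi_root).
  exists x => //; apply: weyl_conj_trans xa _.
  by rewrite -(reflection_id ip (root_neq0 Phi_root aP)); apply: weyl_conj_reflection.
- move=> a y yb [aP [x xb xa]]; have yP : y \in Phi by case: bP => sub _ _; apply: sub.
  split; first exact: (root_reflection Phi_root).
  by exists x => //; apply: weyl_conj_trans xa _; apply: weyl_conj_reflection.
Qed.

End WeylGroup.

(** * Vertices and constraints of symmetric polytopes *)

Section Polytope.
Variables (R : realType) (V : vectType R) (ip : {dot V for idfun}).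
Variables (Phi : {fset V}) (P : set V).
Hypothesis Phi_root : root_system ip Phi.

Lemma generatingP h (v : 'I_h -> V) : alcoved_polytope ip Phi P ->
  (forall i, P (v i)) ->
  (forall a, a \in Phi -> exists i, forall x, P x -> ip a x <= ip a (v i)) ->
  generating_set ip Phi P (range v).
Proof.
move=> alc vP cov; split=> //; first by move=> _ [i _ <-].
move=> Q [_ [Psi [c [sub ->]]]] vQ x Px a aPsi.
have [i iP] := cov a (sub _ aPsi).
by apply: le_trans (iP x Px) _; apply: (vQ (v i)) => //; exists i.
Qed.

(** The form to maximise is the sum of the vectors in [N]. A second maximiser would agree with [v]
    on each of them, and [N] separates points. *)
Lemma vertexP (N : seq V) v : P v ->
  (forall x, {in N, forall a, ip a x = 0} -> x = 0) ->
  {in N, forall a x, P x -> ip a x <= ip a v} -> vertex ip P v.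
Proof.
move=> Pv Nsp Nmax; split=> //; exists (\sum_(a <- N) a) => x Px xv.
rewrite -subr_gt0 !ip_suml -sumrB.
have ge0 : {in N, forall a, 0 <= ip a v - ip a x} by move=> a aN; rewrite subr_ge0 Nmax.
rewrite big_seq lt_neqAle sumr_ge0 // andbT eq_sym psumr_neq0 //.
apply: contra_notT xv => none; apply/eqP; rewrite eq_sym -subr_eq0; apply/eqP/Nsp => a aN.
apply/eqP; rewrite ipBr eq_le ge0 // andbT leNgt; apply/negP => lt.
by move/negP: none; apply; apply/hasP; exists a; rewrite // aN.
Qed.

Hypothesis P_sym : weyl_symmetric ip Phi P.

Lemma vertex_weyl w v : weyl_group ip Phi w -> vertex ip P v -> vertex ip P (w v).
Proof.
move=> Ww [Pv [u uP]].
have [w' [Ww' wK w'K]] := weyl_cancel Phi_root Ww.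
have iso := weyl_isometry Phi_root Ww.
split; first by rewrite -(P_sym Ww); exists v.
exists (w u) => x Px xv; rewrite -[x]w'K !iso; apply: uP.
  by rewrite -(P_sym Ww'); exists x.
by move=> w'x; apply: xv; rewrite -w'x w'K.
Qed.

Hypothesis P_alc : alcoved_polytope ip Phi P.
Hypothesis P0 : (P !=set0)%classic.

Lemma symmetric_bound w a x (Psi : {fset V}) (c : V -> R) :
  P = [set x | forall a, a \in Psi -> ip a x <= c a]%classic ->
  weyl_group ip Phi w -> a \in Psi -> P x -> ip (w a) x <= c a.
Proof.
move=> PE Ww aPsi Px; have [w' [Ww' wK w'K]] := weyl_cancel Phi_root Ww.
rewrite -[x]w'K (weyl_isometry Phi_root Ww).
have : P (w' x) by rewrite -(P_sym Ww'); exists x.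
by rewrite PE => /(_ a aPsi).
Qed.

(** By symmetry, a bound on one root holds for all its conjugates, so the smallest constant
    occurring in the class [K] serves the whole class. In the first alternative [P] is described
    without constraints from [K]. *)
Lemma class_bound (Psi : {fset V}) (c : V -> R) (K : V -> Prop) :
  P = [set x | forall a, a \in Psi -> ip a x <= c a]%classic ->
  (forall a a', a \in Psi -> a' \in Phi -> K a -> K a' -> weyl_conj ip Phi a a') ->
  (forall a, a \in Psi -> ~ K a) \/
  exists C : R, (forall x a, P x -> a \in Phi -> K a -> ip a x <= C) /\
    (forall a, a \in Psi -> K a -> C <= c a).
Proof.
move=> PE conjK; pose s := [seq a <- enum_fset Psi | `[< K a >]].
have [s0|s0] := eqVneq s [::].
  left=> a aPsi Ka; have : a \in s by rewrite mem_filter aPsi andbT; apply/asboolP.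
  by rewrite s0.
right; have [a0] := seq_min c s0; rewrite mem_filter => /andP[/asboolP K0 a0Psi] a0min.
exists (c a0); split.
  move=> x a Px aP Ka; have [w Ww <-] := conjK a0 a a0Psi aP K0 Ka.
  exact: symmetric_bound PE Ww a0Psi Px.
by move=> a aPsi Ka; apply: a0min; rewrite mem_filter aPsi andbT; apply/asboolP.
Qed.

(** With no constraint [P] would be all of [V], which contains a multiple of a root of length
    [|M| + 1]. *)
Lemma alcoved_constraints_neq0 (Psi : {fset V}) (c : V -> R) : Phi != fset0 ->
  P = [set x | forall a, a \in Psi -> ip a x <= c a]%classic -> exists a, a \in Psi.
Proof.
move=> /fset0Pn[a aP] PE; case: (fset_0Vmem Psi) => [Psi0|[a' ?]]; last by exists a'.
exfalso; case: P_alc => -[M bM] _.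
have PT x : P x by rewrite PE => a'; rewrite Psi0 inE.
have a0 : 0 < ip a a by rewrite ip_gt0 (root_neq0 Phi_root).
have sa : 0 < Num.sqrt (ip a a) by rewrite sqrtr_gt0.
have := bM (((`|M| + 1) / Num.sqrt (ip a a)) *: a) (PT _).
rewrite !ipE mulrA -expr2 sqrtrM ?sqr_ge0 // sqrtr_sqr ger0_norm; last first.
  by rewrite divr_ge0 ?ltW // ltr_wpDl.
rewrite divfK ?gt_eqF // leNgt => /negP[].
by apply: le_lt_trans (ler_norm M) _; rewrite ltrDl.
Qed.

Lemma one_class z : Phi != fset0 ->
  (forall a, a \in Phi -> weyl_conj ip Phi z a) ->
  exists2 C : R, 0 <= C &
    forall x, P x <-> (forall a, a \in Phi -> ip a x <= C).
Proof.
move=> Phi0 zconj; case: (P_alc) => _ [Psi [c [sub PE]]].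
have [a0 a0Psi] := alcoved_constraints_neq0 Phi0 PE.
have [] := @class_bound Psi c xpredT PE.
- move=> a a' aPsi a'P _ _; apply: weyl_conj_trans (zconj _ a'P).
  by apply/weyl_conj_sym/zconj => //; apply: sub.
- by move=> /(_ a0 a0Psi)[].
move=> [C [CP Cmin]]; exists C; last first.
  move=> x; split=> [Px a aP|xC]; first exact: CP.
  rewrite PE => a aPsi; apply: le_trans (Cmin a aPsi _) => //.
  exact: xC (sub _ aPsi).
case: P0 => x Px; have a0P := sub _ a0Psi.
have h1 := CP x a0 Px a0P isT; have h2 := CP x (- a0) Px (root_opp Phi_root a0P) isT.
by rewrite ipNl in h2; lra.
Qed.

Lemma one_class_neq0 C : (forall x, P x <-> (forall a, a \in Phi -> ip a x <= C)) ->
  P <> [set 0]%classic -> C != 0.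
Proof.
move=> PC Pn; apply/eqP => C0; apply: Pn; apply/seteqP; split=> x /=.
  move=> /PC xC; case: Phi_root => _ sp _ _; apply: (ip_eq0_span sp) => a aP.
  have h1 := xC a aP; have h2 := xC (- a) (root_opp Phi_root aP).
  by rewrite ipNl in h2; lra.
by move=> ->; apply/PC => a aP; rewrite ip0r C0.
Qed.

End Polytope.

(** * Type A *)

Section Frame.
Variables (R : realType) (V : vectType R) (ip : {dot V for idfun}).
Implicit Types (t L : seq V) (z e : V).

Lemma arm_gram z L : arm ip z L -> forall i j, (i <= size L)%N -> (j <= size L)%N ->
  ip (z :: L)`_i (z :: L)`_j =
    ip z z / 2 * (2 * (i == j)%:R - (i == j.+1)%:R - (i.+1 == j)%:R).
Proof.
elim: L z => [|x L IH] z; first by move=> _ [|//] [|//] _ _ /=; field.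
move=> [[zx xz] oz ax].
have zL j : (j < size L)%N -> ip z L`_j = 0.
  by move=> jL; apply: oz; rewrite ?mem_head ?mem_nth.
have h := IH _ ax; rewrite -zx in h.
move=> [|i] [|j] /=; rewrite ?ltnS => iL jL.
- by rewrite /=; field.
- case: j jL => [|j] jL /=; first by rewrite xz; field.
  by rewrite zL //; field.
- rewrite ipC; case: i iL => [|i] iL /=; first by rewrite xz; field.
  by rewrite zL //; field.
- by rewrite (h i j) // !eqSS.
Qed.

Variables (e0 : V) (t : seq V).
(** The family whose consecutive differences are [t]. For a suitable [e0] it plays the role of the
    coordinate vectors: orthogonal in types B, C and D, with a constant mutual product in type A. *)
Definition frame i := e0 + \sum_(k < i) t`_k.
Local Notation E := frame.

Lemma frameS i : E i.+1 = E i + t`_i.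
Proof. by rewrite /frame big_ord_recr addrA. Qed.

Lemma frame_diff i : E i.+1 - E i = t`_i.
Proof. by rewrite frameS addrC addKr. Qed.

Lemma frame_mkseq : t = mkseq (fun i => E i.+1 - E i) (size t).
Proof.
by apply: (@eq_from_nth _ 0); rewrite ?size_mkseq // => i it; rewrite nth_mkseq // frame_diff.
Qed.

Variable r : R.
Hypothesis r0 : 0 < r.

(* The chain z :: L, with e0 dual to its first node, is the chain of differences
   of a family with Gram matrix kappa + r * Id. *)
Lemma frame_gram z L : t = z :: L -> arm ip z L -> ip z z = 2 * r ->
  ip z e0 = - r -> {in L, forall u, ip u e0 = 0} ->
  forall i j, (i <= size t)%N -> (j <= size t)%N ->
  ip (E i) (E j) = (ip e0 e0 - r) + r * (i == j)%:R.
Proof.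
move=> tE ar zz ze Le.
have gram i j : (i < size t)%N -> (j < size t)%N ->
    ip t`_i t`_j = r * (2 * (i == j)%:R - (i == j.+1)%:R - (i.+1 == j)%:R).
  by rewrite tE !ltnS => i_t jt; rewrite (arm_gram ar) // zz; field.
have te i : (i < size t)%N -> ip t`_i e0 = - r * (i == 0)%:R.
  rewrite tE; case: i => [|i] /=; first by rewrite ze mulr1.
  by rewrite ltnS => iL; rewrite Le ?mem_nth // mulr0.
have tEj i j : (i < size t)%N -> (j <= size t)%N ->
    ip t`_i (E j) = r * ((i.+1 == j)%:R - (i == j)%:R).
  move=> i_t; elim: j => [|j IH] jt.
    by rewrite /frame big_ord0 addr0 te //=; ring.
  by rewrite frameS ipDr IH ?gram // 1?ltnW // eqSS; ring.
have E0j j : (j <= size t)%N -> ip (E 0) (E j) = (ip e0 e0 - r) + r * (0 == j)%:R.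
  elim: j => [|j IH] jt; first by rewrite /frame big_ord0 addr0 eqxx mulr1 subrK.
  by rewrite frameS ipDr IH 1?ltnW // ipC tEj // [0 == j]eq_sym [0 == j.+1]eq_sym; case: j jt {IH} => [|j] jt /=; ring.
move=> i j; elim: i => [|i IH] i_t jt; first exact: E0j.
by rewrite frameS ipDl (IH (ltnW i_t) jt) (tEj i j i_t jt); ring.
Qed.

End Frame.

Section FrameReflection.
Variables (R : realType) (V : vectType R) (ip : {dot V for idfun}).
Variables (E : nat -> V) (n : nat) (r k : R).
Hypothesis r0 : 0 < r.
Hypothesis gram : forall i j, (i <= n)%N -> (j <= n)%N ->
  ip (E i) (E j) = k + r * (i == j)%:R.

Definition swap (i j l : nat) := if l == i then j else if l == j then i else l.

Lemma swap_le i j l : (i <= n)%N -> (j <= n)%N -> (l <= n)%N -> (swap i j l <= n)%N.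
Proof. by rewrite /swap => ? ? ?; case: ifP => // _; case: ifP. Qed.

Lemma swap_inj i j : injective (swap i j).
Proof.
apply: (can_inj (g := swap i j)) => l; rewrite /swap.
have [->|li] := eqVneq l i; first by rewrite eqxx; case: eqP.
have [->|lj] := eqVneq l j; first by rewrite eqxx.
by rewrite (negPf li) (negPf lj).
Qed.

Lemma frame_diff_norm i j : (i <= n)%N -> (j <= n)%N -> i != j ->
  ip (E i - E j) (E i - E j) = 2 * r.
Proof.
move=> iN jN /negPf ij; rewrite !ipE !gram // !eqxx (eq_sym j) ij /=; ring.
Qed.

Lemma frame_reflection i j l : (i <= n)%N -> (j <= n)%N -> (l <= n)%N -> i != j ->
  reflection ip (E i - E j) (E l) = E (swap i j l).
Proof.
move=> iN jN lN ij; rewrite reflectionE frame_diff_norm // ipBr !gram // /swap.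
have rn : r != 0 by rewrite gt_eqF.
have -> : 2 * (k + r * (l == i)%:R - (k + r * (l == j)%:R)) / (2 * r) =
    (l == i)%:R - (l == j)%:R by field.
have [->|li] := eqVneq l i; first by rewrite (negPf ij) subr0 scale1r opprB addrC subrK.
have [->|lj] := eqVneq l j; first by rewrite sub0r scaleN1r opprK addrC subrK.
by rewrite subrr scale0r subr0.
Qed.

Lemma frame_reflectionB i j l m : (i <= n)%N -> (j <= n)%N -> (l <= n)%N -> (m <= n)%N ->
  i != j -> reflection ip (E i - E j) (E l - E m) = E (swap i j l) - E (swap i j m).
Proof.
move=> iN jN lN mN ij; have -> : E l - E m = (-1) *: E m + E l.
  by rewrite scaleN1r addrC.
by rewrite reflection_is_linear !frame_reflection // scaleN1r addrC.
Qed.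

Lemma frame_roots (Phi : {fset V}) : root_system ip Phi ->
  (forall i, (i < n)%N -> E i.+1 - E i \in Phi) ->
  forall i j, (i <= n)%N -> (j <= n)%N -> i != j -> E i - E j \in Phi.
Proof.
move=> Phi_root simp.
have up i j : (i < j)%N -> (j <= n)%N -> E j - E i \in Phi.
  elim: j => // j IH; rewrite ltnS leq_eqVlt => /orP[/eqP->|ij] jn; first exact: simp.
  have jn' : (j <= n)%N := ltnW jn.
  have i_n : (i <= n)%N := leq_trans (ltnW ij) jn'.
  have jj : j.+1 != j by rewrite gtn_eqF.
  have := root_reflection Phi_root (simp j jn) (IH ij jn').
  rewrite (frame_reflectionB jn jn' jn' i_n jj) /swap eq_sym (negPf jj) eqxx.
  by rewrite (ltn_eqF ij) [i == j.+1]ltn_eqF // ltnW.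
move=> i j iN jN; rewrite neq_ltn => /orP[ij|ji]; last exact: up.
by rewrite -opprB; apply: (root_opp Phi_root); apply: up.
Qed.

(** Each factor transposes two adjacent frame vectors, and the product of these transpositions is
    the cycle 0, 1, ..., m. *)
Lemma cox_frame m j : (m <= n)%N -> (j <= n)%N ->
  coxeter_element ip (mkseq (fun i => E i.+1 - E i) m) (E j) =
    if (j < m)%N then E j.+1 else if j == m then E 0 else E j.
Proof.
elim: m j => [|m IH] j mn jn; first by case: eqP => [->|].
have mn' : (m <= n)%N := ltnW mn.
have mm : m.+1 != m by rewrite gtn_eqF.
rewrite mkseqS -cats1 cox_cat /= (frame_reflection mn mn' jn mm) /swap.
have [->|jm1] := eqVneq j m.+1.
  by rewrite ltnn IH // ltnn eqxx.
have [->|jm] := eqVneq j m.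
  by rewrite IH // ltnSn ltnNge leqnSn /= [m.+1 == m]gtn_eqF.
by rewrite IH // (negPf jm) [in RHS]ltnS [in RHS]leq_eqVlt (negPf jm).
Qed.

End FrameReflection.

Section TypeA.
Variables (R : realType) (V : vectType R) (ip : {dot V for idfun}).
Variables (Phi : {fset V}) (P : set V).
Hypotheses (Phi_root : root_system ip Phi) (Phi_reduced : reduced Phi).
Hypothesis P_sym : weyl_symmetric ip Phi P.
Hypothesis P_alc : alcoved_polytope ip Phi P.
Hypothesis P0 : (P !=set0)%classic.

(** The polytope reduced to the origin has a single vertex, hence the condition on distinctness. *)
Definition generated_by_vertices h := exists v : 'I_h -> V,
  [/\ (forall i, vertex ip P (v i)), generating_set ip Phi P (range v)
    & P <> [set 0]%classic -> injective v].

Lemma typeA z L h : arm ip z L -> simple_system Phi (z :: L) ->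
  has_order (coxeter_element ip (z :: L)) h -> generated_by_vertices h.
Proof.
set t := z :: L => ar simp hord.
have zP : z \in Phi by case: simp => sub _ _; rewrite sub ?mem_head.
have z0 : z != 0 := root_neq0 Phi_root zP.
have Phi0 : Phi != fset0 by apply/fset0Pn; exists z.
have tbas : basis_of fullv t by case: simp.
have tspan := simple_span simp.
have ut := simple_uniq simp.
pose r := ip z z / 2.
have r0 : 0 < r by rewrite divr_gt0 ?ip_gt0.
(* These are the values of the projection to [V] of the coordinate vector e_0 when the simple roots
   are the differences e_(i+1) - e_i of coordinate vectors of squared length [r]. *)
have [e0 e0P] := riesz ip (fun u => if u == z then - r else 0) tbas.
pose E := frame e0 t; pose n := size t.
have gram i j : (i <= n)%N -> (j <= n)%N ->
    ip (E i) (E j) = (ip e0 e0 - r) + r * (i == j)%:R.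
  apply: (frame_gram (z := z) (L := L)) => //.
  - by rewrite /r; field.
  - by rewrite e0P ?mem_head // eqxx.
  - move=> u uL; rewrite e0P ?in_cons ?uL ?orbT //; case: eqP => // uz.
    by move: ut; rewrite /= -uz uL.
have tE : t = mkseq (fun i => E i.+1 - E i) n by apply: frame_mkseq.
have simpE i : (i < n)%N -> E i.+1 - E i \in Phi.
  by move=> i_n; case: simp => sub _ _; rewrite /E frame_diff sub // mem_nth.
have rootE := frame_roots r0 gram Phi_root simpE.
have diffE i j l : (i <= n)%N -> (j <= n)%N -> (l <= n)%N ->
    ip (E i - E j) (E l) = r * ((i == l)%:R - (j == l)%:R).
  by move=> *; rewrite ipBl !gram //; ring.
have rootsE : forall a, a \in Phi -> exists i j, [/\ (i <= n)%N, (j <= n)%N, i != j & a = E i - E j].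
  apply: (root_ind Phi_root Phi_reduced simp).
  - rewrite tE => a /mapP[i]; rewrite mem_iota => /andP[_ i_n] ->.
    by exists i.+1, i; rewrite i_n ltnW // gtn_eqF.
  - by move=> a [i [j [? ? ij ->]]]; exists j, i; rewrite opprB eq_sym.
  - move=> a x; rewrite tE => /mapP[l]; rewrite mem_iota => /andP[_ ln] -> [i [j [iN jN ij ->]]].
    have ln' : (l <= n)%N by apply: ltnW.
    rewrite (frame_reflectionB r0 gram) // ?gtn_eqF //.
    exists (swap l.+1 l i), (swap l.+1 l j); split; rewrite ?swap_le //.
    by rewrite (inj_eq (@swap_inj _ _)).
have zconj a : a \in Phi -> weyl_conj ip Phi z a.
  move=> aP; have [x xt xa] := weyl_conj_simple Phi_root Phi_reduced simp aP.
  apply: weyl_conj_trans _ xa; apply: (weyl_conj_arm Phi_root _ ar) xt.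
  by case: simp.
have [C C0 PC] := one_class Phi_root P_sym P_alc P0 Phi0 zconj.
have spanE k x : (k <= n)%N -> (forall j, (j <= n)%N -> j != k -> ip (E k - E j) x = 0) -> x = 0.
  move=> kn Ex; apply: (ip_eq0_span (ip := ip) tspan) => y; rewrite tE => /mapP[i].
  rewrite mem_iota => /andP[_ i_n] ->.
  have Ekj j : (j <= n)%N -> ip (E k - E j) x = 0.
    by have [->|jk] := eqVneq j k; [rewrite subrr ip0l|move=> jn; rewrite Ex].
  have -> : E i.+1 - E i = (E k - E i) - (E k - E i.+1) by rewrite opprB [RHS]addrC addrA subrK.
  by rewrite ipBl !Ekj ?subrr // ltnW.
have hn : h = n.+1.
  apply: has_order_uniq hord _.
  have it m j : (j <= n)%N -> iter m (coxeter_element ip t) (E j) = E ((j + m) %% n.+1)%N.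
    move=> jn; elim: m => [|m IH]; first by rewrite addn0 modn_small.
    rewrite iterS IH {1}tE (cox_frame r0 gram) //; last by rewrite -ltnS ltn_mod.
    have -> : ((j + m.+1) %% n.+1 = ((j + m) %% n.+1).+1 %% n.+1)%N.
      by rewrite -[in RHS]addn1 modnDml addn1 addnS.
    move: (ltn_pmod (j + m) (ltn0Sn n)); move: ((j + m) %% n.+1)%N => q.
    rewrite ltnS leq_eqVlt => /orP[/eqP->|lt].
      by rewrite ltnn eqxx modnn.
    by rewrite lt modn_small ?ltnS.
  split=> //.
    apply: (linear_span_id _ tspan).
      exact/iter_linear/cox_linear.
    move=> y; rewrite {1}tE => /mapP[i]; rewrite mem_iota => /andP[_ i_n] ->.
    rewrite -scaleN1r addrC (iter_linear _ (cox_linear ip t)) !it // 1?ltnW //.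
    by rewrite !modnDr !modn_small // ltnW.
  move=> m /andP[m0 mn] /(_ (E 0)); rewrite it // add0n modn_small // => E0m.
  have := frame_diff_norm gram (leq0n n) mn.
  rewrite E0m subrr ip0l eq_sym -lt0n m0 => /(_ isT)/esym/eqP.
  by rewrite mulf_eq0 pnatr_eq0 (gt_eqF r0).
(* With the factor [C / r], the root [E i - E j] takes the value [C] at vertex [i], [- C] at vertex
   [j] and 0 at the others. *)
rewrite hn; exists (fun i : 'I_n.+1 => (C / r) *: E i).
have rn : r != 0 by rewrite gt_eqF.
have val i j l : (i <= n)%N -> (j <= n)%N -> (l <= n)%N ->
    ip (E i - E j) ((C / r) *: E l) = C * ((i == l)%:R - (j == l)%:R).
  by move=> *; rewrite ipZr diffE //; field.
have vP i : (i <= n)%N -> P ((C / r) *: E i).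
  move=> iN; apply/PC => a /rootsE[j [l [jn ln jl ->]]]; rewrite val //.
  by case: (j == i); case: (l == i); rewrite /=; move: C0; lra.
split.
- move=> [i iN] /=; rewrite ltnS in iN.
  apply: (vertexP (N := [seq E i - E j | j <- iota 0 n.+1 & j != i])); first exact: vP.
    move=> x Ex; apply: (spanE i) => // j jn ji; apply: Ex; apply/mapP; exists j => //.
    by rewrite mem_filter ji mem_iota.
  move=> a /mapP[j]; rewrite mem_filter mem_iota add0n ltnS => /and3P[ji _ jn] -> x Px.
  by rewrite val // eqxx (negPf ji) subr0 mulr1; apply: (PC x).1 => //; apply: rootE; rewrite // eq_sym.
- apply: generatingP => //; first by move=> [i iN]; apply: vP.
  move=> a /[dup] aP /rootsE[i [j [iN jN ij aE]]]; exists (Ordinal (iN : (i < n.+1)%N)) => x Px /=.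
  rewrite {2}aE val // eqxx eq_sym (negPf ij) subr0 mulr1; exact: (PC x).1.
- move=> Pn [i iN] [j jN] /= eqv; apply: val_inj => /=; apply/eqP; apply/negPn/negP => ij.
  have Cn := one_class_neq0 Phi_root PC Pn.
  have := val i j i iN jN iN; rewrite eqv val // !eqxx [i == j](negPf ij) [j == i]eq_sym (negPf ij).
  move/eqP; rewrite subr0 sub0r mulr1 mulrN1 => /eqP CC.
  by move/eqP: Cn; apply; move: CC; lra.
Qed.

End TypeA.

(** * Types B, C and D *)

Section LinearMaps.
Variables (R : realType) (V : vectType R) (f : V -> V).
Hypothesis lf : linear f.

Lemma lin0 : f 0 = 0.
Proof. by have := lf (-1) 0 0; rewrite scaler0 add0r scaleN1r addNr. Qed.

Lemma linZ q x : f (q *: x) = q *: f x.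
Proof. by rewrite -[_ *: x]addr0 lf lin0 addr0. Qed.

Lemma linN x : f (- x) = - f x.
Proof. by rewrite -scaleN1r linZ scaleN1r. Qed.

End LinearMaps.

(** * Signed permutations of an orthogonal frame *)

Section Orthogonal.
Variables (R : realType) (V : vectType R) (ip : {dot V for idfun}).
Variables (G : nat -> V) (n : nat) (r : R).
Hypothesis r0 : 0 < r.
Hypothesis gram : forall i j, (i <= n)%N -> (j <= n)%N ->
  ip (G i) (G j) = r * (i == j)%:R.
Hypothesis G_span : forall x, (forall i, (i <= n)%N -> ip (G i) x = 0) -> x = 0.
Implicit Types (b c d : bool) (i j l : nat).

Definition sg b : R := (-1) ^+ b.

Lemma sgM b c : sg b * sg c = sg (b (+) c).
Proof. by rewrite /sg signr_addb. Qed.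

Lemma sgN b : - sg b = sg (~~ b).
Proof. by rewrite /sg signrN. Qed.

Lemma sg_neq0 b : sg b != 0.
Proof. by rewrite signr_eq0. Qed.

Lemma sg_le b (y : R) : sg b * y <= `|y|.
Proof.
by apply: le_trans (ler_norm _) _; rewrite normrM normr_sign mul1r.
Qed.

Lemma sg_norm (y : R) : exists b, sg b * y = `|y|.
Proof.
have [y0|y0] := leP 0 y; first by exists false; rewrite /sg expr0 mul1r ger0_norm.
by exists true; rewrite /sg expr1 mulN1r ltr0_norm.
Qed.

Definition vec (f : nat -> R) : V := \sum_(j < n.+1) (f j / r) *: G j.

Lemma ip_vec f i : (i <= n)%N -> ip (G i) (vec f) = f i.
Proof.
move=> i_n; rewrite /vec ip_sumr (bigD1 (Ordinal (i_n : (i < n.+1)%N))) //=.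
rewrite ipZr gram // eqxx mulr1 divfK ?gt_eqF // big1 ?addr0 // => j ji.
have jn : (j <= n)%N by rewrite -ltnS.
rewrite ipZr gram //; move: ji; rewrite -val_eqE /= eq_sym => /negPf->.
by rewrite !mulr0.
Qed.

Lemma G_neq i j b c : (i <= n)%N -> (j <= n)%N -> sg b *: G i = sg c *: G j ->
  i = j /\ b = c.
Proof.
move=> i_n jn /(congr1 (ip (G i))); rewrite !ipZr !gram // eqxx mulr1.
case: (eqVneq i j) => [-> /=|ij /=]; last first.
  by rewrite !mulr0 => /eqP; rewrite mulf_eq0 (negPf (sg_neq0 _)) (gt_eqF r0).
by rewrite mulr1 => /(mulIf (lt0r_neq0 r0))/signr_inj.
Qed.

(** With p = n + 1 - m, the power p of [f] is -1 on the vectors [G m], ..., [G n], which form one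
    signed cycle; hence the order 2p. The value m = 0 is the case of B and C; in type D, m = 1 and
    [f] also negates [G 0], which an even power undoes. *)
Lemma signed_cycle_order (f : V -> V) m : (0 < n)%N || (m == 0)%N -> (m <= 1)%N ->
  linear f ->
  (forall j, (m <= j < n)%N -> f (G j) = G j.+1) -> f (G n) = - G m ->
  (forall j, (j < m)%N -> f (G j) = - G j) ->
  has_order f (2 * (n.+1 - m)).
Proof.
move=> n0 m1 lf fS fn f0.
have mn : (m <= n)%N by case: m m1 n0 {fS fn f0} => [|[|]] //; rewrite orbF.
have itl k := iter_linear k lf.
have itN k := linN (itl k).
set p := (n.+1 - m)%N.
have up k j : (m <= j)%N -> (j + k <= n)%N -> iter k f (G j) = G (j + k).
  move=> mj; elim: k => [|k IH] jk; first by rewrite addn0.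
  rewrite addnS in jk *.
  by rewrite iterS (IH (ltnW jk)) fS // jk (leq_trans mj (leq_addr k j)).
have pj j : (m <= j <= n)%N -> iter p f (G j) = - G j.
  case/andP => mj jn.
  have -> : p = ((j - m) + (1 + (n - j)))%N by rewrite /p; lia.
  rewrite iterD iterD (up (n - j)%N j) // ?subnKC //= fn itN up ?leqnn ?subnKC //.
have pp j : (j <= n)%N -> iter (2 * p) f (G j) = G j.
  move=> jn; rewrite mul2n -addnn iterD.
  have [jm|mj] := ltnP j m; last by rewrite pj ?mj // itN pj ?mj // opprK.
  have e k : iter k f (G j) = (-1) ^+ k *: G j.
    elim: k => [|k IH]; first by rewrite expr0 scale1r.
    by rewrite iterS IH (linZ lf) f0 // scalerN exprS mulN1r scaleNr.
  by rewrite e (linZ (itl p)) e scalerA -expr2 sqrr_sign scale1r.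
split; first by rewrite muln_gt0 /p subn_gt0 ltnS.
  move=> x; have gv : x = vec (fun i => ip (G i) x).
    apply/eqP; rewrite -subr_eq0; apply/eqP/G_span => i i_n.
    by rewrite ipBr ip_vec // subrr.
  rewrite gv /vec; move: (2 * p)%N (pp) (itl (2 * p)%N) => k kG kl.
  elim/big_rec: _ => [|i y _ IH]; first exact: lin0 kl.
  by rewrite kl IH kG // -ltnS.
move=> k /andP[k0 k2] /(_ (G m)).
have [kp|pk] := ltnP k p.
  rewrite up // => [|]; last by rewrite /p in kp; lia.
  move=> e; have := @G_neq (m + k) m false false; rewrite /sg expr0 !scale1r e.
  by rewrite mn /p in kp *; case=> //; lia.
have -> : k = ((k - p) + p)%N by lia.
rewrite iterD pj ?leqnn // itN up //; last by rewrite /p in pk k2 *; lia.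
move=> e; have := @G_neq (m + (k - p)) m true false.
rewrite /sg expr0 expr1 scale1r scaleN1r e => h.
by case: h => //; rewrite /p in pk k2 *; lia.
Qed.

Definition signed_perm (f : V -> V) := exists (s : nat -> nat) (e : nat -> bool),
  [/\ (forall i, (i <= n)%N -> (s i <= n)%N), injective s
    & (forall i, (i <= n)%N -> f (G i) = sg (e i) *: G (s i))].

Definition signed_pair a := exists i j b c,
  [/\ (i <= n)%N, (j <= n)%N, i != j & a = sg b *: G i + sg c *: G j].

Definition signed_single (k : R) a := exists i b, (i <= n)%N /\ a = sg b *: (k *: G i).

Lemma signed_pair_opp a : signed_pair a -> signed_pair (- a).
Proof.
move=> [i [j [b [c [i_n jn ij ->]]]]]; exists i, j, (~~ b), (~~ c); split=> //.
by rewrite opprD -!sgN !scaleNr.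
Qed.

Lemma signed_single_opp k a : signed_single k a -> signed_single k (- a).
Proof. by move=> [i [b [i_n ->]]]; exists i, (~~ b); rewrite -sgN scaleNr. Qed.

Lemma signed_pair_perm f a : linear f -> signed_perm f -> signed_pair a -> signed_pair (f a).
Proof.
move=> lf [s [e [s_n sinj fG]]] [i [j [b [c [i_n jn ij ->]]]]].
exists (s i), (s j), (b (+) e i), (c (+) e j); split; rewrite ?s_n ?(inj_eq sinj) //.
by rewrite lf (linZ lf) !fG // !scalerA !sgM.
Qed.

Lemma signed_single_perm k f a : linear f -> signed_perm f ->
  signed_single k a -> signed_single k (f a).
Proof.
move=> lf [s [e [s_n sinj fG]]] [i [b [i_n ->]]].
exists (s i), (b (+) e i); split; rewrite ?s_n //.
by rewrite !(linZ lf) fG // !scalerA -sgM; congr (_ *: _); ring.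
Qed.

Lemma signed_perm_diff i j : (i <= n)%N -> (j <= n)%N -> i != j ->
  signed_perm (reflection ip (G i - G j)).
Proof.
move=> i_n jn ij; exists (swap i j), (fun=> false); split.
- by move=> l ln; apply: swap_le.
- exact: swap_inj.
- move=> l ln; rewrite /sg expr0 scale1r; apply: (frame_reflection (n := n) (r := r) (k := 0)) => //.
  by move=> ? ? ? ?; rewrite add0r gram.
Qed.

Lemma reflection_sum i j l : (i <= n)%N -> (j <= n)%N -> (l <= n)%N -> i != j ->
  reflection ip (G i + G j) (G l) = sg ((l == i) || (l == j)) *: G (swap i j l).
Proof.
move=> i_n jn ln ij; have rr : r + r != 0 by rewrite gt_eqF // addr_gt0.
rewrite reflectionE !ipE !gram // !eqxx [j == i]eq_sym (negPf ij) /swap /sg.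
have [->|li] := eqVneq l i.
  rewrite (negPf ij) /= ?(mulr1, mulr0, addr0, add0r) expr1 scaleN1r.
  rewrite (_ : _ / _ = 1); last by rewrite mulr_natl mulr2n divff.
  by rewrite scale1r opprD addrA subrr sub0r.
have [->|lj] := eqVneq l j.
  rewrite /= ?(mulr1, mulr0, addr0, add0r) expr1 scaleN1r.
  rewrite (_ : _ / _ = 1); last by rewrite mulr_natl mulr2n divff.
  by rewrite scale1r opprD addrCA subrr addr0.
by rewrite /= expr0 scale1r mulr0 addr0 mulr0 mul0r scale0r subr0.
Qed.


Lemma signed_perm_sum i j : (i <= n)%N -> (j <= n)%N -> i != j ->
  signed_perm (reflection ip (G i + G j)).
Proof.
move=> i_n jn ij; exists (swap i j), (fun l => (l == i) || (l == j)); split.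
- by move=> l ln; apply: swap_le.
- exact: swap_inj.
- by move=> l ln; apply: reflection_sum.
Qed.

Lemma reflection_single (k : R) i l : k != 0 -> (i <= n)%N -> (l <= n)%N ->
  reflection ip (k *: G i) (G l) = sg (l == i) *: G l.
Proof.
move=> k0 i_n ln; have rn : r != 0 by rewrite gt_eqF.
rewrite reflectionE !ipE !gram // !eqxx /sg.
have [->|li] := eqVneq l i.
  rewrite /= expr1 scaleN1r scalerA (_ : _ / _ * k = 2); last by field; rewrite rn k0.
  by rewrite scaler_nat mulr2n opprD addrA subrr sub0r.
by rewrite /= expr0 scale1r !mulr0 mul0r scale0r subr0.
Qed.

Lemma signed_perm_single (k : R) i : k != 0 -> (i <= n)%N ->
  signed_perm (reflection ip (k *: G i)).
Proof.
move=> k0 i_n; exists id, (fun l => l == i); split=> // l ln.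
exact: reflection_single.
Qed.

Lemma signed_pair_norm a : signed_pair a -> ip a a = 2 * r.
Proof.
move=> [i [j [b [c [i_n jn ij ->]]]]]; rewrite !ipE !gram // !eqxx [j == i]eq_sym (negPf ij).
have bb : sg b * sg b = 1 by rewrite sgM addbb.
have cc : sg c * sg c = 1 by rewrite sgM addbb.
by rewrite !mulr0 !mulr1 !addr0 !add0r !mulrA bb cc; ring.
Qed.

Lemma signed_single_norm k a : signed_single k a -> ip a a = k ^+ 2 * r.
Proof.
move=> [i [b [i_n ->]]]; rewrite !ipE !gram // eqxx.
have bb : sg b * sg b = 1 by rewrite sgM addbb.
transitivity ((sg b * sg b) * (k ^+ 2 * r)); last by rewrite bb mul1r.
by rewrite /= expr2; ring.
Qed.

End Orthogonal.

Section Reindex.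
Variables (R : realType) (V : vectType R) (ip : {dot V for idfun}).
Variables (Phi : {fset V}) (P : set V).
Hypothesis P_alc : alcoved_polytope ip Phi P.

Lemma generated_by_finType (T : finType) h (v : T -> V) : #|T| = h ->
  (forall i, vertex ip P (v i)) ->
  (forall a, a \in Phi -> exists i, forall x, P x -> ip a x <= ip a (v i)) ->
  (P <> [set 0]%classic -> injective v) -> generated_by_vertices ip Phi P h.
Proof.
move=> <- vv cov inj; exists (v \o enum_val); split.
- by move=> i; apply: vv.
- apply: generatingP => // [i|a /cov[i iP]]; first by case: (vv (enum_val i)).
  by exists (enum_rank i) => x Px; rewrite /= enum_rankK iP.
- by move=> Pn; apply: inj_comp (inj Pn) enum_val_inj.
Qed.

End Reindex.

Section SignedCoordinates.
Variables (R : realType) (V : vectType R) (ip : {dot V for idfun}).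
Variables (G : nat -> V) (n : nat).
Local Notation sg := (sg R).

Lemma signed_pair_le (C : R) x : (forall i j, (i <= n)%N -> (j <= n)%N -> i != j ->
    `|ip (G i) x| + `|ip (G j) x| <= C) ->
  forall a, signed_pair G n a -> ip a x <= C.
Proof.
move=> xC a [i [j [b [c [i_n jn ij ->]]]]]; rewrite !ipE.
by apply: le_trans (xC i j i_n jn ij); apply: lerD; apply: sg_le.
Qed.

Lemma signed_single_le (C k : R) x : 0 <= k ->
  (forall i, (i <= n)%N -> `|ip (G i) x| <= C) ->
  forall a, signed_single G n k a -> ip a x <= k * C.
Proof.
move=> k0 xC a [i [b [i_n ->]]]; rewrite !ipE mulrCA ler_wpM2l //.
by apply: le_trans (xC i i_n); apply: sg_le.
Qed.

Lemma le_signed_pair (C : R) x : (forall a, signed_pair G n a -> ip a x <= C) ->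
  forall i j, (i <= n)%N -> (j <= n)%N -> i != j ->
    `|ip (G i) x| + `|ip (G j) x| <= C.
Proof.
move=> aC i j i_n jn ij.
have [b <-] := sg_norm (ip (G i) x); have [c <-] := sg_norm (ip (G j) x).
have := aC (sg b *: G i + sg c *: G j); rewrite !ipE; apply.
by exists i, j, b, c.
Qed.

Lemma le_signed_single (C k : R) x : 0 < k ->
  (forall a, signed_single G n k a -> ip a x <= C) ->
  forall i, (i <= n)%N -> `|ip (G i) x| <= C / k.
Proof.
move=> k0 aC i i_n; have [b <-] := sg_norm (ip (G i) x).
rewrite ler_pdivlMr // [_ * k]mulrC mulrCA.
have := aC (sg b *: (k *: G i)); rewrite !ipE; apply.
by exists i, b.
Qed.

End SignedCoordinates.

(** * Types B and C *)

Section TypeBC.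
Variables (R : realType) (V : vectType R) (ip : {dot V for idfun}).
Variables (Phi : {fset V}) (P : set V).
Hypotheses (Phi_root : root_system ip Phi) (Phi_reduced : reduced Phi).
Hypothesis P_sym : weyl_symmetric ip Phi P.
Hypothesis P_alc : alcoved_polytope ip Phi P.
Hypothesis P0 : (P !=set0)%classic.
Local Notation sg := (sg R).

Section Cross.
Variables (G : nat -> V) (n : nat) (r al be : R).
Hypothesis r0 : 0 < r.
Hypothesis gram : forall i j, (i <= n)%N -> (j <= n)%N ->
  ip (G i) (G j) = r * (i == j)%:R.
Hypothesis G_span : forall x, (forall i, (i <= n)%N -> ip (G i) x = 0) -> x = 0.
Hypotheses (al_be : al <= be) (be_al : be <= 2 * al).
Hypothesis PE : forall x, P x <->
  (forall i, (i <= n)%N -> `|ip (G i) x| <= al) /\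
  (forall i j, (i <= n)%N -> (j <= n)%N -> i != j ->
    `|ip (G i) x| + `|ip (G j) x| <= be).

Let al0 : 0 <= al.
Proof. by move: al_be be_al; lra. Qed.

(** The change of sign at place i makes the positive vertex tight for e_i + e_j when j < i and for
    e_i - e_j when j > i. So for each pair of places, the two vertices with these indices and their
    negatives serve all four roots, each relative sign being met exactly once up to opposites. *)
Definition cross_coord (b : bool) i j : R :=
  sg b * (if j == i then al else if (j < i)%N then be - al else al - be).

Definition cross_vertex (p : bool * 'I_n.+1) : V := vec G n r (cross_coord p.1 p.2).

Lemma cross_coord_norm b i j : `|cross_coord b i j| = if j == i then al else be - al.
Proof.
rewrite /cross_coord normrM normr_sign mul1r.
case: eqP => _; first by rewrite ger0_norm.
case: ifP => _; first by rewrite ger0_norm ?subr_ge0.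
by rewrite ler0_norm ?subr_le0 // opprB.
Qed.

Lemma cross_vertex_in p : P (cross_vertex p).
Proof.
case: p => b i; apply/PE; split=> [j jn|j l jn ln jl]; rewrite !(ip_vec r0 gram) // !cross_coord_norm /=.
  by move: al_be be_al; case: eqP => _; lra.
move: al_be be_al; case: eqVneq => [ji|_]; case: eqVneq => [li|_]; try lra.
by move: jl; rewrite ji li eqxx.
Qed.

Lemma cross_vertexP p : vertex ip P (cross_vertex p).
Proof.
case: p => b i; have i_n : (i <= n)%N by rewrite -ltnS.
pose e j : R := if (j < i)%N then 1 else -1.
apply: (vertexP (N := sg b *: G i :: [seq sg b *: (G i + e j *: G j) | j <- iota 0 n.+1 & j != i :> nat])).
- exact: cross_vertex_in.
- move=> x xN.
  have xi : ip (G i) x = 0.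
    have := xN _ (mem_head _ _); rewrite ipZl => /eqP.
    by rewrite mulf_eq0 (negPf (sg_neq0 _ _)) => /eqP.
  apply: G_span => j jn; have [->//|ji] := eqVneq j i.
  have : ip (sg b *: (G i + e j *: G j)) x = 0.
    apply: xN; rewrite in_cons; apply/orP; right; apply/mapP; exists j => //.
    by rewrite mem_filter ji mem_iota.
  rewrite !ipE xi add0r => /eqP; rewrite !mulf_eq0 (negPf (sg_neq0 _ _)) /= => /orP[|/eqP//].
  by rewrite /e; case: ifP => _; rewrite ?oppr_eq0 oner_eq0.
- have bb : sg b * sg b = 1 by rewrite sgM addbb.
  move=> a aN x /PE[x1 x2]; move: aN; rewrite in_cons => /orP[/eqP->|/mapP[j]].
    rewrite !ipZl (ip_vec r0 gram) // /cross_coord eqxx mulrA bb mul1r.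
    by apply: le_trans (x1 i i_n); apply: sg_le.
  rewrite mem_filter mem_iota add0n ltnS => /and3P[ji _ jn] ->.
  rewrite !ipE !(ip_vec r0 gram) // /cross_coord eqxx (negPf ji) [X in _ <= X](_ : _ = be).
    apply: (@le_trans _ _ (`|ip (G i) x| + `|ip (G j) x|)); last by apply: x2; rewrite // eq_sym.
    rewrite mulrDr; apply: lerD; first exact: sg_le.
    rewrite /e; case: ifP => _; rewrite ?mul1r ?mulN1r; first exact: sg_le.
    by rewrite -normrN; apply: sg_le.
  rewrite /e; case: ifP => _; rewrite mulrDr !mulrA ?mulr1 ?mulrN1 ?mulNr bb; lra.
Qed.

Lemma cross_vertex_single (k : R) a : 0 <= k -> signed_single G n k a ->
  exists p, forall x, P x -> ip a x <= ip a (cross_vertex p).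
Proof.
move=> k0 /[dup] aS [i [b [i_n aE]]].
exists (b, Ordinal (i_n : (i < n.+1)%N)) => x /PE[x1 _].
apply: le_trans (signed_single_le k0 x1 aS) _.
rewrite aE !ipZl (ip_vec r0 gram) // /cross_coord eqxx.
have bb : sg b * sg b = 1 by rewrite sgM addbb.
by rewrite (_ : sg b * _ = (sg b * sg b) * (k * al)); [rewrite bb mul1r|ring].
Qed.

Lemma cross_vertex_pair a : signed_pair G n a ->
  exists p, forall x, P x -> ip a x <= ip a (cross_vertex p).
Proof.
move=> aS; suff [p pE] : exists p, ip a (cross_vertex p) = be.
  by exists p => x /PE[_ x2]; rewrite pE; apply: signed_pair_le aS.
have key i j b c : (i < j)%N -> (j <= n)%N ->
    exists p, ip (sg b *: G i + sg c *: G j) (cross_vertex p) = be.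
  move=> ij jn; have i_n : (i <= n)%N := leq_trans (ltnW ij) jn.
  have bb : sg b * sg b = 1 by rewrite sgM addbb.
  have [bc|bc] := eqVneq b c.
    exists (c, Ordinal (jn : (j < n.+1)%N)).
    rewrite !ipE !(ip_vec r0 gram) // /cross_coord /= eqxx (ltn_eqF ij) ij -bc.
    by rewrite !mulrA bb; ring.
  exists (b, Ordinal (i_n : (i < n.+1)%N)).
  rewrite !ipE !(ip_vec r0 gram) // /cross_coord /= eqxx (gtn_eqF ij).
  rewrite ltnNge (ltnW ij) /= !mulrA bb.
  have -> : sg c = - sg b by rewrite sgN; congr (sg _); case: (b) (c) bc => [] [].
  by rewrite mulNr bb; ring.
case: aS => i [j [b [c [i_n jn ij ->]]]]; move: ij; rewrite neq_ltn => /orP[ij|ji].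
  exact: key.
by rewrite addrC; apply: key.
Qed.

Lemma cross_vertex_inj : P <> [set 0]%classic -> injective cross_vertex.
Proof.
move=> Pn.
have al_gt0 : 0 < al.
  rewrite lt_neqAle al0 andbT.
  apply/eqP => al_eq0; apply: Pn; apply/seteqP; split=> x /=.
    move=> /PE[x1 _]; apply: G_span => i i_n; apply/eqP; rewrite -normr_le0.
    by rewrite al_eq0; apply: x1.
  move=> ->; have -> : (0 : V) = cross_vertex (false, ord0); last exact: cross_vertex_in.
  apply/esym/G_span => i i_n; apply/eqP; rewrite -normr_le0 (ip_vec r0 gram) // cross_coord_norm.
  by move: al_be be_al al_eq0; case: ifP => _; lra.
have key b i c j : (i < j)%N -> (j <= n)%N ->
    vec G n r (cross_coord b i) = vec G n r (cross_coord c j) -> False.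
  move=> ij jn e; have i_n : (i <= n)%N := leq_trans (ltnW ij) jn.
  have := congr1 (ip (G i)) e; have := congr1 (ip (G j)) e.
  rewrite !(ip_vec r0 gram) // /cross_coord !eqxx (ltn_eqF ij) (gtn_eqF ij) ij.
  rewrite ltnNge (ltnW ij) /= /sg; move: al_be be_al al_gt0.
  by case: (b); case: (c); rewrite ?expr0 ?expr1; lra.
move=> [b i] [c j] e; rewrite /cross_vertex /= in e.
have jn : (j <= n)%N by rewrite -ltnS.
have i_n : (i <= n)%N by rewrite -ltnS.
have [ij|ji|/val_inj ij] := ltngtP i j.
- by case: (key _ _ _ _ ij jn e).
- by case: (key _ _ _ _ ji i_n (esym e)).
congr (_, _) => //; subst j.
have := congr1 (ip (G i)) e; rewrite !(ip_vec r0 gram) // /cross_coord !eqxx /sg.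
by move: al_gt0; case: (b); case: (c); rewrite ?expr0 ?expr1 //; lra.
Qed.

End Cross.

Lemma typeBC z L x h : multi ip 2 z L x [::] -> simple_system Phi (x :: z :: L) ->
  has_order (coxeter_element ip (x :: z :: L)) h -> generated_by_vertices ip Phi P h.
Proof.
set t := z :: L => -[_ bzx [ar _] _ ox] simp hord.
have sub : {subset x :: t <= Phi} by case: simp.
have zP : z \in Phi by rewrite sub // !in_cons eqxx orbT.
have xP : x \in Phi by rewrite sub // mem_head.
have Phi0 : Phi != fset0 by apply/fset0Pn; exists z.
have tspan := simple_span simp.
pose r := ip z z / 2.
have r0 : 0 < r by rewrite divr_gt0 ?ip_gt0 ?(root_neq0 Phi_root).
have rn : r != 0 by rewrite gt_eqF.
have zz : ip z z = 2 * r by rewrite /r; field.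
have Lx u : u \in L -> ip u x = 0 by move=> uL; apply: ox; rewrite ?mem_head.
(* In type B the end root [x] is short and is itself a coordinate vector; in type C it is long and
   is twice a coordinate vector. *)
have [tau [e0 [tau12 xE ee ze]]] : exists tau e0, [/\ tau = 1 \/ tau = 2,
    x = tau *: e0, ip e0 e0 = r & ip z e0 = - r].
  case: bzx => -[e1 e2].
    exists 1, x; split; rewrite ?scale1r //; [by left|by rewrite /r e1; field|by rewrite e2 /r; field].
  exists 2, (2^-1 *: x); split; first by right.
  - by rewrite scalerA divff ?scale1r // pnatr_eq0.
  - by rewrite !ipE /r e1; field.
  - by rewrite !ipE e2 e1 /r; field.
have tau0 : 0 < tau by case: tau12 => ->.
have taun : tau != 0 by rewrite gt_eqF.
pose G := frame e0 t; pose n := size t.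
have G0 : G 0 = e0 by rewrite /G /frame big_ord0 addr0.
have gram i j : (i <= n)%N -> (j <= n)%N -> ip (G i) (G j) = r * (i == j)%:R.
  move=> i_n jn; rewrite (frame_gram (r := r) (z := z) (L := L)) // ?ee ?subrr ?add0r //.
  move=> u uL; apply/eqP; have /eqP := Lx u uL.
  by rewrite xE ipZr mulf_eq0 (negPf taun).
have gramk i j : (i <= n)%N -> (j <= n)%N -> ip (G i) (G j) = 0 + r * (i == j)%:R.
  by rewrite add0r; apply: gram.
have tE : t = mkseq (fun i => G i.+1 - G i) n by apply: frame_mkseq.
have G_span y : (forall i, (i <= n)%N -> ip (G i) y = 0) -> y = 0.
  move=> Gy; apply: (ip_eq0_span (ip := ip) tspan) => a; rewrite in_cons => /orP[/eqP->|].
    by rewrite xE ipZl -G0 Gy // mulr0.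
  rewrite tE => /mapP[i]; rewrite mem_iota => /andP[_ i_n] ->.
  by rewrite ipBl !Gy ?subrr // ltnW.
have coxE y : coxeter_element ip (x :: t) y =
    reflection ip x (coxeter_element ip (mkseq (fun i => G i.+1 - G i) n) y).
  by rewrite -tE.
have hn : h = (2 * n.+1)%N.
  apply: has_order_uniq hord _; rewrite -[n.+1]subn0.
  apply: (signed_cycle_order r0 gram G_span) => //; first exact: cox_linear.
  - move=> j /andP[_ jn]; rewrite coxE (cox_frame r0 gramk (leqnn n) (ltnW jn)) jn.
    by rewrite xE -G0 (reflection_single r0 gram) // /sg expr0 scale1r.
  - rewrite coxE (cox_frame r0 gramk) // ltnn eqxx.
    by rewrite xE -G0 (reflection_single r0 gram) // eqxx /sg expr1 scaleN1r.
have simpE i : (i < n)%N -> G i.+1 - G i \in Phi.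
  by move=> i_n; rewrite /G frame_diff sub // in_cons mem_nth ?orbT.
have diff_root := frame_roots r0 gramk Phi_root simpE.
have single_root a : signed_single G n tau a -> a \in Phi.
  have pos i : (i <= n)%N -> tau *: G i \in Phi.
    move=> i_n; have [->|i0] := eqVneq i 0%N; first by rewrite G0 -xE.
    have := root_reflection Phi_root (diff_root i 0%N i_n (leq0n n) i0) xP.
    rewrite xE -G0 (linZ (reflection_is_linear ip _)) (frame_reflection r0 gramk) //.
    by rewrite /swap eq_sym (negPf i0) eqxx.
  move=> [i [[] [i_n ->]]]; rewrite /sg ?expr1 ?expr0 ?scaleN1r ?scale1r; last exact: pos.
  by apply: (root_opp Phi_root); apply: pos.
have pair_root a : signed_pair G n a -> a \in Phi.
  have sum i j : (i <= n)%N -> (j <= n)%N -> i != j -> G i + G j \in Phi.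
    move=> i_n jn ij; have jP : tau *: G j \in Phi.
      by apply: single_root; exists j, false; rewrite /sg expr0 scale1r.
    have := root_reflection Phi_root jP (diff_root i j i_n jn ij).
    rewrite addrC -scaleN1r reflection_is_linear !(reflection_single r0 gram) //.
    by rewrite eqxx (negPf ij) /sg expr0 expr1 !scaleN1r opprK scale1r addrC.
  move=> [i [j [[] [[] [i_n jn ij ->]]]]]; rewrite /sg ?expr1 ?expr0 ?scaleN1r ?scale1r.
  - by rewrite -opprD; apply: (root_opp Phi_root); apply: sum.
  - by rewrite addrC; apply: diff_root; rewrite // eq_sym.
  - exact: diff_root.
  - exact: sum.
have rootsE : forall a, a \in Phi -> signed_pair G n a \/ signed_single G n tau a.
  have simple a : a \in x :: t -> signed_pair G n a \/ signed_single G n tau a.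
    rewrite in_cons => /orP[/eqP->|].
      by right; exists 0%N, false; rewrite /sg expr0 scale1r G0.
    rewrite tE => /mapP[i]; rewrite mem_iota => /andP[_ i_n] ->.
    left; exists i.+1, i, false, true; rewrite i_n ltnW // gtn_eqF //.
    by rewrite /sg expr0 expr1 scale1r scaleN1r.
  have perm a : a \in x :: t -> signed_perm G n (reflection ip a).
    rewrite in_cons => /orP[/eqP->|].
      by rewrite xE -G0; apply: (signed_perm_single r0 gram).
    rewrite tE => /mapP[i]; rewrite mem_iota => /andP[_ i_n] ->.
    by apply: (signed_perm_diff r0 gram); rewrite // 1?ltnW // gtn_eqF.
  apply: (root_ind Phi_root Phi_reduced simp) => //.
    by move=> a [/signed_pair_opp|/signed_single_opp]; [left|right].
  move=> a y /perm py [aS|aS]; [left; apply: signed_pair_perm|right; apply: signed_single_perm] => //;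
    exact: reflection_is_linear.
have zconj a : signed_pair G n a -> weyl_conj ip Phi z a.
  move=> aS; have [y yt ya] := weyl_conj_simple Phi_root Phi_reduced simp (pair_root a aS).
  move: yt; rewrite in_cons => /orP[/eqP yx|yt]; last first.
    apply: weyl_conj_trans _ ya; apply: (weyl_conj_arm Phi_root _ ar) yt.
    by move=> u ut; rewrite sub // in_cons ut orbT.
  (* The squared length separates the two classes: 2r for pairs, against r or 4r for multiples of a
     coordinate vector. *)
  exfalso; case: ya => w Ww wa; have := weyl_isometry Phi_root Ww y y.
  rewrite wa (signed_pair_norm gram aS) yx xE !ipE ee => /eqP.
  by case: tau12 => -> /eqP; move: r0; lra.
have xconj a : signed_single G n tau a -> weyl_conj ip Phi x a.
  move=> aS; have [y yt ya] := weyl_conj_simple Phi_root Phi_reduced simp (single_root a aS).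
  move: yt; rewrite in_cons => /orP[/eqP <-//|yt].
  exfalso; case: ya => w Ww wa; have := weyl_isometry Phi_root Ww y y.
  have -> : ip y y = 2 * r.
    by rewrite -zz; move: yt; rewrite in_cons => /orP[/eqP->//|/(arm_norm ar)].
  rewrite wa (signed_single_norm gram aS).
  by case: tau12 => ->; rewrite expr2; move: r0; lra.
case: (P_alc) => _ [Psi [c [Psub PsiE]]].
have [a0 a0Psi] := alcoved_constraints_neq0 Phi_root P_alc Phi0 PsiE.
have cl1 := @class_bound _ _ _ _ _ Phi_root P_sym Psi c (signed_pair G n) PsiE.
have cl2 := @class_bound _ _ _ _ _ Phi_root P_sym Psi c (signed_single G n tau) PsiE.
have {}cl1 := cl1 (fun a a' _ _ aS aS' => weyl_conj_trans (weyl_conj_sym Phi_root (zconj a aS)) (zconj a' aS')).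
have {}cl2 := cl2 (fun a a' _ _ aS aS' => weyl_conj_trans (weyl_conj_sym Phi_root (xconj a aS)) (xconj a' aS')).
have other i : (i <= n)%N -> exists2 j, (j <= n)%N & i != j.
  by case: i => [|i] _; [exists 1%N|exists 0%N].
have bound1 C1 : (forall y a, P y -> a \in Phi -> signed_pair G n a -> ip a y <= C1) ->
    forall y, P y -> forall i j, (i <= n)%N -> (j <= n)%N -> i != j ->
      `|ip (G i) y| + `|ip (G j) y| <= C1.
  by move=> h1 y Py; apply: le_signed_pair => a aS; apply: h1 => //; apply: pair_root.
have bound2 C2 : (forall y a, P y -> a \in Phi -> signed_single G n tau a -> ip a y <= C2) ->
    forall y, P y -> forall i, (i <= n)%N -> `|ip (G i) y| <= C2 / tau.
  by move=> h2 y Py; apply: le_signed_single => // a aS; apply: h2 => //; apply: single_root.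
(* Bounds on single coordinates and on pairs imply each other: |x_i| <= |x_i| + |x_j|, and the sum
   is at most twice the largest coordinate. Lowering each bound to what the other implies gives al
   <= be <= 2 al; a class without constraints receives the implied bound. *)
have [al [be [al_be be_al PE]]] : exists al be : R, [/\ al <= be, be <= 2 * al
    & forall y, P y <-> (forall i, (i <= n)%N -> `|ip (G i) y| <= al) /\
       (forall i j, (i <= n)%N -> (j <= n)%N -> i != j ->
          `|ip (G i) y| + `|ip (G j) y| <= be)].
  have nonneg C : (forall y, P y -> forall i, (i <= n)%N -> `|ip (G i) y| <= C) -> 0 <= C.
    by case: P0 => y Py h1; apply: le_trans (h1 y Py 0%N (leq0n n)); apply: normr_ge0.
  have weaken C y : (forall i j, (i <= n)%N -> (j <= n)%N -> i != j ->
      `|ip (G i) y| + `|ip (G j) y| <= C) -> forall i, (i <= n)%N -> `|ip (G i) y| <= C.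
    move=> yC i i_n; have [j jn ij] := other i i_n.
    by apply: le_trans (yC i j i_n jn ij); rewrite lerDl normr_ge0.
  have double C y : (forall i, (i <= n)%N -> `|ip (G i) y| <= C) ->
     forall i j, (i <= n)%N -> (j <= n)%N -> i != j -> `|ip (G i) y| + `|ip (G j) y| <= 2 * C.
    by move=> yC i j i_n jn _; have := yC i i_n; have := yC j jn; lra.
  case: cl1 => [no1|[C1 [C1P C1c]]]; case: cl2 => [no2|[C2 [C2P C2c]]].
  - by case: (rootsE a0 (Psub _ a0Psi)) => [/(no1 _ a0Psi)|/(no2 _ a0Psi)].
  - have C20 := nonneg _ (bound2 _ C2P).
    exists (C2 / tau), (2 * (C2 / tau)); split=> //; first by lra.
    move=> y; split=> [Py|[y1 y2]]; first by split; [exact: bound2|apply: double; exact: bound2].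
    rewrite PsiE => a aPsi; case: (rootsE a (Psub _ aPsi)) => aS; first by case: (no1 _ aPsi).
    apply: le_trans (C2c a aPsi aS).
    by apply: le_trans (signed_single_le (ltW tau0) y1 aS) _; rewrite mulrC divfK.
  - have C10 := nonneg _ (fun y Py => weaken _ _ (bound1 _ C1P y Py)).
    exists C1, C1; split=> //; first by lra.
    move=> y; split=> [Py|[y1 y2]]; first by split; [apply: weaken; exact: bound1|exact: bound1].
    rewrite PsiE => a aPsi; case: (rootsE a (Psub _ aPsi)) => aS; last by case: (no2 _ aPsi).
    exact: le_trans (signed_pair_le y2 aS) (C1c a aPsi aS).
  - have C10 := nonneg _ (fun y Py => weaken _ _ (bound1 _ C1P y Py)).
    have C20 := nonneg _ (bound2 _ C2P).
    have [al [al1 al2 al3]] : exists al, [/\ al <= C1, al <= C2 / tau & al = C1 \/ al = C2 / tau].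
      by have [le|/ltW le] := leP C1 (C2 / tau); [exists C1|exists (C2 / tau)]; split=> //; auto.
    have al0 : 0 <= al by case: al3 => ->.
    have [be [be1 be2 be3]] : exists be, [/\ be <= C1, be <= 2 * al & be = C1 \/ be = 2 * al].
      by have [le|/ltW le] := leP C1 (2 * al); [exists C1|exists (2 * al)]; split=> //; auto.
    exists al, be; split=> //; first by case: be3 => ->; lra.
    move=> y; split=> [Py|[y1 y2]].
      have yal i : (i <= n)%N -> `|ip (G i) y| <= al.
        by case: al3 => ->; [apply: weaken; exact: bound1|exact: bound2].
      by split=> //; case: be3 => ->; [exact: bound1|exact: double].
    rewrite PsiE => a aPsi; case: (rootsE a (Psub _ aPsi)) => aS.
      by apply: le_trans (signed_pair_le y2 aS) _; apply: le_trans be1 _; apply: C1c.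
    apply: le_trans (C2c a aPsi aS).
    apply: le_trans (signed_single_le (ltW tau0) y1 aS) _.
    by rewrite mulrC -ler_pdivlMr.
apply: (@generated_by_finType _ _ _ _ _ P_alc (bool * 'I_n.+1)%type _ (cross_vertex G r al be)).
- by rewrite card_prod card_bool card_ord hn.
- exact: cross_vertexP.
- move=> a /rootsE[aS|aS]; first exact: cross_vertex_pair.
  exact: cross_vertex_single (ltW tau0) aS.
- exact: cross_vertex_inj.
Qed.

End TypeBC.

(** * Type D *)

Section TypeD.
Variables (R : realType) (V : vectType R) (ip : {dot V for idfun}).
Variables (Phi : {fset V}) (P : set V).
Hypotheses (Phi_root : root_system ip Phi) (Phi_reduced : reduced Phi).
Hypothesis P_sym : weyl_symmetric ip Phi P.
Hypothesis P_alc : alcoved_polytope ip Phi P.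
Hypothesis P0 : (P !=set0)%classic.
Local Notation sg := (sg R).

Lemma one_class_vertex (C : R) v :
  (forall x, P x <-> (forall a, a \in Phi -> ip a x <= C)) -> P v ->
  (forall x, (forall a, a \in Phi -> ip a v = C -> ip a x = 0) -> x = 0) ->
  vertex ip P v.
Proof.
move=> PC Pv sp; apply: (vertexP (N := [seq a <- enum_fset Phi | ip a v == C])) => //.
  by move=> x xN; apply: sp => a aP av; apply: xN; rewrite mem_filter av eqxx.
move=> a; rewrite mem_filter => /andP[/eqP av aP] x Px; rewrite av; exact: (PC x).1.
Qed.

Lemma typeD z L x y h : fork ip z [:: x] [:: y] L ->
  simple_system Phi (x :: y :: z :: L) ->
  has_order (coxeter_element ip (x :: y :: z :: L)) h -> generated_by_vertices ip Phi P h.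
Proof.
set t := y :: z :: L => -[[ax ay ar] [oxy oxL oyL] [_ _ L0]] simp hord.
have sub : {subset x :: t <= Phi} by case: simp.
have zP : z \in Phi by rewrite sub // !in_cons eqxx !orbT.
have yP : y \in Phi by rewrite sub // !in_cons eqxx !orbT.
have xP : x \in Phi by rewrite sub // mem_head.
have Phi0 : Phi != fset0 by apply/fset0Pn; exists z.
have tspan := simple_span simp.
pose r := ip z z / 2.
have r0 : 0 < r by rewrite divr_gt0 ?ip_gt0 ?(root_neq0 Phi_root).
have rn : r != 0 by rewrite gt_eqF.
have zz : ip z z = 2 * r by rewrite /r; field.
have [[xx zx] [yy zy]] : (ip x x = 2 * r /\ ip z x = - r) /\ (ip y y = 2 * r /\ ip z y = - r).
  by case: ax => -[<- ->] _ _; case: ay => -[<- ->] _ _; rewrite zz; split; split=> //; field.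
have xy : ip x y = 0 by apply: oxy; rewrite mem_head.
have arm_t : arm ip y (z :: L).
  by split=> //; split; [rewrite yy zz|rewrite ipC zy yy; field].
(* The solution for [G 0] of x = G 0 + G 1 and y = G 1 - G 0, the two end roots at the fork. *)
pose e0 : V := 2^-1 *: (x - y).
pose G := frame e0 t; pose n := size t.
have n3 : (2 < n)%N by rewrite /n /=; case: (L) L0.
have G0 : G 0 = e0 by rewrite /G /frame big_ord0 addr0.
have gram i j : (i <= n)%N -> (j <= n)%N -> ip (G i) (G j) = r * (i == j)%:R.
  have ee : ip e0 e0 = r by rewrite /e0 !ipE (ipC y x) xx yy xy; field.
  move=> i_n jn; rewrite (frame_gram (r := r) (z := y) (L := z :: L)) // ?ee ?subrr ?add0r //.
    by rewrite /e0 !ipE (ipC y x) xy yy; field.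
  move=> u; rewrite in_cons /e0 ipZr ipBr => /orP[/eqP->|uL].
    by rewrite zx zy subrr mulr0.
  by rewrite (ipC u x) (ipC u y) oxL ?oyL ?mem_head // subrr mulr0.
have gramk i j : (i <= n)%N -> (j <= n)%N -> ip (G i) (G j) = 0 + r * (i == j)%:R.
  by rewrite add0r; apply: gram.
have tE : t = mkseq (fun i => G i.+1 - G i) n by apply: frame_mkseq.
have xE : x = G 0 + G 1.
  rewrite /G frameS -/G G0 addrA -mulr2n -scaler_nat scalerA divff ?pnatr_eq0 //.
  by rewrite scale1r subrK.
have n1 : (1 <= n)%N by apply: leq_trans n3.
have G_span u : (forall i, (i <= n)%N -> ip (G i) u = 0) -> u = 0.
  move=> Gu; apply: (ip_eq0_span (ip := ip) tspan) => a; rewrite in_cons => /orP[/eqP->|].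
    by rewrite xE ipDl !Gu // addr0.
  rewrite tE => /mapP[i]; rewrite mem_iota => /andP[_ i_n] ->.
  by rewrite ipBl !Gu ?subrr // ltnW.
have coxE u : coxeter_element ip (x :: t) u =
    reflection ip x (coxeter_element ip (mkseq (fun i => G i.+1 - G i) n) u).
  by rewrite -tE.
have hn : h = (2 * n)%N.
  apply: has_order_uniq hord _; rewrite -[n in (2 * n)%N]subn0 -subSS.
  apply: (signed_cycle_order r0 gram G_span) => //.
  - exact: cox_linear.
  - move=> [|j] // /andP[_ jn]; rewrite coxE (cox_frame r0 gramk (leqnn n) (ltnW jn)) jn.
    by rewrite xE (reflection_sum r0 gram) // /swap /= /sg expr0 scale1r.
  - rewrite coxE (cox_frame r0 gramk) // ltnn eqxx.
    by rewrite xE (reflection_sum r0 gram) // /swap /= /sg expr1 scaleN1r.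
  - move=> [|j] // _; rewrite coxE (cox_frame r0 gramk) // n1.
    by rewrite xE (reflection_sum r0 gram) // /swap /= /sg expr1 scaleN1r.
have simpE i : (i < n)%N -> G i.+1 - G i \in Phi.
  by move=> i_n; rewrite /G frame_diff sub // in_cons mem_nth ?orbT.
clearbody G.
have diff_root := frame_roots r0 gramk Phi_root simpE.
have sum_step i j l : (i <= n)%N -> (j <= n)%N -> (l <= n)%N -> i != j -> l != i -> l != j ->
    G l + G i \in Phi -> G l + G j \in Phi.
  move=> i_n jn ln ij li lj aP; have := root_reflection Phi_root (diff_root i j i_n jn ij) aP.
  rewrite -[G l]scale1r reflection_is_linear !(frame_reflection r0 gramk) // !scale1r.
  by rewrite /swap eqxx (negPf li) (negPf lj).
have sum0_root j : (0 < j <= n)%N -> G 0 + G j \in Phi.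
  case/andP => j0 jn; have [->|j1] := eqVneq j 1%N; first by rewrite -xE.
  by apply: (@sum_step 1%N) => //; [rewrite eq_sym|rewrite eq_sym -lt0n|rewrite -xE].
have sum_root i j : (i <= n)%N -> (j <= n)%N -> i != j -> G i + G j \in Phi.
  move=> i_n jn ij; have [i0|i0] := eqVneq i 0%N.
    by rewrite i0 sum0_root // jn lt0n -i0 eq_sym ij.
  have [j0|j0] := eqVneq j 0%N; first by rewrite j0 addrC sum0_root // i_n lt0n i0.
  rewrite addrC; apply: (@sum_step 0%N) => //; rewrite 1?eq_sym //.
  by rewrite addrC sum0_root // jn lt0n j0.
have pair_root a : signed_pair G n a -> a \in Phi.
  move=> [i [j [[] [[] [i_n jn ij ->]]]]]; rewrite /sg ?expr1 ?expr0 ?scaleN1r ?scale1r.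
  - by rewrite -opprD; apply: (root_opp Phi_root); apply: sum_root.
  - by rewrite addrC; apply: diff_root; rewrite // eq_sym.
  - exact: diff_root.
  - exact: sum_root.
have rootsE : forall a, a \in Phi -> signed_pair G n a.
  have perm a : a \in x :: t -> signed_perm G n (reflection ip a).
    rewrite in_cons => /orP[/eqP->|].
      by rewrite xE; apply: (signed_perm_sum r0 gram).
    rewrite tE => /mapP[i]; rewrite mem_iota => /andP[_ i_n] ->.
    by apply: (signed_perm_diff r0 gram); rewrite // 1?ltnW // gtn_eqF.
  apply: (root_ind Phi_root Phi_reduced simp) => //.
  - move=> a; rewrite in_cons => /orP[/eqP->|].
      by exists 0%N, 1%N, false, false; rewrite /sg expr0 !scale1r.
    rewrite tE => /mapP[i]; rewrite mem_iota => /andP[_ i_n] ->.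
    exists i.+1, i, false, true; rewrite i_n ltnW // gtn_eqF //.
    by rewrite /sg expr0 expr1 scale1r scaleN1r.
  - exact: signed_pair_opp.
  - move=> a u /perm pu aS; apply: signed_pair_perm => //; exact: reflection_is_linear.
have zconj a : a \in Phi -> weyl_conj ip Phi z a.
  move=> aP; have [u ut ua] := weyl_conj_simple Phi_root Phi_reduced simp aP.
  apply: weyl_conj_trans _ ua; move: ut; rewrite !in_cons -in_cons => /or3P[/eqP->|/eqP->|uL].
  - apply: (weyl_conj_arm Phi_root _ ax); last by rewrite !in_cons eqxx orbT.
    by move=> u'; rewrite !inE => /orP[]/eqP->.
  - apply: (weyl_conj_arm Phi_root _ ay); last by rewrite !in_cons eqxx orbT.
    by move=> u'; rewrite !inE => /orP[]/eqP->.
  - apply: (weyl_conj_arm Phi_root _ ar) uL => u' u'L.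
    by rewrite sub // !(in_cons x, in_cons y) u'L !orbT.
have [C C0 PC] := one_class Phi_root P_sym P_alc P0 Phi0 zconj.
(* Place 0 never carries the -1. The rank is n + 1, so [k] runs over the n remaining places. *)
pose eps (k j : nat) : R := if j == k.+1 then -1 else 1.
pose v (p : bool * 'I_n) : V := vec G n r (fun j => sg p.1 * (eps p.2 j * (C / 2))).
have ipv p i : (i <= n)%N -> ip (G i) (v p) = sg p.1 * (eps p.2 i * (C / 2)).
  by move=> i_n; rewrite (ip_vec r0 gram).
have vP p : P (v p).
  apply/PC => a /rootsE; apply: signed_pair_le => i j i_n jn _; rewrite !ipv // !normrM !normr_sign.
  have eN k l : `|eps k l| = 1 by rewrite /eps; case: ifP; rewrite ?normrN normr1.
  by rewrite !eN !mul1r ger0_norm ?invr_ge0 // ger0_norm //; lra.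
have sgsg b : sg b * sg b = 1 by rewrite sgM addbb.
apply: (@generated_by_finType _ _ _ _ _ P_alc (bool * 'I_n)%type _ v).
- by rewrite card_prod card_bool card_ord hn.
- move=> [b k]; apply: (one_class_vertex PC) => // u ut.
  have epsq j : exists c, eps k j = sg c.
    by rewrite /eps; case: ifP => _; [exists true|exists false]; rewrite /sg ?expr1 ?expr0.
  have ee j : eps k j * eps k j = 1 by have [c ->] := epsq j.
  have tight i j : (i <= n)%N -> (j <= n)%N -> i != j ->
      eps k i * ip (G i) u + eps k j * ip (G j) u = 0.
    move=> i_n jn ij; have [c cE] := epsq i; have [d dE] := epsq j.
    have := ut (sg (b (+) c) *: G i + sg (b (+) d) *: G j).
    rewrite !(ipDl, ipZl) !ipv //= -!sgM -cE -dE.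
    have -> : sg b * eps k i * (sg b * (eps k i * (C / 2))) + sg b * eps k j * (sg b * (eps k j * (C / 2)))
        = (sg b * sg b) * ((eps k i * eps k i) * (C / 2) + (eps k j * eps k j) * (C / 2)) by ring.
    rewrite sgsg !ee mul1r mul1r => h1.
    have : sg b * (eps k i * ip (G i) u + eps k j * ip (G j) u) = 0.
      rewrite mulrDr !mulrA; apply: h1; last by field.
      by apply: pair_root; exists i, j, (b (+) c), (b (+) d); rewrite -!sgM -cE -dE.
    by move/eqP; rewrite mulf_eq0 (negPf (sg_neq0 _ _)) => /eqP.
  apply: G_span => i i_n.
  (* Any two signed coordinates of [u] sum to 0; with three of them at hand, each one vanishes. *)
  have [j [l [jn ln ij il jl]]] : exists j l, [/\ (j <= n)%N, (l <= n)%N, i != j, i != l & j != l].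
    case: i {i_n} => [|[|i]]; [exists 1%N, 2%N|exists 0%N, 2%N|exists 0%N, 1%N]; split=> //; lia.
  have e1 := tight i j i_n jn ij; have e2 := tight i l i_n ln il; have e3 := tight j l jn ln jl.
  have /eqP : eps k i * ip (G i) u = 0 by lra.
  rewrite mulf_eq0 => /orP[|/eqP//]; rewrite /eps; case: ifP => _; rewrite ?oppr_eq0 oner_eq0 //.
- move=> a /[dup] aP /rootsE[i [j [b [c [i_n jn ij aE]]]]].
  suff [p pE] : exists p, ip a (v p) = C by exists p => u Pu; rewrite pE; apply: (PC u).1.
  have [bc|bc] := eqVneq b c.
    (* Two coordinates entering the root with equal signs require the -1 to be elsewhere: since n >=
       3, there are three places to choose from and only two to avoid. *)
    have [k [kn ik jk]] : exists k, [/\ (k < n)%N, i != k.+1 & j != k.+1].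
      case: (boolP ((i == 1) || (j == 1))%N) => h1; last first.
        by exists 0%N; rewrite n1; move: h1; rewrite negb_or => /andP[-> ->].
      case: (boolP ((i == 2) || (j == 2))%N) => h2; last first.
        by exists 1%N; rewrite (ltnW n3); move: h2; rewrite negb_or => /andP[-> ->].
      by exists 2%N; rewrite n3; split=> //; lia.
    exists (b, Ordinal kn); rewrite aE !(ipDl, ipZl) !ipv //= /eps (negPf ik) (negPf jk) -bc.
    by rewrite !mulrA sgsg; field.
  have cb : sg c = - sg b by rewrite sgN; congr (sg _); case: (b) (c) bc => [] [].
  have [j0|j0] := eqVneq j 0%N.
    have i0 : i != 0%N by rewrite -j0.
    have kn : (i.-1 < n)%N by rewrite prednK // lt0n.
    exists (c, Ordinal kn); rewrite aE !(ipDl, ipZl) !ipv //= /eps prednK ?lt0n // eqxx j0.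
    rewrite [0%N == i]eq_sym (negPf i0) cb.
    by transitivity ((sg b * sg b) * C); [field|rewrite sgsg mul1r].
  have kn : (j.-1 < n)%N by rewrite prednK // lt0n.
  exists (b, Ordinal kn); rewrite aE !(ipDl, ipZl) !ipv //= /eps prednK ?lt0n // eqxx (negPf ij) cb.
  by transitivity ((sg b * sg b) * C); [field|rewrite sgsg mul1r].
- move=> Pn [b k] [c l] e; have Cn := one_class_neq0 Phi_root PC Pn.
  have C2 : C / 2 != 0 by rewrite mulf_neq0 // invr_eq0 pnatr_eq0.
  have := congr1 (ip (G 0)) e; rewrite !ipv //= /eps /= !mul1r => /(mulIf C2)/signr_inj bc.
  have kn : (k.+1 <= n)%N by [].
  have := congr1 (ip (G k.+1)) e; rewrite !ipv //= /eps eqxx bc => /(mulfI (sg_neq0 _ _))/(mulIf C2).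
  rewrite eqSS; case: eqP => [/val_inj <- _ //|_ /eqP].
  by rewrite -subr_eq0 -opprD oppr_eq0 -(natrD _ 1 1) pnatr_eq0.
Qed.

End TypeD.

(** * Coxeter orbits and type E *)

Section OrbitGeneration.
Variables (R : realType) (V : vectType R) (ip : {dot V for idfun}).
Variables (Phi : {fset V}) (P : set V).
Hypothesis Phi_root : root_system ip Phi.
Hypothesis P_sym : weyl_symmetric ip Phi P.
Hypothesis P_alc : alcoved_polytope ip Phi P.

Lemma weyl_cox s : {subset s <= Phi} -> weyl_group ip Phi (coxeter_element ip s).
Proof.
elim: s => [|a s IH] sub; first exact: weyl_id.
apply: weyl_comp; first by apply: weyl_reflection; rewrite sub ?mem_head.
by apply: IH => x xs; rewrite sub // in_cons xs orbT.
Qed.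

Lemma weyl_iter c k : weyl_group ip Phi c -> weyl_group ip Phi (iter k c).
Proof. by move=> Wc; elim: k => [|k IH]; [exact: weyl_id|exact: weyl_comp Wc IH]. Qed.

(** If a power of [c] carries [a] to a root maximal at [v0], the inverse power carries [v0] to a
    point of the orbit where [a] is maximal, [c] being an isometry that preserves [P]. *)
Lemma orbit_generation c h v0 : weyl_group ip Phi c -> (0 < h)%N -> iter h c =1 id ->
  vertex ip P v0 ->
  (forall a, a \in Phi -> exists k, forall x, P x -> ip (iter k c a) x <= ip (iter k c a) v0) ->
  (P <> [set 0]%classic -> forall k, (0 < k < h)%N -> iter k c v0 <> v0) ->
  generated_by_vertices ip Phi P h.
Proof.
move=> Wc h0 hc vv0 cov dist.
have itW k := weyl_iter k Wc.
have ithk k x : iter (k * h) c x = x by elim: k => // k IH; rewrite mulSn iterD IH hc.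
exists (fun i : 'I_h => iter i c v0); split.
- by move=> i; apply: (vertex_weyl Phi_root P_sym (itW i) vv0).
- apply: generatingP => // [i|a /cov[k kP]].
    by case: (vertex_weyl Phi_root P_sym (itW i) vv0).
  (* The exponent -k modulo h. *)
  pose j := ((k * h.-1) %% h)%N.
  have jk x : iter j c (iter k c x) = x.
    have [q qE] : exists q, (j + k = q * h)%N.
      have : (h %| j + k)%N.
        rewrite /dvdn modnDml; apply/eqP; rewrite -mulnSr prednK //; exact: modnMl.
      by case/dvdnP => q ->; exists q.
    by rewrite -iterD qE ithk.
  have kj x : iter k c (iter j c x) = x by rewrite -iterD addnC iterD jk.
  exists (Ordinal (ltn_pmod _ h0 : (j < h)%N)) => x Px /=; rewrite -/j.
  have Pkx : P (iter k c x) by rewrite -(P_sym (itW k)); exists x.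
  have iso := weyl_isometry Phi_root (itW k).
  by have := kP _ Pkx; rewrite iso -[v0 in X in _ <= X]kj iso.
- move=> Pn.
  have key i j : (i < j < h)%N -> iter i c v0 = iter j c v0 -> False.
    case/andP => ij jh e; have [w' [_ wK _]] := weyl_cancel Phi_root (itW i).
    apply: (dist Pn (j - i)%N); last first.
      by apply: (can_inj wK); rewrite -iterD subnKC // ltnW.
    by rewrite subn_gt0 ij (leq_ltn_trans (leq_subr _ _) jh).
  move=> i j e; apply: val_inj; have [ij|ji|//] := ltngtP i j.
    by case: (key i j); rewrite ?ij /=.
  by case: (key j i); rewrite ?ji /=.
Qed.

End OrbitGeneration.

(** * Integer certificates for the three systems of type E *)

Definition sumz (s : seq int) : int := foldr +%R 0 s.
Definition dotz (f c : seq int) : int := sumz [seq x.1 * x.2 | x <- zip f c].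

Section Certificate.
Variables (M : seq (seq int)) (n : nat).

Definition entry i j : int := nth 0 (nth [::] M i) j.
(** Two coordinate systems are in use: [reflz] reflects a vector given by its coefficients on the
    simple roots, [actz] one given by its products with the simple roots. *)
Definition reflz (i : nat) (c : seq int) : seq int :=
  let d := dotz (nth [::] M i) c in mkseq (fun k => if k == i then c`_k - d else c`_k) n.
Definition actz (i : nat) (f : seq int) : seq int :=
  let d := f`_i in mkseq (fun k => f`_k - entry i k * d) n.
Definition deltaz i : seq int := mkseq (fun k => (k == i)%:R) n.

(** For roots of equal length, reflecting a positive root in a simple root with negative product
    adds that simple root once, so the layers list the positive roots by height. Completeness is not
    presupposed here: the certificate tests closure under simple reflections. *)
Definition raise (s : seq (seq int)) : seq (seq int) :=
  undup (flatten [seq [seq reflz i c | i <- iota 0 n & dotz (nth [::] M i) c < 0] | c <- s]).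
Fixpoint layers k s : seq (seq int) := if k is k'.+1 then s ++ layers k' (raise s) else s.
Definition posroots k := layers k [seq deltaz i | i <- iota 0 n].
Definition oppz (c : seq int) : seq int := map -%R c.

Definition coxz (c : seq int) := foldr reflz c (iota 0 n).
Definition coxf (f : seq int) := foldr actz f (iota 0 n).

(* k layers of positive roots; the vertex is the coweight of the given node, of
   maximal coefficient m among roots, moved by the word w; h is the order. *)
Definition certificate (k node m : nat) (w : seq nat) (h : nat) : bool :=
  let pos := posroots k in
  let rts := pos ++ map oppz pos in
  let top := [seq c <- pos | c`_node == m%:Z] in
  let f0 := foldr actz (deltaz node) w in
  [&& all (fun c => all (fun i => reflz i c \in rts) (iota 0 n)) rts,
      all (fun c => c`_node <= m%:Z) rts,
      top != [::],
      all (fun i => (i == node) || has (fun a => has (fun b =>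
        all (fun l => a`_l - b`_l == (l == i)%:R) (iota 0 n)) top) top) (iota 0 n),
      all (fun i => iter h coxz (deltaz i) == deltaz i) (iota 0 n),
      all (fun j => iter j coxf f0 != f0) (iota 1 h.-1)
    & all (fun c => has (fun j => dotz f0 (iter j coxz c) == m%:Z) (iota 0 h)) rts].

End Certificate.

Definition tree_cartan (n : nat) (e : seq (nat * nat)) : seq (seq int) :=
  mkseq (fun i => mkseq (fun j => if i == j then 2%:Z else
    if ((i, j) \in e) || ((j, i) \in e) then -1 else 0) n) n.

(** Node 0 is the branch point, node 1 the arm of one node, nodes 2 and 3 the arm of two nodes, and
    nodes 4, 5, ... the arm of [k] nodes. *)
Definition E_cartan (k : nat) : seq (seq int) :=
  tree_cartan (4 + k) ([:: (0, 1); (0, 2); (2, 3); (0, 4)]%N ++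
    mkseq (fun i => (4 + i, 5 + i)%N) k.-1).

(** The 10 layers after the simple roots reach height 11 = h - 1, the largest height of a root; 16
    and 28 arise likewise for E_7 and E_8. The nodes chosen for E_6 and E_7 end an arm and are
    minuscule: no root has a coefficient above 1 there. *)
Lemma certificate_E6 : certificate (E_cartan 2) 6 10 3 1 [::] 12.
Proof. by vm_compute. Qed.
Lemma certificate_E7 : certificate (E_cartan 3) 7 16 6 1 [::] 18.
Proof. by vm_compute. Qed.
(** E_8 has no minuscule coweight. The end of the arm of two nodes has coefficient 2 in the highest
    root, and the word moves its coweight to a point of the Weyl orbit at which every Coxeter orbit
    of roots attains the value 2. *)
Lemma certificate_E8 : certificate (E_cartan 4) 8 28 3 2
  [:: 4; 5; 6; 1; 0; 4; 5; 2; 0; 4; 1; 0; 2; 3]%N 30.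
Proof. by vm_compute. Qed.

(** * Soundness of the certificates *)

Section Soundness.
Variables (R : realType) (V : vectType R) (ip : {dot V for idfun}).
Variables (Phi : {fset V}) (P : set V).
Hypotheses (Phi_root : root_system ip Phi) (Phi_reduced : reduced Phi).
Hypothesis P_sym : weyl_symmetric ip Phi P.
Hypothesis P_alc : alcoved_polytope ip Phi P.
Hypothesis P0 : (P !=set0)%classic.
Variables (t : seq V) (r : R) (M : seq (seq int)) (n : nat).
Hypothesis r0 : 0 < r.
Hypothesis t_size : size t = n.
Hypothesis M_size : forall i, (i < n)%N -> size (nth [::] M i) = n.
Hypothesis M_diag : forall i, (i < n)%N -> entry M i i = 2.
Hypothesis gram : forall i j, (i < n)%N -> (j < n)%N ->
  ip t`_i t`_j = r * (entry M i j)%:~R.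
Hypothesis simp : simple_system Phi t.
Local Notation reflz := (reflz M n).
Local Notation actz := (actz M n).
Local Notation deltaz := (deltaz n).
Local Notation coxz := (coxz M n).
Local Notation coxf := (coxf M n).
Local Notation cox := (coxeter_element ip t).

Let rn : r != 0.
Proof. by rewrite gt_eqF. Qed.

Lemma dotzE f c : size f = n -> size c = n -> dotz f c = \sum_(k < n) f`_k * c`_k.
Proof.
move=> sf sc; rewrite /dotz /sumz foldrE big_map (big_nth (0, 0)) size_zip sf sc minnn.
by rewrite big_mkord; apply: eq_bigr => k _; rewrite nth_zip /= ?sf ?sc.
Qed.

Definition lcomb (c : seq int) : V := \sum_(k < n) (c`_k)%:~R *: t`_k.

Lemma lcomb_delta i : (i < n)%N -> lcomb (deltaz i) = t`_i.
Proof.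
move=> i_n; rewrite /lcomb (bigD1 (Ordinal i_n)) //= nth_mkseq // eqxx scale1r.
rewrite big1 ?addr0 // => k ki; rewrite nth_mkseq //.
by move: ki; rewrite -val_eqE /= => /negPf->; rewrite scale0r.
Qed.

Lemma lcomb_opp c : size c = n -> lcomb (oppz c) = - lcomb c.
Proof.
move=> sc; rewrite /lcomb -sumrN; apply: eq_bigr => k _.
by rewrite /oppz (nth_map 0) ?sc // rmorphN scaleNr.
Qed.

Lemma ip_lcomb f c v : size f = n -> size c = n ->
  (forall k, (k < n)%N -> ip t`_k v = (f`_k)%:~R) ->
  ip (lcomb c) v = (dotz f c)%:~R.
Proof.
move=> sf sc fv; rewrite dotzE // /lcomb ip_suml rmorph_sum; apply: eq_bigr => k _ /=.
by rewrite ipZl fv // -intrM mulrC.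
Qed.

Lemma t_norm i : (i < n)%N -> ip t`_i t`_i = 2 * r.
Proof. by move=> i_n; rewrite gram // M_diag // mulrC. Qed.

Lemma ip_lcomb_t c i : (i < n)%N -> size c = n ->
  ip (lcomb c) t`_i = r * (dotz (nth [::] M i) c)%:~R.
Proof.
move=> i_n sc; rewrite dotzE ?M_size // /lcomb ip_suml rmorph_sum mulr_sumr.
apply: eq_bigr => k _ /=; rewrite ipZl ipC gram // mulrCA; congr (_ * _).
by rewrite intrM mulrC.
Qed.

Lemma lcomb_reflz i c : (i < n)%N -> size c = n ->
  reflection ip t`_i (lcomb c) = lcomb (reflz i c).
Proof.
move=> i_n sc; rewrite reflectionE ip_lcomb_t // t_norm //.
have -> d : 2 * (r * d) / (2 * r) = d by field.
rewrite /lcomb (bigD1 (Ordinal i_n)) //= [in RHS](bigD1 (Ordinal i_n)) //=.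
rewrite nth_mkseq // eqxx rmorphB scalerBl addrAC; congr (_ + _).
apply: eq_bigr => k ki; rewrite nth_mkseq //.
by move: ki; rewrite -val_eqE /= => /negPf->.
Qed.

Lemma size_reflz i c : size (reflz i c) = n.
Proof. exact: size_mkseq. Qed.

Lemma size_actz i f : size (actz i f) = n.
Proof. exact: size_mkseq. Qed.

Lemma size_foldr_reflz c s : size c = n -> size (foldr reflz c s) = n.
Proof. by case: s => //= *; rewrite size_reflz. Qed.

Lemma size_foldr_actz f s : size f = n -> size (foldr actz f s) = n.
Proof. by case: s => //= *; rewrite size_actz. Qed.

Definition wordv (s : seq nat) (v : V) := coxeter_element ip [seq t`_i | i <- s] v.

Lemma cox_word : cox =1 wordv (iota 0 n).
Proof. by move=> v; rewrite /wordv -t_size -/(mkseq _ _) mkseq_nth. Qed.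

Lemma lcomb_word s c : all (gtn n) s -> size c = n ->
  wordv s (lcomb c) = lcomb (foldr reflz c s).
Proof.
elim: s => //= i s IH /andP[i_n sn] sc; rewrite /wordv /= -/(wordv s _) IH //.
by rewrite lcomb_reflz // size_foldr_reflz.
Qed.

Definition values (f : seq int) v := forall k, (k < n)%N -> ip t`_k v = (f`_k)%:~R.

Lemma values_word s f v : all (gtn n) s -> values f v ->
  values (foldr actz f s) (wordv s v).
Proof.
elim: s => //= i s IH /andP[i_n sn] fv k kn; rewrite /wordv /= -/(wordv s _).
have h := IH sn fv; rewrite reflectionE ipBr ipZr h // ipC h // t_norm // ipC gram //.
rewrite nth_mkseq // rmorphB rmorphM /=; congr (_ - _); field.
exact: rn.
Qed.

Lemma iota_lt : all (gtn n) (iota 0 n).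
Proof. by apply/allP => i; rewrite mem_iota. Qed.

Lemma iter_coxz k c : size c = n ->
  size (iter k coxz c) = n /\ iter k cox (lcomb c) = lcomb (iter k coxz c).
Proof.
move=> sc; elim: k => [|k [s1 e]] //=; split; first exact: size_foldr_reflz.
by rewrite e cox_word lcomb_word // iota_lt.
Qed.

Lemma iter_coxf k f v : size f = n -> values f v ->
  size (iter k coxf f) = n /\ values (iter k coxf f) (iter k cox v).
Proof.
move=> sf fv; elim: k => [|k [s1 e]] //=; split; first exact: size_foldr_actz.
by rewrite cox_word; apply: values_word => //; apply: iota_lt.
Qed.

Lemma t_root i : (i < n)%N -> t`_i \in Phi.
Proof. by move=> i_n; case: simp => sub _ _; rewrite sub // mem_nth // t_size. Qed.

Lemma posroots_root k : {in posroots M n k, forall c, size c = n /\ lcomb c \in Phi}.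
Proof.
have gen s : {in s, forall c, size c = n /\ lcomb c \in Phi} ->
    {in layers M n k s, forall c, size c = n /\ lcomb c \in Phi}.
  elim: k s => [|k IH] s ok //= c; rewrite mem_cat => /orP[/ok//|]; apply: IH => {}c.
  rewrite mem_undup => /flatten_mapP[d ds /mapP[i]]; rewrite mem_filter mem_iota.
  move=> /and3P[_ _ i_n] ->; have [sd dP] := ok d ds; split; first exact: size_reflz.
  by rewrite -lcomb_reflz //; apply: (root_reflection Phi_root) => //; apply: t_root.
apply: gen => c /mapP[i]; rewrite mem_iota => /andP[_ i_n] ->.
by split; [exact: size_mkseq|rewrite lcomb_delta ?t_root].
Qed.

Lemma posroots_delta k i : (i < n)%N -> deltaz i \in posroots M n k.
Proof.
move=> i_n; have : deltaz i \in [seq deltaz i | i <- iota 0 n].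
  by apply/mapP; exists i; rewrite // mem_iota.
by rewrite /posroots; case: k => //= k dl; rewrite mem_cat dl.
Qed.

Lemma cox_root s a : {subset s <= Phi} -> a \in Phi -> coxeter_element ip s a \in Phi.
Proof.
elim: s => //= b s IH bs aP; apply: (root_reflection Phi_root).
  by rewrite bs ?mem_head.
by apply: IH => // q qs; rewrite bs // in_cons qs orbT.
Qed.

Lemma wordv_linear s : linear (wordv s).
Proof. exact: cox_linear. Qed.

(** The listed roots contain the simple ones and are closed under negation and, by the first check,
    under simple reflections; induction on roots makes the list exhaustive. The vertex is a
    fundamental coweight, scaled so that a root with coefficient [m] at [node] attains the bound
    [C], and then moved by [w]. *)
Lemma certificateP k node m w h h' z : certificate M n k node m w h ->
  (node < n)%N -> (0 < m)%N -> (0 < h)%N -> all (gtn n) w ->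
  (forall a, a \in Phi -> weyl_conj ip Phi z a) -> Phi != fset0 ->
  has_order cox h' -> generated_by_vertices ip Phi P h'.
Proof.
rewrite /certificate; set pos := posroots M n k; set rts := pos ++ _; set top := filter _ pos.
set f0 := foldr actz (deltaz node) w.
move=> /and5P[/allP closed /allP le_m top0 /allP diff /and3P[/allP order /allP dist /allP cov]].
move=> node_n m0 h0 wn zconj Phi0 hord.
have tspan := simple_span simp; have ut := simple_uniq simp.
have posP : {in pos, forall c, size c = n /\ lcomb c \in Phi} by apply: posroots_root.
have rts_size c : c \in rts -> size c = n.
  rewrite mem_cat => /orP[/posP[]//|/mapP[d /posP[sd _] ->]]; by rewrite size_map.
have rootsE : forall a, a \in Phi -> exists2 c, c \in rts & a = lcomb c.
  apply: (root_ind Phi_root Phi_reduced simp).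
  - move=> x xt; exists (deltaz (index x t)).
      by rewrite mem_cat posroots_delta // -t_size index_mem.
    by rewrite lcomb_delta ?nth_index // -t_size index_mem.
  - move=> a [c crts ->]; exists (oppz c); last by rewrite lcomb_opp // rts_size.
    move: crts; rewrite !mem_cat => /orP[cp|/mapP[d dp ->]].
      by rewrite (map_f oppz cp) orbT.
    by rewrite /oppz -map_comp map_id_in ?dp // => q _ /=; rewrite opprK.
  - move=> a x xt [c crts ->]; have xi : (index x t < n)%N by rewrite -t_size index_mem.
    exists (reflz (index x t) c).
      by have /allP := closed c crts; apply; rewrite mem_iota.
    by rewrite -lcomb_reflz ?nth_index // rts_size.
have [C C0 PC] := one_class Phi_root P_sym P_alc P0 Phi0 zconj.
have tbas : basis_of fullv t by case: simp.
(* The fundamental coweight of [node], on which a root takes its coefficient at [node] as value. *)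
have [u uP] := riesz ip (fun x => (index x t == node)%:R) tbas.
have uval : values (deltaz node) u.
  move=> i i_n; rewrite uP; last by rewrite mem_nth // t_size.
  by rewrite index_uniq ?t_size // nth_mkseq //; case: eqP.
have sdelta : size (deltaz node) = n by rewrite size_mkseq.
have mR : (m%:R : R) != 0 by rewrite pnatr_eq0 -lt0n.
have mR0 : 0 < (m%:R : R) by rewrite ltr0n.
have ipu c : size c = n -> ip (lcomb c) u = (c`_node)%:~R.
  move=> sc; rewrite (ip_lcomb sdelta sc uval) dotzE //; congr (_%:~R).
  rewrite (bigD1 (Ordinal node_n)) //= nth_mkseq // eqxx mul1r big1 ?addr0 // => i ki.
  by rewrite nth_mkseq //; move: ki; rewrite -val_eqE /= => /negPf->; rewrite mul0r.
pose v1 := (C / m%:R) *: u.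
have Pv1 : P v1.
  apply/PC => a /rootsE[c crts ->]; rewrite ipZr ipu ?rts_size // -mulrA ler_piMr //.
  rewrite ler_pdivrMl // mulr1 -[m%:R]/((m%:Z)%:~R) ler_int; exact: le_m.
have vv1 : vertex ip P v1.
  apply: (one_class_vertex PC Pv1) => x xt.
  have topx c : c \in top -> ip (lcomb c) x = 0 /\ size c = n.
    rewrite mem_filter => /andP[/eqP cm cpos]; have [sc cP] := posP c cpos; split=> //.
    apply: xt => //; rewrite ipZr ipu // cm; exact: divfK.
  (* Each simple root other than that of [node] is a difference of two roots tight at [v1]. Adding
     one tight root, whose coefficient at [node] is [m], completes these to a spanning family. *)
  have xi i : (i < n)%N -> i != node -> ip t`_i x = 0.
    move=> i_n inode; have := diff i; rewrite mem_iota i_n => /(_ isT).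
    rewrite (negPf inode) /= => /hasP[a atop /hasP[b btop /allP ab]].
    have [ax sa] := topx a atop; have [bx sb] := topx b btop.
    have -> : t`_i = lcomb a - lcomb b; last by rewrite ipBl ax bx subrr.
    rewrite -(lcomb_delta i_n) /lcomb -sumrB; apply: eq_bigr => l _.
    have := ab l; rewrite mem_iota ltn_ord => /(_ isT)/eqP e.
    by rewrite -scalerBl -rmorphB e nth_mkseq.
  apply: (ip_eq0_span (ip := ip) tspan) => y yt.
  have yi : (index y t < n)%N by rewrite -t_size index_mem.
  rewrite -(nth_index 0 yt); have [->|] := eqVneq (index y t) node; last exact: xi.
  have [c ctop] : exists c, c \in top.
    by case: (top) top0 => // c s _; exists c; rewrite mem_head.
  have [cx sc] := topx c ctop; move: ctop; rewrite mem_filter => /andP[/eqP cm _].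
  move: cx; rewrite /lcomb ip_suml (bigD1 (Ordinal node_n)) //= big1 => [|l ln].
    by rewrite addr0 ipZl cm => /eqP; rewrite mulf_eq0 (negPf mR) => /eqP.
  by rewrite ipZl xi ?mulr0 //; move: ln; rewrite -val_eqE.
pose u0 := wordv w u.
have f0val : values f0 u0 by apply: values_word.
have sf0 : size f0 = n by apply: size_foldr_actz.
have ne j : (0 < j < h)%N -> iter j cox u0 <> u0.
  move=> /andP[j0 jh] e; have := dist j; rewrite mem_iota j0 add1n prednK // => /(_ jh)/eqP; apply.
  have [s1 v1'] := iter_coxf j sf0 f0val.
  apply: (@eq_from_nth _ 0); rewrite s1 // => i i_n.
  by apply: (@intr_inj R); rewrite -v1' // e f0val.
have hid : iter h cox =1 id.
  apply: (linear_span_id _ tspan); first by apply/iter_linear/cox_linear.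
  move=> y yt; have yi : (index y t < n)%N by rewrite -t_size index_mem.
  rewrite -(nth_index 0 yt) -lcomb_delta //.
  have [_ ->] := iter_coxz h (size_mkseq _ _ : size (deltaz (index y t)) = n).
  by have := order (index y t); rewrite mem_iota yi => /(_ isT)/eqP->.
(* The distinctness of the orbit of [u0] also fixes the order of the Coxeter element: a smaller
   power equal to the identity would fix [u0]. *)
have hh : h' = h.
  apply: has_order_uniq hord _; split=> // j jh e.
  by apply: (ne j jh); rewrite e.
have tsub : {subset t <= Phi} by case: simp.
have wcox : weyl_group ip Phi (coxeter_element ip [seq t`_i | i <- w]).
  apply: weyl_cox => _ /mapP[i iw ->]; apply: t_root.
  by move/allP: wn; apply.
have v0E : wordv w v1 = (C / m%:R) *: u0 by rewrite (linZ (wordv_linear w)).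
rewrite hh; apply: (@orbit_generation _ _ _ _ _ Phi_root P_sym P_alc cox h (wordv w v1)) => //.
- exact: weyl_cox.
- exact: (vertex_weyl Phi_root P_sym wcox vv1).
- move=> a aP; have [c crts aE] := rootsE a aP; have sc := rts_size c crts.
  have /hasP[j _ /eqP jE] := cov c crts; exists j => x Px.
  have jP : iter j cox a \in Phi.
    by elim: j {jE} => // j IH; rewrite iterS; apply: cox_root.
  apply: le_trans ((PC x).1 Px _ jP) _; rewrite v0E ipZr aE.
  have [sj ->] := iter_coxz j sc; rewrite (ip_lcomb sf0 sj f0val) jE.
  by rewrite divfK.
- move=> Pn j jh; rewrite v0E (linZ (iter_linear j (cox_linear ip t))) => e.
  have Cn := one_class_neq0 Phi_root PC Pn.
  apply: (ne j jh); apply: (scalerI _ e).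
  by rewrite mulf_neq0 // invr_eq0.
Qed.

End Soundness.

Lemma tree_cartan_sym n e i j : (i < n)%N -> (j < n)%N ->
  entry (tree_cartan n e) i j = entry (tree_cartan n e) j i.
Proof. by move=> i_n jn; rewrite /entry !nth_mkseq // eq_sym orbC. Qed.

Lemma E_cartan_chain k i j : (i < k)%N -> (j < k)%N -> (2 <= k <= 4)%N ->
  entry (E_cartan k) (4 + i) (4 + j) =
    2 * (i == j)%:R - (i == j.+1)%:R - (i.+1 == j)%:R.
Proof.
by case: k => [|[|[|[|[|]]]]] //; case: i => [|[|[|[|]]]] //; case: j => [|[|[|[|]]]].
Qed.

Lemma E_cartan_row k i j : (i < 4)%N -> (j < k)%N -> (2 <= k <= 4)%N ->
  entry (E_cartan k) i (4 + j) = - ((i == 0%N) && (j == 0%N))%:R.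
Proof.
by case: k => [|[|[|[|[|]]]]] //; case: i => [|[|[|[|]]]] //; case: j => [|[|[|[|]]]].
Qed.

Lemma E_cartan_core k i j : (i < 4)%N -> (j < 4)%N -> (2 <= k <= 4)%N ->
  entry (E_cartan k) i j = entry (E_cartan 2) i j.
Proof.
by case: k => [|[|[|[|[|]]]]] //; case: i => [|[|[|[|]]]] //; case: j => [|[|[|[|]]]].
Qed.

(** * Type E *)

Section TypeE.
Variables (R : realType) (V : vectType R) (ip : {dot V for idfun}).
Variables (Phi : {fset V}) (P : set V).
Hypotheses (Phi_root : root_system ip Phi) (Phi_reduced : reduced Phi).
Hypothesis P_sym : weyl_symmetric ip Phi P.
Hypothesis P_alc : alcoved_polytope ip Phi P.
Hypothesis P0 : (P !=set0)%classic.

Lemma typeE_gram z L x y y' i j : fork ip z [:: x] [:: y; y'] L ->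
  (2 <= size L <= 4)%N -> (i < 4 + size L)%N -> (j < 4 + size L)%N ->
  ip (z :: x :: y :: y' :: L)`_i (z :: x :: y :: y' :: L)`_j =
    ip z z / 2 * (entry (E_cartan (size L)) i j)%:~R.
Proof.
move=> [[a1 a2 a3] [o12 o13 o23] _] sL i_n jn.
have g1 := arm_gram a1; have g2 := arm_gram a2; have g3 := arm_gram a3.
wlog ij : i j i_n jn / (i <= j)%N.
  move=> wl; have [ij|/ltnW ji] := leqP i j; first exact: wl.
  by rewrite ipC wl // tree_cartan_sym.
have cross12 l : (l < 2)%N -> ip x [:: y; y']`_l = 0.
  by move=> l2; apply: o12; rewrite ?mem_head ?mem_nth.
have cross13 l : (l < size L)%N -> ip x L`_l = 0.
  by move=> lL; apply: o13; rewrite ?mem_head ?mem_nth.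
have cross23 l l' : (l < 2)%N -> (l' < size L)%N -> ip [:: y; y']`_l L`_l' = 0.
  by move=> l2 lL; apply: o23; rewrite ?mem_nth.
have xx : ip x x = ip z z by case: a1 => -[].
have [yy y'y'] : ip y y = ip z z /\ ip y' y' = ip z z.
  by have := arm_norm a2; move=> h; rewrite !h // !inE eqxx ?orbT.
move: i_n jn ij.
case: i => [|[|[|[|i]]]]; case: j => [|[|[|[|j]]]] //= i_n jn ij.
- by rewrite E_cartan_core // (_ : entry _ _ _ = 2) //; field.
- by have := g1 0%N 1%N isT isT; rewrite /= => ->; rewrite E_cartan_core // (_ : entry _ _ _ = -1) // rmorphN1; ring.
- by have := g2 0%N 1%N isT isT; rewrite /= => ->; rewrite E_cartan_core // (_ : entry _ _ _ = -1) // rmorphN1; ring.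
- by have := g2 0%N 2%N isT isT; rewrite /= => ->; rewrite E_cartan_core // (_ : entry _ _ _ = 0) //; ring.
- have := g3 0%N j.+1 isT jn; rewrite /= => ->; rewrite (@E_cartan_row _ 0 j) // rmorphN /= eqSS [0%N == j]eq_sym.
  by case: (j == 0%N) => /=; ring.
- by rewrite xx E_cartan_core // (_ : entry _ _ _ = 2) //; field.
- by rewrite (cross12 0%N) // E_cartan_core // (_ : entry _ _ _ = 0) // mulr0.
- by rewrite (cross12 1%N) // E_cartan_core // (_ : entry _ _ _ = 0) // mulr0.
- by rewrite (cross13 j) // (@E_cartan_row _ 1 j) //= oppr0 mulr0.
- by rewrite yy E_cartan_core // (_ : entry _ _ _ = 2) //; field.
- by have := g2 1%N 2%N isT isT; rewrite /= => ->; rewrite E_cartan_core // (_ : entry _ _ _ = -1) // rmorphN1; ring.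
- by rewrite (cross23 0%N j) // (@E_cartan_row _ 2 j) //= oppr0 mulr0.
- by rewrite y'y' E_cartan_core // (_ : entry _ _ _ = 2) //; field.
- by rewrite (cross23 1%N j) // (@E_cartan_row _ 3 j) //= oppr0 mulr0.
- have := g3 i.+1 j.+1 i_n jn; rewrite /= !eqSS => ->; rewrite (@E_cartan_chain _ i j) //; congr (_ * _).
  by rewrite !rmorphB rmorphM /=; case: eqP; case: eqP; case: eqP.
Qed.

Lemma typeE z L x y y' h : fork ip z [:: x] [:: y; y'] L -> (2 <= size L <= 4)%N ->
  simple_system Phi (z :: x :: y :: y' :: L) ->
  has_order (coxeter_element ip (z :: x :: y :: y' :: L)) h ->
  generated_by_vertices ip Phi P h.
Proof.
move=> fk sL simp hord; set t := z :: _ in simp hord.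
case: (fk) => -[a1 a2 a3] _ _.
have sub : {subset t <= Phi} by case: simp.
have zP : z \in Phi by rewrite sub ?mem_head.
have Phi0 : Phi != fset0 by apply/fset0Pn; exists z.
have r0 : 0 < ip z z / 2 by rewrite divr_gt0 ?ip_gt0 ?(root_neq0 Phi_root).
have zconj a : a \in Phi -> weyl_conj ip Phi z a.
  move=> aP; have [u ut ua] := weyl_conj_simple Phi_root Phi_reduced simp aP.
  apply: weyl_conj_trans _ ua.
  have [u1|[u2|u3]] : u \in z :: [:: x] \/ u \in z :: [:: y; y'] \/ u \in z :: L.
    move: ut; rewrite /t !in_cons => /or4P[e|e|e|/orP[e|e]]; rewrite e ?orbT; auto.
  - apply: (weyl_conj_arm Phi_root _ a1) u1 => q qL; apply: sub; move: qL.
    by rewrite /t !in_cons in_nil orbF => /orP[]->; rewrite ?orbT.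
  - apply: (weyl_conj_arm Phi_root _ a2) u2 => q qL; apply: sub; move: qL.
    by rewrite /t !in_cons in_nil orbF => /or3P[]->; rewrite ?orbT.
  - apply: (weyl_conj_arm Phi_root _ a3) u3 => q qL; apply: sub; move: qL.
    by rewrite /t !in_cons => /orP[]->; rewrite ?orbT.
have gram i j : (i < size t)%N -> (j < size t)%N ->
    ip t`_i t`_j = ip z z / 2 * (entry (E_cartan (size L)) i j)%:~R.
  by move=> i_n jn; apply: typeE_gram.
have M_size i : (i < size t)%N -> size (nth [::] (E_cartan (size L)) i) = size t.
  by move=> i_n; rewrite /E_cartan /tree_cartan nth_mkseq ?size_mkseq.
have M_diag i : (i < size t)%N -> entry (E_cartan (size L)) i i = 2.
  by move=> i_n; rewrite /entry /E_cartan /tree_cartan !nth_mkseq // eqxx.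
have st : size t = (4 + size L)%N by [].
have cert := @certificateP _ _ _ _ _ Phi_root Phi_reduced P_sym P_alc P0 t _ _ _ r0 st M_size M_diag gram simp.
case sLE : (size L) sL => [|[|[|[|[|l]]]]] // _; rewrite sLE in cert.
- exact: (cert _ _ _ _ _ _ _ certificate_E6 isT isT isT isT zconj Phi0 hord).
- exact: (cert _ _ _ _ _ _ _ certificate_E7 isT isT isT isT zconj Phi0 hord).
- exact: (cert _ _ _ _ _ _ _ certificate_E8 isT isT isT isT zconj Phi0 hord).
Qed.

End TypeE.

(** * Types G and F *)

(** Coordinates refer to the long simple root first and the short one second. *)
Definition G2_reflect_long (c : int * int) : int * int := (c.2 - c.1, c.2).
Definition G2_reflect_short (c : int * int) : int * int := (c.1, 3 * c.1 - c.2).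
Definition G2_cox c := G2_reflect_long (G2_reflect_short c).
Definition G2_long : seq (int * int) :=
  [:: (1, 0); (2, 3); (1, 3); (-1, 0); (-2, -3); (-1, -3)].
Definition G2_short : seq (int * int) :=
  [:: (0, 1); (1, 1); (1, 2); (0, -1); (-1, -1); (-1, -2)].

Section TypeG.
Variables (R : realType) (V : vectType R) (ip : {dot V for idfun}).
Variables (Phi : {fset V}) (P : set V).
Hypotheses (Phi_root : root_system ip Phi) (Phi_reduced : reduced Phi).
Hypothesis P_sym : weyl_symmetric ip Phi P.
Hypothesis P_alc : alcoved_polytope ip Phi P.
Hypothesis P0 : (P !=set0)%classic.
Variables a s : V.
Hypotheses (aa : ip a a = 3 * ip s s) (as_ : ip a s = - ip a a / 2).
Hypothesis simp : simple_system Phi [:: a; s].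

Definition G2_comb (c : int * int) : V := c.1%:~R *: a + c.2%:~R *: s.
Local Notation cox := (coxeter_element ip [:: a; s]).

Let aP : a \in Phi.
Proof. by case: simp => sub _ _; rewrite sub // !inE eqxx. Qed.
Let sP : s \in Phi.
Proof. by case: simp => sub _ _; rewrite sub // !inE eqxx orbT. Qed.
Let ss0 : 0 < ip s s.
Proof. by rewrite ip_gt0 (root_neq0 Phi_root). Qed.

Lemma G2_comb_long c : reflection ip a (G2_comb c) = G2_comb (G2_reflect_long c).
Proof.
case: c => p q; rewrite /G2_comb /G2_reflect_long /= reflection_is_linear (reflection_id ip (root_neq0 Phi_root aP)).
rewrite (linZ (reflection_is_linear ip a)).
have -> : reflection ip a s = a + s.
  rewrite reflectionE ipC as_ aa (_ : 2 * _ / _ = -1).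
    by rewrite scaleN1r opprK addrC.
  by field; rewrite gt_eqF.
by rewrite rmorphB scalerBl scalerDr scalerN addrCA addrA.
Qed.

Lemma G2_comb_short c : reflection ip s (G2_comb c) = G2_comb (G2_reflect_short c).
Proof.
case: c => p q; rewrite /G2_comb /G2_reflect_short /= reflection_is_linear.
rewrite (linZ (reflection_is_linear ip s)) (reflection_id ip (root_neq0 Phi_root sP)).
have -> : reflection ip s a = a + (3 : R) *: s.
  rewrite reflectionE as_ aa (_ : 2 * _ / _ = -3).
    by rewrite scaleNr opprK.
  by field; rewrite gt_eqF.
rewrite rmorphB rmorphM scalerBl scalerDr scalerN scalerA addrA.
by rewrite [_%:~R * 3]mulrC.
Qed.

Lemma G2_comb_cox k c : iter k cox (G2_comb c) = G2_comb (iter k G2_cox c).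
Proof. by elim: k => //= k ->; rewrite G2_comb_short G2_comb_long. Qed.

Lemma G2_comb10 : G2_comb (1, 0) = a.
Proof. by rewrite /G2_comb /= scale1r scale0r addr0. Qed.
Lemma G2_comb01 : G2_comb (0, 1) = s.
Proof. by rewrite /G2_comb /= scale1r scale0r add0r. Qed.

Lemma G2_comb_ip c x : ip (G2_comb c) x = c.1%:~R * ip a x + c.2%:~R * ip s x.
Proof. by rewrite /G2_comb ipDl !ipZl. Qed.

Lemma G2_order : has_order cox 6.
Proof.
have tspan := simple_span simp; have tbas : basis_of fullv [:: a; s] by case: simp.
split=> //.
  apply: (linear_span_id _ tspan); first by apply/iter_linear/cox_linear.
  move=> y; rewrite !inE => /orP[]/eqP->.
    by transitivity (G2_comb (iter 6 G2_cox (1, 0))); [rewrite -G2_comb_cox G2_comb10|exact: G2_comb10].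
  by transitivity (G2_comb (iter 6 G2_cox (0, 1))); [rewrite -G2_comb_cox G2_comb01|exact: G2_comb01].
have sa : s != a.
  by apply/eqP => e; move: aa ss0; rewrite e; lra.
(* This vector reads off p + 10 q from the coordinates (p, q). At [a] the value is 1; at its images
   under the five proper powers it is 32, 31, -1, -32 and -31. *)
have [d dP] := riesz ip (fun y => if y == a then 1 else 10) tbas.
have da : ip a d = 1 by rewrite dP ?eqxx // !inE eqxx.
have ds : ip s d = 10 by rewrite dP ?(negPf sa) // !inE eqxx orbT.
move=> k kh /(_ a); have -> : iter k cox a = G2_comb (iter k G2_cox (1, 0)).
  by rewrite -G2_comb_cox G2_comb10.
move=> /(congr1 (ip^~ d)); rewrite G2_comb_ip da ds.
rewrite mulr1 -[10]/(10%:~R) -intrM -intrD -[1]/(1%:~R) => /intr_inj.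
by case: k kh => [|[|[|[|[|[|]]]]]].
Qed.

Lemma G2_root c : c \in G2_long ++ G2_short -> G2_comb c \in Phi.
Proof.
have long1 : G2_comb (1, 0) \in Phi by rewrite G2_comb10.
have short1 : G2_comb (0, 1) \in Phi by rewrite G2_comb01.
have step k c' : G2_comb c' \in Phi -> G2_comb (iter k G2_cox c') \in Phi.
  move=> h; elim: k => //= k IH; rewrite /G2_cox -G2_comb_long -G2_comb_short.
  by do 2 apply: (root_reflection Phi_root) => //.
have orbits : all (fun c => has (fun k => has (fun c0 => c == iter k G2_cox c0)
  [:: (1, 0); (0, 1)]) (iota 0 6)) (G2_long ++ G2_short) by [].
move=> /(allP orbits)/hasP[k _ /hasP[c0 c0in /eqP->]]; apply: step.
by move: c0in; rewrite !inE => /orP[]/eqP->.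
Qed.

Lemma G2_roots u : u \in Phi -> exists2 c, c \in G2_long ++ G2_short & u = G2_comb c.
Proof.
move: u; apply: (root_ind Phi_root Phi_reduced simp).
- move=> x; rewrite !inE => /orP[]/eqP->; first by exists (1, 0); rewrite ?G2_comb10.
  by exists (0, 1); rewrite ?G2_comb01.
- move=> u [c cr ->]; exists (- c.1, - c.2).
    by apply/allP: c cr.
  by rewrite /G2_comb !rmorphN !scaleNr opprD.
- move=> u x; rewrite !inE => /orP[]/eqP-> [c cr ->].
    rewrite G2_comb_long; exists (G2_reflect_long c) => //.
    by apply/allP: c cr.
  rewrite G2_comb_short; exists (G2_reflect_short c) => //.
  by apply/allP: c cr.
Qed.

Definition G2_short_le (C X Y : R) :=
  [/\ Y <= C /\ - Y <= C, X + Y <= C /\ - (X + Y) <= C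
    & X + 2 * Y <= C /\ - (X + 2 * Y) <= C].
Definition G2_long_le (C X Y : R) :=
  [/\ X <= C /\ - X <= C, X + 3 * Y <= C /\ - (X + 3 * Y) <= C
    & 2 * X + 3 * Y <= C /\ - (2 * X + 3 * Y) <= C].

Lemma G2_short_leP C x : (forall c, c \in G2_short -> ip (G2_comb c) x <= C) <->
  G2_short_le C (ip a x) (ip s x).
Proof.
split=> [h|[[h1 h2] [h3 h4] [h5 h6]] c].
  have h1 := h (0, 1) isT; have h2 := h (1, 1) isT; have h3 := h (1, 2) isT.
  have h4 := h (0, -1) isT; have h5 := h (-1, -1) isT; have h6 := h (-1, -2) isT.
  move: h1 h2 h3 h4 h5 h6; rewrite !G2_comb_ip /= !rmorphN /=.
  by move: (ip a x) (ip s x) => X Y *; split; split; lra.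
move: (ip a x) (ip s x) (G2_comb_ip c x) h1 h2 h3 h4 h5 h6 => X Y -> h1 h2 h3 h4 h5 h6.
rewrite !inE => /or4P[|||/or3P[]] /eqP-> /=; rewrite ?rmorphN /=; lra.
Qed.

Lemma G2_long_leP C x : (forall c, c \in G2_long -> ip (G2_comb c) x <= C) <->
  G2_long_le C (ip a x) (ip s x).
Proof.
split=> [h|[[h1 h2] [h3 h4] [h5 h6]] c].
  have h1 := h (1, 0) isT; have h2 := h (1, 3) isT; have h3 := h (2, 3) isT.
  have h4 := h (-1, 0) isT; have h5 := h (-1, -3) isT; have h6 := h (-2, -3) isT.
  move: h1 h2 h3 h4 h5 h6; rewrite !G2_comb_ip /= !rmorphN /=.
  by move: (ip a x) (ip s x) => X Y *; split; split; lra.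
move: (ip a x) (ip s x) (G2_comb_ip c x) h1 h2 h3 h4 h5 h6 => X Y -> h1 h2 h3 h4 h5 h6.
rewrite !inE => /or4P[|||/or3P[]] /eqP-> /=; rewrite ?rmorphN /=; lra.
Qed.

(** Three times a short root is a sum of two long ones. Conversely a long root is a sum of two short
    ones, whence the factor 2 in the next lemma. *)
Lemma G2_short_of_long C X Y : G2_long_le C X Y -> G2_short_le (2 * C / 3) X Y.
Proof. by move=> [[? ?] [? ?] [? ?]]; split; split; lra. Qed.

Lemma G2_long_of_short C X Y : G2_short_le C X Y -> G2_long_le (2 * C) X Y.
Proof. by move=> [[? ?] [? ?] [? ?]]; split; split; lra. Qed.

Lemma typeG h : has_order cox h -> generated_by_vertices ip Phi P h.
Proof.
move=> hord; have -> : h = 6%N by apply: has_order_uniq hord G2_order.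
have Phi0 : Phi != fset0 by apply/fset0Pn; exists a.
have tspan := simple_span simp; have tbas : basis_of fullv [:: a; s] by case: simp.
have sa : s != a.
  by apply/eqP => e; move: aa ss0; rewrite e; lra.
have norm d : ip (G2_comb d) (G2_comb d) =
    (d.1 * d.1 * 3 - 3 * d.1 * d.2 + d.2 * d.2)%:~R * ip s s.
  by rewrite /G2_comb !ipE (ipC s a) as_ aa rmorphD rmorphB !rmorphM /=; field.
have norm_long d : d \in G2_long -> ip (G2_comb d) (G2_comb d) = ip a a.
  rewrite norm aa => dl; congr (_ * _); have /allP/(_ d dl)/eqP-> // :
    all (fun d : int * int => d.1 * d.1 * 3 - 3 * d.1 * d.2 + d.2 * d.2 == 3) G2_long by [].
have norm_short d : d \in G2_short -> ip (G2_comb d) (G2_comb d) = ip s s.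
  rewrite norm => dl; rewrite -[RHS]mul1r; congr (_ * _); have /allP/(_ d dl)/eqP-> // :
    all (fun d : int * int => d.1 * d.1 * 3 - 3 * d.1 * d.2 + d.2 * d.2 == 1) G2_short by [].
have conj_norm u x : x \in Phi -> ip u u = ip x x -> (x = a \/ x = s) -> u \in Phi -> weyl_conj ip Phi x u.
  move=> xP ux xas uP; have [y yt yu] := weyl_conj_simple Phi_root Phi_reduced simp uP.
  suff -> : x = y by [].
  case: yu => w Ww wy; have := weyl_isometry Phi_root Ww y y; rewrite wy ux.
  move: yt ss0 aa; rewrite !inE => /orP[]/eqP->; case: xas => -> // ? ? ?;
    (suff : (0 : R) < 0 by rewrite ltxx); lra.
have K1 u : u \in Phi -> ip u u = ip a a -> weyl_conj ip Phi a u.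
  by move=> uP uu; apply: conj_norm => //; left.
have K2 u : u \in Phi -> ip u u = ip s s -> weyl_conj ip Phi s u.
  by move=> uP uu; apply: conj_norm => //; right.
case: (P_alc) => _ [Psi [c [Psub PsiE]]].
have [a0 a0Psi] := alcoved_constraints_neq0 Phi_root P_alc Phi0 PsiE.
have cl1 := @class_bound _ _ _ _ _ Phi_root P_sym Psi c (fun u => ip u u = ip a a) PsiE
  (fun u u' uPsi u'P uu uu' => weyl_conj_trans (weyl_conj_sym Phi_root (K1 u (Psub _ uPsi) uu)) (K1 u' u'P uu')).
have cl2 := @class_bound _ _ _ _ _ Phi_root P_sym Psi c (fun u => ip u u = ip s s) PsiE
  (fun u u' uPsi u'P uu uu' => weyl_conj_trans (weyl_conj_sym Phi_root (K2 u (Psub _ uPsi) uu)) (K2 u' u'P uu')).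
have boundL C1 : (forall y u, P y -> u \in Phi -> ip u u = ip a a -> ip u y <= C1) ->
    forall y, P y -> G2_long_le C1 (ip a y) (ip s y).
  move=> h1 y Py; apply/G2_long_leP => d dl; apply: h1 => //; last exact: norm_long.
  by apply: G2_root; rewrite mem_cat dl.
have boundS C2 : (forall y u, P y -> u \in Phi -> ip u u = ip s s -> ip u y <= C2) ->
    forall y, P y -> G2_short_le C2 (ip a y) (ip s y).
  move=> h2 y Py; apply/G2_short_leP => d dl; apply: h2 => //; last exact: norm_short.
  by apply: G2_root; rewrite mem_cat dl orbT.
have Psi_cases u : u \in Psi -> (exists2 d, d \in G2_long & u = G2_comb d) \/
    (exists2 d, d \in G2_short & u = G2_comb d).
  move=> /Psub/G2_roots[d]; rewrite mem_cat => /orP[dl|ds] ->; [left|right]; by exists d.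
(* The bounds on long and short roots are lowered to what each implies for the other, a class
   without constraints receiving the implied bound. *)
have [la [si [h1 h2 PE]]] : exists la si : R, [/\ 3 * si <= 2 * la, la <= 2 * si
    & forall y, P y <-> G2_long_le la (ip a y) (ip s y) /\ G2_short_le si (ip a y) (ip s y)].
  case: P0 => y0 Py0.
  case: cl1 => [no1|[C1 [C1P C1c]]]; case: cl2 => [no2|[C2 [C2P C2c]]].
  - case: (Psi_cases a0 a0Psi) => -[d dl dE].
      by case: (no1 a0 a0Psi); rewrite dE; apply: norm_long.
    by case: (no2 a0 a0Psi); rewrite dE; apply: norm_short.
  - have [[? ?] _ _] := boundS _ C2P _ Py0.
    exists (2 * C2), C2; split=> //; first by lra.
    move=> y; split=> [Py|[_ y2]].
      by have hs := boundS _ C2P y Py; split=> //; apply: G2_long_of_short.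
    rewrite PsiE => u uPsi; case: (Psi_cases u uPsi) => -[d dl dE].
      by case: (no1 u uPsi); rewrite dE; apply: norm_long.
    rewrite dE; apply: le_trans (_ : C2 <= _); first exact: (G2_short_leP _ _).2 y2 d dl.
    by rewrite -dE; apply: C2c => //; rewrite dE norm_short.
  - have [[? ?] _ _] := boundL _ C1P _ Py0.
    exists C1, (2 * C1 / 3); split; [by lra|by lra|].
    move=> y; split=> [Py|[y1 _]].
      by have hl := boundL _ C1P y Py; split=> //; apply: G2_short_of_long.
    rewrite PsiE => u uPsi; case: (Psi_cases u uPsi) => -[d dl dE]; last first.
      by case: (no2 u uPsi); rewrite dE; apply: norm_short.
    rewrite dE; apply: le_trans (_ : C1 <= _); first exact: (G2_long_leP _ _).2 y1 d dl.
    by rewrite -dE; apply: C1c => //; rewrite dE norm_long.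
  - have [[? ?] _ _] := boundS _ C2P _ Py0; have [[? ?] _ _] := boundL _ C1P _ Py0.
    have [si [si1 si2 si3]] : exists si, [/\ si <= C2, si <= 2 * C1 / 3 & si = C2 \/ si = 2 * C1 / 3].
      by have [le|/ltW le] := leP C2 (2 * C1 / 3); [exists C2|exists (2 * C1 / 3)]; split=> //; auto.
    have si0 : 0 <= si by case: si3 => ->; lra.
    have [la [la1 la2 la3]] : exists la, [/\ la <= C1, la <= 2 * si & la = C1 \/ la = 2 * si].
      by have [le|/ltW le] := leP C1 (2 * si); [exists C1|exists (2 * si)]; split=> //; auto.
    exists la, si; split=> //; first by case: la3 => ->; lra.
    move=> y; split=> [Py|[y1 y2]].
      have hs := boundS _ C2P y Py; have hl := boundL _ C1P y Py.
      have hsi : G2_short_le si (ip a y) (ip s y).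
        by case: si3 => -> //; apply: G2_short_of_long.
      by split=> //; case: la3 => -> //; apply: G2_long_of_short.
    rewrite PsiE => u uPsi; case: (Psi_cases u uPsi) => -[d dl dE]; rewrite dE.
      apply: le_trans (_ : la <= _); first exact: (G2_long_leP _ _).2 y1 d dl.
      by apply: le_trans la1 _; rewrite -dE; apply: C1c => //; rewrite dE norm_long.
    apply: le_trans (_ : si <= _); first exact: (G2_short_leP _ _).2 y2 d dl.
    by apply: le_trans si1 _; rewrite -dE; apply: C2c => //; rewrite dE norm_short.
(* The values solve the system asking that the highest long root 2a + 3s equal [la] and the highest
   short root a + 2s equal [si]. The normalisation makes them nonnegative, so [v0] is a dominant
   point of [P]. *)
have [v0 v0P] := riesz ip (fun y => if y == a then 2 * la - 3 * si else 2 * si - la) tbas.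
have v0a : ip a v0 = 2 * la - 3 * si by rewrite v0P ?eqxx // !inE eqxx.
have v0s : ip s v0 = 2 * si - la by rewrite v0P ?(negPf sa) // !inE eqxx orbT.
have topL : ip (G2_comb (2, 3)) v0 = la by rewrite G2_comb_ip v0a v0s /=; ring.
have topS : ip (G2_comb (1, 2)) v0 = si by rewrite G2_comb_ip v0a v0s /=; ring.
have maxL y : P y -> ip (G2_comb (2, 3)) y <= ip (G2_comb (2, 3)) v0.
  by move=> /PE[/G2_long_leP hl _]; rewrite topL; apply: hl.
have maxS y : P y -> ip (G2_comb (1, 2)) y <= ip (G2_comb (1, 2)) v0.
  by move=> /PE[_ /G2_short_leP hs]; rewrite topS; apply: hs.
have Pv0 : P v0.
  by apply/PE; rewrite v0a v0s; split; split; split; lra.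
have weyl : weyl_group ip Phi cox.
  by apply: weyl_cox => y; rewrite !inE => /orP[]/eqP->.
apply: (@orbit_generation _ _ _ _ _ Phi_root P_sym P_alc cox 6 v0) => //.
- by case: G2_order.
- apply: (vertexP (N := [:: G2_comb (2, 3); G2_comb (1, 2)])) => //.
    move=> y yN; have e1 := yN (G2_comb (2, 3)); have e2 := yN (G2_comb (1, 2)).
    rewrite !inE !eqxx ?orbT in e1 e2; have {}e1 := e1 isT; have {}e2 := e2 isT.
    rewrite !G2_comb_ip /= in e1 e2; apply: (ip_eq0_span (ip := ip) tspan) => u.
    by rewrite !inE => /orP[]/eqP->; lra.
  by move=> u; rewrite !inE => /orP[]/eqP-> y; [apply: maxL|apply: maxS].
(* The long roots and the short roots each form one Coxeter orbit, so one tight root of each length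
   at [v0] is enough. *)
- move=> u /G2_roots[d dr ->].
  have : all (fun d => has (fun k => iter k G2_cox d \in [:: (2, 3); (1, 2)]) (iota 0 6))
    (G2_long ++ G2_short) by [].
  move=> /allP/(_ d dr)/hasP[k _ kd]; exists k => y Py; rewrite G2_comb_cox.
  by move: kd; rewrite !inE => /orP[]/eqP->; [apply: maxL|apply: maxS].
- move=> Pn k kh e.
  have si0 : 0 < si.
    rewrite lt_neqAle (_ : 0 <= si) ?andbT; last by lra.
    apply/eqP => si0; apply: Pn; apply/seteqP; split=> y /=.
      move=> /PE[_ [[? ?] [? ?] _]]; apply: (ip_eq0_span (ip := ip) tspan) => u.
      by rewrite !inE => /orP[]/eqP->; lra.
    by move=> ->; apply/PE; rewrite !ip0r; split; split; split; lra.
  (* If a proper power fixed [v0], the images of the two highest roots would again take the values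
     [la] and [si] there, which contradicts [si > 0] for each of the five powers. *)
  have iso := weyl_isometry Phi_root (weyl_iter k weyl).
  have := iso (G2_comb (2, 3)) v0; have := iso (G2_comb (1, 2)) v0.
  rewrite e !G2_comb_cox topL topS !G2_comb_ip v0a v0s.
  case: k kh {e iso} => [|[|[|[|[|[|]]]]]] //= _; rewrite ?rmorphN /= => e1 e2;
    (suff : (0 : R) < 0 by rewrite ltxx); lra.
Qed.

End TypeG.

(** * Recognising type F_4, and the assembly of all types *)

Lemma F4_diagram (R : realType) (V : vectType R) (ip : {dot V for idfun})
    (Phi : {fset V}) (p q u w : V) :
  bond ip p q -> bond ip u w -> ip q q = 2 * ip u u -> ip q u = - ip q q / 2 ->
  ip p u = 0 -> ip p w = 0 -> ip q w = 0 -> u != 0 ->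
  simple_system Phi [:: p; q; u; w] -> type_F4 ip Phi.
Proof.
move=> [pp pq] [ww uw] qq qu pu pw qw u0 simp.
have uu : ip u u != 0 by rewrite gt_eqF // ip_gt0.
exists [:: p; q; u; w]; split=> //; first exact: simple_system_roots.
rewrite pp qq in pq; rewrite qq in pp qu; rewrite /cartan_number.
case=> [|[|[|[|//]]]]; case=> [|[|[|[|//]]]] _ _; rewrite /= ?rmorphN /=;
  rewrite ?[ip q p]ipC ?[ip u p]ipC ?[ip w p]ipC ?[ip u q]ipC ?[ip w q]ipC ?[ip w u]ipC;
  rewrite ?(pp, pq, qq, qu, pu, pw, qw, uw) -?ww ?mulr0 ?mul0r //; by field.
Qed.

Theorem theorem4p3 (R : realType) (V : vectType R) (ip : {dot V for idfun})
    (Phi : {fset V}) (h : nat) (P : set V)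
    (Phi_root : root_system ip Phi)
    (Phi_reduced : reduced Phi)
    (Phi_irreducible : irreducible ip Phi)
    (Phi_notF4 : ~ type_F4 ip Phi)
    (h_coxeter : coxeter_number ip Phi h)
    (P_nonempty : (P !=set0)%classic)
    (P_alcoved : alcoved_polytope ip Phi P)
    (P_symmetric : weyl_symmetric ip Phi P) :
  exists v : 'I_h -> V,
    [/\ (forall i, vertex ip P (v i)),
        generating_set ip Phi P (range v)
      & P <> [set 0]%classic -> injective v].
Proof.
case: h_coxeter => b [/simple_roots_system bP hord].
have b0 : b != [::].
  apply/eqP => b_nil; case: Phi_irreducible => /eqP/fset0Pn[a aP] _.
  case: bP => _ _ /(_ a aP)[k]; rewrite b_nil big_nil oppr0.
  by have := root_neq0 Phi_root aP; case: eqP => // ? _ [].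
have [t [tb tr dyn]] := dynkin_classification (simple_uniq bP)
  (simple_neq0 Phi_root bP) (simple_dual ip bP)
  (simple_bond Phi_root bP) (simple_connected Phi_root Phi_reduced bP Phi_irreducible) b0.
have ut : uniq t by rewrite (perm_uniq tb) (simple_uniq bP).
(* The Coxeter number is given for one ordering of the simple roots, while each type needs its own.
   The diagram being a tree, the Coxeter elements of all orderings are conjugate and have the same
   order. *)
have tsys t' : perm_eq t t' ->
    simple_system Phi t' /\ has_order (coxeter_element ip t') h.
  move=> tt'; have bt' : perm_eq b t' by rewrite perm_sym in tb; apply: perm_trans tb tt'.
  split; first exact: simple_system_perm bt' bP.
  apply: has_order_conj hord; apply: word_equiv_conjugate.
    exact: (simple_neq0 Phi_root bP).
  apply: WordTrans (tree_words tr ut tt').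
  by apply: WordSym; apply: tree_words.
case: dyn => [z L ar|z L x mu|z L x y fk|z L x y y' fk sL|z x y x' mu|z x mu] /[dup] tE /tsys[simp ord].
- exact: typeA ar simp ord.
- exact: typeBC mu simp ord.
- exact: typeD fk simp ord.
- exact: typeE fk sL simp ord.
- case: Phi_notF4; case: mu => _ bzx [[bzy _ _] [bxx' _ _]] o1 o2.
  have [zn xn] : z != 0 /\ x != 0.
    by split; apply: (simple_neq0 Phi_root simp); rewrite !inE eqxx ?orbT.
  have zx' : ip z x' = 0 by apply: o1; rewrite !inE eqxx ?orbT.
  have yx' : ip y x' = 0 by apply: o1; rewrite !inE eqxx ?orbT.
  have yx : ip y x = 0 by apply: o2; rewrite !inE eqxx ?orbT.
  case: bzx => -[e1 e2].
    exact: (F4_diagram (bondC bzy) bxx' e1 e2 yx yx' zx' xn simp).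
  (* Here the longer end of the double bond is [x]; reading the chain backwards puts the long roots
     first, as in the Cartan matrix of F_4. *)
  have tE' : perm_eq t [:: x'; x; z; y] by perm_by_count tE.
  have [simp' _] := tsys _ tE'.
  by apply: (F4_diagram (bondC bxx') bzy e1 _ _ _ _ zn simp'); rewrite 1?ipC.
- case: mu => _ bzx _ _ _; case: bzx => -[e1 e2].
    exact: (typeG Phi_root Phi_reduced P_symmetric P_alcoved P_nonempty e1 e2 simp ord).
  have tE' : perm_eq t [:: x; z] by perm_by_count tE.
  have [simp' ord'] := tsys _ tE'; rewrite ipC in e2.
  exact: (typeG Phi_root Phi_reduced P_symmetric P_alcoved P_nonempty e1 e2 simp' ord').
Qed.
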